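(* Let $a\in\mathbb Z_+=\{0,1,2,\dots\}$ and $b\ge0$ be such that either (i) $a=b=0$ or (ii) $\gamma a+b>0$ holds. Assume $$0<\delta<\min\{\tfrac12,\gamma a+b\}\ \text{ if }\gamma a+b>0,\qquad 0<\delta<\min\{\tfrac12,\gamma\}\ \text{ if }a=b=0 .$$ Then there exists a constant $N=N(d,a,b,\gamma,\nu,\delta)$ such that $$\sup_{s<t}\int_{\mathbb R^d}\Big||x|^{\frac d2+\delta}q_{a,b}(s,t,x)\Big|^2dx\le N .$$
   Context: Standing assumptions: $d\in\mathbb N$, $\gamma\in(0,\infty)$, $\nu>0$, and $\psi:\mathbb R\times\mathbb R^d\to\mathbb C$ is measurable with $\Re[\psi(t,\xi)]\le-\nu|\xi|^\gamma$ for all $(t,\xi)$ and $|D_\xi^\alpha\psi(t,\xi)|\le\nu^{-1}|\xi|^{\gamma-|\alpha|}$ for all $t\in\mathbb R$, $\xi\neq0$, $|\alpha|\le\lfloor d/2\rfloor+1$. For $s<t$, $$q_{a,b}(s,t,x)=\mathcal F^{-1}\Big[\big((t-s)\psi(t,(t-s)^{-1/\gamma}\xi)\big)^a|\xi|^b\exp\Big(\int_s^t\psi(r,(t-s)^{-1/\gamma}\xi)\,dr\Big)\Big](x),$$ where $\mathcal F^{-1}[g](x)=(2\pi)^{-d}\int_{\mathbb R^d}e^{i\xi\cdot x}g(\xi)\,d\xi$. (A zeroth power is $1$.) *)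

(* Defs.v *)
From HB Require Import structures.
From mathcomp Require Import all_boot all_order all_algebra.
From mathcomp Require Import all_classical all_reals all_analysis.
From mathcomp Require Import complex.
Set Implicit Arguments.
Unset Strict Implicit.
Unset Printing Implicit Defensive.
Import Order.TTheory GRing.Theory Num.Theory.
Import numFieldNormedType.Exports.
Local Open Scope classical_set_scope.
Local Open Scope ring_scope.
Local Open Scope complex_scope.

(* The product (= Borel) sigma-algebra on the row vectors 'rV[R]_n, generated
   by the coordinate maps, as the library does for n.-tuple R. *)
Section measurable_rV.
Context {R : realType}.
Variable n : nat.

Let coords : 'I_n -> 'rV[R]_n -> R := fun i x => x ord0 i.

Let rV_set0 : g_sigma_preimage coords set0.
Proof. exact: sigma_algebra0. Qed.

Let rV_setC A : g_sigma_preimage coords A -> g_sigma_preimage coords (~` A).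
Proof. exact: sigma_algebraC. Qed.

Let rV_bigcup (F : _^nat) : (forall i, g_sigma_preimage coords (F i)) ->
  g_sigma_preimage coords (\bigcup_i (F i)).
Proof. exact: sigma_algebra_bigcup. Qed.

HB.instance Definition _ := @isMeasurable.Build default_measure_display
  'rV[R]_n (g_sigma_preimage coords) rV_set0 rV_setC rV_bigcup.

End measurable_rV.

Section measurable_rV_theory.
Context {R : realType}.

Lemma measurable_coord n (i : 'I_n) :
  measurable_fun [set: 'rV[R]_n] (fun x : 'rV[R]_n => x ord0 i).
Proof.
move=> _ Y mY; rewrite setTI; apply: sub_sigma_algebra => /=.
rewrite -bigcup_seq/=; exists i => /=; first by rewrite mem_index_enum.
by exists Y => //; rewrite setTI.
Qed.

Lemma measurable_fun_rVP d (T : measurableType d) n (f : T -> 'rV[R]_n) :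
  measurable_fun [set: T] f <->
  forall i, measurable_fun [set: T] (fun x => f x ord0 i).
Proof.
split=> [mf i|mf].
  exact: (measurableT_comp (@measurable_coord n i) mf).
pose c (i : 'I_n) (x : 'rV[R]_n) : R := x ord0 i.
suff prefS : g_sigma_preimage (fun i => c i \o f) `<=` measurable.
  by move: prefS; rewrite g_sigma_preimage_comp => + _ A mA; apply; exists A.
apply: smallest_sub; first exact: sigma_algebra_measurable.
case: n => [|n] in f mf c *; first by rewrite big_ord0.
by rewrite -bigcup_mkord_ord; apply: bigcup_sub => i Ii A [B mB <-]; exact: mf.
Qed.

Definition rV_cons n (p : R * 'rV[R]_n) : 'rV[R]_n.+1 :=
  \row_(i < n.+1) if unlift ord0 i is Some j then p.2 ord0 j else p.1.

Definition rV_uncons n (x : 'rV[R]_n.+1) : R * 'rV[R]_n :=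
  (x ord0 ord0, \row_(i < n) x ord0 (lift ord0 i)).

Lemma rV_cons0 n (p : R * 'rV[R]_n) : rV_cons p ord0 ord0 = p.1.
Proof. by rewrite mxE unlift_none. Qed.

Lemma rV_consS n (p : R * 'rV[R]_n) i :
  rV_cons p ord0 (lift ord0 i) = p.2 ord0 i.
Proof. by rewrite mxE liftK. Qed.

Lemma rV_consK n : cancel (@rV_cons n) (@rV_uncons n).
Proof.
move=> [a v]; rewrite /rV_uncons rV_cons0; congr pair.
by apply/rowP => i; rewrite mxE rV_consS.
Qed.

Lemma rV_unconsK n : cancel (@rV_uncons n) (@rV_cons n).
Proof.
move=> x; apply/rowP => i.
by case: (unliftP ord0 i) => [j|] ->; rewrite ?rV_consS ?rV_cons0 //= mxE.
Qed.

Lemma measurable_rV_cons n :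
  measurable_fun [set: measurableTypeR R * 'rV[R]_n] (@rV_cons n).
Proof.
apply/measurable_fun_rVP => i; case: (unliftP ord0 i) => [j|] ->.
  under eq_fun do rewrite rV_consS.
  exact: (measurableT_comp (measurable_coord j) measurable_snd).
under eq_fun do rewrite rV_cons0.
exact: measurable_fst.
Qed.

Lemma measurable_rV_uncons n :
  measurable_fun [set: 'rV[R]_n.+1]
    (@rV_uncons n : _ -> (measurableTypeR R * 'rV[R]_n)%type).
Proof.
apply/measurable_fun_pairP; split; first exact: (measurable_coord ord0).
apply/measurable_fun_rVP => i; rewrite /=.
under eq_fun do rewrite mxE.
exact: measurable_coord.
Qed.

End measurable_rV_theory.

(* The pushforward of lebesgue_measure \x m under (a, v) |-> [a, v], the induction step of
   the construction of the Lebesgue measure on 'rV[R]_n. *)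
Section cons_measure.
Context {R : realType}.
Variables (n : nat) (m : {sigma_finite_measure set 'rV[R]_n -> \bar R}).

Definition cons_measure : set 'rV[R]_n.+1 -> \bar R :=
  pushforward (@lebesgue_measure R \x m)%E (@rV_cons R n).

Let cons_measureE : {measure set 'rV[R]_n.+1 -> \bar R} :=
  measure_function_pushforward__canonical__measure_function_Measure
    ((@lebesgue_measure R \x m)%E :
      {measure set (measurableTypeR R * 'rV[R]_n) -> \bar R})
    (@measurable_rV_cons R n).

HB.instance Definition _ := isMeasure.Build _ _ _ cons_measure
  (measure0 cons_measureE) (measure_ge0 cons_measureE)
  (@measure_semi_sigma_additive _ _ _ cons_measureE).

Let cons_measure_sigma_finite : sigma_finite setT cons_measure.
Proof.
have /sigma_finiteP[F [TF ndF Foo]] := sigma_finiteT (@lebesgue_measure R).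
have /sigma_finiteP[G [TG ndG Goo]] := sigma_finiteT m.
exists (fun k => @rV_uncons R n @^-1` (F k `*` G k)).
  apply/seteqP; split=> // x _.
  have [i _ Fi] : (\bigcup_k F k) (rV_uncons x).1 by rewrite -TF.
  have [j _ Gj] : (\bigcup_k G k) (rV_uncons x).2 by rewrite -TG.
  exists (maxn i j) => //; split.
    by move: Fi; exact/subsetPset/ndF/leq_maxl.
  by move: Gj; exact/subsetPset/ndG/leq_maxr.
move=> k; have [mF Fk] := Foo k; have [mG Gk] := Goo k; split.
  rewrite -[X in measurable X]setTI; apply: measurable_rV_uncons => //.
  exact: measurableX.
rewrite /cons_measure /pushforward -comp_preimage.
rewrite (_ : _ \o _ = id); last by apply/funext => x /=; rewrite rV_consK.
by rewrite preimage_id product_measure1E// lte_mul_pinfty// ge0_fin_numE.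
Qed.

HB.instance Definition _ := Measure_isSigmaFinite.Build _ _ _ cons_measure
  cons_measure_sigma_finite.

End cons_measure.

Fixpoint lebesgue_rV {R : realType} (n : nat) :
    {sigma_finite_measure set 'rV[R]_n -> \bar R} :=
  if n is n'.+1 then cons_measure (lebesgue_rV n') else \d_(0 : 'rV[R]_0).

Lemma lebesgue_rV_box {R : realType} (n : nat) (A : 'I_n -> set R) :
  (forall i, measurable (A i)) ->
  lebesgue_rV n [set x : 'rV[R]_n | forall i, A i (x ord0 i)] =
  (\prod_(i < n) @lebesgue_measure R (A i))%E.
Proof.
elim: n A => [|n ih] A mA.
  by rewrite big_ord0 /= diracE mem_set// => -[].
have mB : measurable [set x : 'rV[R]_n | forall i, A (lift ord0 i) (x ord0 i)].
  rewrite (_ : [set x | _] = \bigcap_(i in [set: 'I_n])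
      ((fun x : 'rV[R]_n => x ord0 i) @^-1` A (lift ord0 i))); last first.
    by apply/seteqP; split=> x /= Ax i; [move=> _; exact: Ax|exact: Ax].
  apply: fin_bigcap_measurable => // i _; rewrite -[X in measurable X]setTI.
  exact: measurable_coord.
rewrite big_ord_recl -ih//= -product_measure1E// /cons_measure /pushforward.
congr (_ _); apply/seteqP; split=> -[a v] /= Av.
  split=> /=; first by have := Av ord0; rewrite rV_cons0.
  by move=> i; have := Av (lift ord0 i); rewrite rV_consS.
  by case: Av => /= Aa Av i; case: (unliftP ord0 i) => [j|] ->;
    rewrite ?rV_consS ?rV_cons0.
exact: mA.
Qed.

Section complex_analysis.
Context {R : realType}.
Implicit Types z : R[i].

Definition cexp z : R[i] :=
  (expR (complex.Re z) * cos (complex.Im z)) +i*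
  (expR (complex.Re z) * sin (complex.Im z)).

Definition cmeasurable_fun d (T : measurableType d) (D : set T)
    (f : T -> R[i]) : Prop :=
  measurable_fun D (fun x => complex.Re (f x)) /\
  measurable_fun D (fun x => complex.Im (f x)).

(* Rintegral is 0 for a real function whose integral is undefined or infinite,
   so cintegral is the integral of f only when f is integrable on D. *)
Definition cintegral d (T : measurableType d)
    (mu : {measure set T -> \bar R}) (D : set T) (f : T -> R[i]) : R[i] :=
  (\int[mu]_(x in D) complex.Re (f x)) +i*
  (\int[mu]_(x in D) complex.Im (f x)).

Definition cderivable (V : normedModType R) (f : V -> R[i]) (x v : V) : Prop :=
  derivable (fun y => complex.Re (f y)) x v /\
  derivable (fun y => complex.Im (f y)) x v.

Definition cderive (V : normedModType R) (f : V -> R[i]) (x v : V) : R[i] :=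
  'D_v (fun y => complex.Re (f y)) x +i* 'D_v (fun y => complex.Im (f y)) x.

End complex_analysis.

Section symbols.
Context {R : realType} {d : nat}.
Implicit Types (x y xi : 'rV[R]_d) (psi : R -> 'rV[R]_d -> R[i]).

Definition dotrV x y : R := \sum_(i < d) x ord0 i * y ord0 i.

(* The norm the library puts on 'rV[R]_d is the sup norm. *)
Definition enorm x : R := Num.sqrt (dotrV x x).

(* The iterated partial derivative of f in the coordinate directions listed by
   s: this is D^alpha f for the multi-index alpha with alpha_i the number of
   occurrences of i in s, and |alpha| = size s. The order of s is immaterial
   when f is of class C^(size s), which is_symbol does not assume: it asks for
   the derivatives and their bounds along every s. *)
Fixpoint partials (s : seq 'I_d) (f : 'rV[R]_d -> R[i]) : 'rV[R]_d -> R[i] :=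
  if s is i :: s' then
    fun xi => cderive (partials s' f) xi (delta_mx ord0 i)
  else f.

Record is_symbol (gamma nu : R) psi : Prop := IsSymbol {
  symbol_measurable :
    cmeasurable_fun [set: R * 'rV[R]_d] (fun p => psi p.1 p.2) ;
  symbol_elliptic : forall t xi,
    complex.Re (psi t xi) <= - nu * enorm xi `^ gamma ;
  symbol_derivable : forall t xi i (s : seq 'I_d), xi != 0 ->
    (size (i :: s) <= d./2.+1)%N ->
    cderivable (partials s (psi t)) xi (delta_mx ord0 i) ;
  symbol_bound : forall t xi (s : seq 'I_d), xi != 0 ->
    (size s <= d./2.+1)%N ->
    Normc.normc (partials s (psi t) xi) <=
      nu^-1 * enorm xi `^ (gamma - (size s)%:R)
}.

Definition inv_fourier (g : 'rV[R]_d -> R[i]) x : R[i] :=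
  ((2 * pi) ^- d)%:C *
  cintegral (lebesgue_rV d) setT (fun xi => cexp (0 +i* dotrV xi x) * g xi).

Definition qker psi (gamma : R) (a : nat) (b s t : R) : 'rV[R]_d -> R[i] :=
  inv_fourier (fun xi =>
    let eta := (t - s) `^ (- gamma^-1) *: xi in
    ((t - s)%:C * psi t eta) ^+ a * (enorm xi `^ b)%:C *
    cexp (cintegral lebesgue_measure `[s, t] (fun r => psi r eta))).

End symbols.

(* Main.v *)
(* Let m = floor(d/2) + 1 and pick delta < sigma < 1/2 with sigma < gamma a + b (resp.
   sigma < gamma if a = b = 0). The Fourier integrand g of q_(a,b) satisfies
   |g - c| <= C |xi|^sigma with c = 0 (resp. c = 1), and its m-th derivative along a
   coordinate line is O(|xi|^(sigma - m)), uniformly in psi, s and t: rescaling by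
   (t - s)^(-1/gamma) makes the bounds on the exponent independent of s and t, and the
   ellipticity of psi absorbs every surplus power of |xi|. Hence the m-th difference of g
   with step h has squared L^2 norm O(h^(d + 2 sigma)), because 2 m > d + 2 sigma.
   On the Fourier side this difference multiplies the transform by (e^(-i h x_i) - 1)^m,
   which has modulus at least 1 where pi/2 <= |h x_i| <= pi, so Bessel's inequality
   bounds the L^2 mass of the transform on the dyadic shell |x| ~ 2^j by
   O(2^(-j (d + 2 sigma))), and summing against |x|^(d + 2 delta) converges. *)
Require Import Defs.
From mathcomp Require Import all_boot all_order all_algebra.
From mathcomp Require Import all_classical all_reals all_analysis.
From mathcomp Require Import measurable_realfun.
From mathcomp Require Import complex.
From mathcomp Require Import ring lra.
Import Order.TTheory GRing.Theory Num.Theory.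
Import numFieldNormedType.Exports.
Local Open Scope classical_set_scope.
Local Open Scope ring_scope.
Local Open Scope complex_scope.
Set Implicit Arguments.
Unset Strict Implicit.
Unset Printing Implicit Defensive.

Lemma gt0_powRD (R : realType) (x r s : R) : 0 < x ->
  x `^ (r + s) = x `^ r * x `^ s.
Proof. by move=> x0; rewrite powRD // (gt_eqF x0) implybT. Qed.

Lemma ge0_integral_lebesgue_shift (R : realType) (c : R) (F : R -> \bar R) :
  measurable_fun setT F -> (forall x, 0 <= F x)%E ->
  (\int[lebesgue_measure]_x F (x + c)%R = \int[lebesgue_measure]_x F x)%E.
Proof.
move=> mF F0.
have mS : measurable_fun [set: measurableTypeR R]
    (fun x : measurableTypeR R => x + c : measurableTypeR R).
  by apply: measurable_funD => //; exact: measurable_cst.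
transitivity (\int[pushforward (@lebesgue_measure R)
    (fun x : measurableTypeR R => (x + c)%R : measurableTypeR R)]_x F x)%E.
  apply/esym; apply: (@ge0_integral_pushforward _ _ _ _ R _ mS lebesgue_measure
    setT F measurableT mF).
  by move=> y _.
pose nu := measure_function_pushforward__canonical__measure_function_Measure
  (@lebesgue_measure R) mS.
apply/esym; apply: (@eq_measure_integral _ _ _ setT nu) => A mA _.
apply: lebesgue_measure_unique => // X [[a b] _ <-]; rewrite /nu /= /pushforward.
rewrite (_ : _ @^-1` _ = `]a - c, b - c]%classic).
  rewrite !lebesgue_measure_itv/= !lte_fin ltrD2r; case: ifPn => // _.
  by rewrite -!EFinB; congr EFin; ring.
by apply/seteqP; split=> x /=; rewrite !in_itv/= ltrBlDr lerBrDr.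
Qed.

Lemma measurable_fun_rV_cons2 (R : realType) d (T : measurableType d) n
    (F : 'rV[R]_n.+1 -> T) (a : R) :
  measurable_fun setT F -> measurable_fun setT (fun v => F (rV_cons (a, v))).
Proof.
move=> mF; apply: measurableT_comp => //.
apply: (measurableT_comp (@measurable_rV_cons R n)).
exact: (pair1_measurable (a : measurableTypeR R)).
Qed.

Lemma ge0_integral_lebesgue_rVS (R : realType) n (F : 'rV[R]_n.+1 -> \bar R) :
  measurable_fun setT F -> (forall x, 0 <= F x)%E ->
  (\int[lebesgue_rV n.+1]_x F x =
   \int[lebesgue_measure]_a \int[lebesgue_rV n]_v F (rV_cons (a, v)))%E.
Proof.
move=> mF F0.
transitivity (\int[(@lebesgue_measure R \x lebesgue_rV n)%E]_p F (rV_cons p))%E.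
  have := @ge0_integral_pushforward _ _ _ _ R _ (@measurable_rV_cons R n)
    (@lebesgue_measure R \x lebesgue_rV n)%E setT F measurableT mF.
  by apply => y _.
rewrite fubini_tonelli1 //.
exact: (measurableT_comp mF (@measurable_rV_cons R n)).
Qed.

Lemma rV_consD (R : realType) n (p q : R * 'rV[R]_n) :
  rV_cons (p.1 + q.1, p.2 + q.2) = rV_cons p + rV_cons q.
Proof.
apply/rowP => i; rewrite [RHS]mxE; case: (unliftP ord0 i) => [j|] ->.
  by rewrite !rV_consS [LHS]mxE.
by rewrite !rV_cons0.
Qed.

Lemma measurable_fun_rV_shift (R : realType) n (c : 'rV[R]_n) :
  measurable_fun setT (fun x : 'rV[R]_n => x + c).
Proof.
apply/measurable_fun_rVP => i; under eq_fun do rewrite mxE.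
by apply: measurable_funD; [exact: measurable_coord|exact: measurable_cst].
Qed.

Lemma ge0_integral_rV_shift (R : realType) n (c : 'rV[R]_n)
    (F : 'rV[R]_n -> \bar R) :
  measurable_fun setT F -> (forall x, 0 <= F x)%E ->
  (\int[lebesgue_rV n]_x F (x + c)%R = \int[lebesgue_rV n]_x F x)%E.
Proof.
elim: n c F => [|n ih] c F mF F0.
  apply: eq_integral => x _; congr F.
  by rewrite [LHS]thinmx0 [RHS]thinmx0.
rewrite !ge0_integral_lebesgue_rVS //; last first.
  exact: (measurableT_comp mF (@measurable_fun_rV_shift _ _ c)).
have mG : measurable_fun setT (fun a : measurableTypeR R =>
    \int[lebesgue_rV n]_v F (rV_cons (a, v)))%E.
  apply: (@measurable_fun_fubini_tonelli_F _ _ (measurableTypeR R) 'rV[R]_n R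
    (lebesgue_rV n) (F \o @rV_cons R n)) => [|p]; last exact: F0.
  exact: (measurableT_comp mF (@measurable_rV_cons R n)).
transitivity (\int[lebesgue_measure]_(a in setT)
   \int[lebesgue_rV n]_v F (rV_cons ((a + (rV_uncons c).1)%R, v)))%E.
  apply: eq_integral => a _.
  rewrite -(ih (rV_uncons c).2 (fun v => F (rV_cons (a + (rV_uncons c).1, v)))) //.
    apply: eq_integral => v _; congr F.
    by rewrite (rV_consD (a, v) (rV_uncons c)) rV_unconsK.
  exact: measurable_fun_rV_cons2.
rewrite (@ge0_integral_lebesgue_shift R (rV_uncons c).1
  (fun a => \int[lebesgue_rV n]_v F (rV_cons (a, v)))%E) //.
by move=> a; exact: integral_ge0.
Qed.

Lemma integral_rV_shift (R : realType) n (c : 'rV[R]_n) (F : 'rV[R]_n -> \bar R) :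
  measurable_fun setT F ->
  (\int[lebesgue_rV n]_x F (x + c)%R = \int[lebesgue_rV n]_x F x)%E.
Proof.
move=> mF; rewrite integralE [RHS]integralE; congr (_ - _)%E.
  rewrite -[RHS](ge0_integral_rV_shift c (measurable_funepos mF)) //.
  by apply: eq_integral => x _; rewrite !funeposE.
rewrite -[RHS](ge0_integral_rV_shift c (measurable_funeneg mF)) //.
by apply: eq_integral => x _; rewrite !funenegE.
Qed.

Lemma ge0_integral_bigcup_le d (T : measurableType d) (R : realType)
    (mu : {measure set T -> \bar R}) (F : nat -> set T) (f : T -> \bar R) :
  (forall k, measurable (F k)) -> measurable_fun setT f ->
  (forall x, 0 <= f x)%E ->
  (\int[mu]_(x in \bigcup_k F k) f x <= \sum_(k <oo) \int[mu]_(x in F k) f x)%E.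
Proof.
move=> mF mf f0; rewrite seqDU_bigcup_eq.
have mD k : measurable (seqDU F k).
  apply: measurableD => //; exact: bigsetU_measurable.
rewrite ge0_integral_bigcup //; last exact: measurable_funTS.
apply: lee_nneseries => k _; first by move=> _; exact: integral_ge0.
apply: ge0_subset_integral => //; first exact: measurable_funTS.
by move=> x [].
Qed.

Lemma nneseries_le_geometric (R : realType) (u : nat -> \bar R) (c z : R) :
  0 <= c -> 0 <= z < 1 -> (forall k, 0 <= u k)%E ->
  (forall k, u k <= (c * z ^+ k)%:E)%E ->
  (\sum_(k <oo) u k <= (c / (1 - z))%:E)%E.
Proof.
move=> c0 /andP[z0 z1] u0 uz.
apply: (@le_trans _ _ (\sum_(k <oo) (c * z ^+ k)%:E)%E).
  by apply: lee_nneseries => k *.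
rewrite le_eqVlt; apply/orP; left; apply/eqP/cvg_lim => //.
under eq_fun do rewrite sumEFin.
apply: cvg_EFin; first exact: nearW.
by apply: cvg_geometric_series; rewrite ger0_norm.
Qed.

Lemma exists_dyadic (R : realType) (y : R) : 1 <= y ->
  exists k, 2 ^+ k <= y < 2 ^+ k.+1.
Proof.
move=> y1; have y0 : 0 <= y by apply: le_trans y1.
have /andP[ny yn] := Num.Theory.truncn_itv y0.
set n := Num.trunc y in ny yn.
have n0 : (0 < n)%N by rewrite Num.Theory.truncn_gt0.
have /andP[kn nk] := @trunc_log_bounds 2 n isT n0.
exists (trunc_log 2 n); apply/andP; split.
  by apply: le_trans ny; rewrite -natrX ler_nat.
by apply: lt_le_trans yn _; rewrite -natrX ler_nat.
Qed.

Lemma integral_layer_cake_le (R : realType) (D q : R) : 0 <= D -> D < q ->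
  exists2 K : R, 0 <= K & forall d (T : measurableType d)
    (mu : {measure set T -> \bar R}) (N : T -> R) (A rho : R),
  measurable_fun setT N -> 0 <= A -> 0 < rho ->
  (forall r : R, 0 < r -> (mu [set x | (N x <= r)%R] <= (A * r `^ D)%:E)%E) ->
  (\int[mu]_(x in [set x | (rho <= N x)%R]) (N x `^ (- q))%:E
    <= (K * A * rho `^ (D - q))%:E)%E.
Proof.
move=> D0 Dq; pose z : R := 2 `^ (D - q).
have z0 : 0 < z by apply: powR_gt0.
have z1 : z < 1.
  rewrite /z /powR pnatr_eq0 /= expR_lt1 nmulr_rlt0 ?subr_lt0 //.
  by rewrite ln_gt0 // ltr1n.
have q0 : 0 <= q by apply: le_trans (ltW Dq).
exists (2 `^ D / (1 - z)).
  by rewrite divr_ge0 ?powR_ge0 // subr_ge0 ltW.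
move=> d T mu N A rho mN A0 rho0 HA.
pose S k := [set x | (2 ^+ k * rho <= N x <= 2 ^+ k.+1 * rho)%R].
have mS k : measurable (S k).
  rewrite (_ : S k = N @^-1` `[2 ^+ k * rho, 2 ^+ k.+1 * rho]%classic).
    by rewrite -[X in measurable X]setTI; apply: mN => //; exact: measurable_itv.
  by apply/seteqP; split=> x /=; rewrite in_itv.
have mf : measurable_fun setT (fun x => (N x `^ (- q))%:E).
  apply/measurable_EFinP.
  exact: (measurableT_comp (measurable_powR _) mN).
have -> : [set x | (rho <= N x)%R] = \bigcup_k S k.
  apply/seteqP; split=> [x /= rx|x [k _ /andP[+ _]] /=].
    have [|k /andP[k1 k2]] := @exists_dyadic _ (N x / rho).
      by rewrite ler_pdivlMr // mul1r.
    exists k => //=; rewrite /S /= -ler_pdivlMr // k1 /=.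
    by rewrite -ler_pdivrMr // ltW.
  apply: le_trans; rewrite ler_peMl ?(ltW rho0) //.
  by apply: exprn_ege1; rewrite ler1n.
apply: le_trans (ge0_integral_bigcup_le mu mS mf _) _.
  by move=> x; rewrite lee_fin powR_ge0.
apply: le_trans (@nneseries_le_geometric _ _
  (2 `^ D * A * rho `^ (D - q)) z _ _ _ _) _.
- by rewrite !mulr_ge0 ?powR_ge0.
- by rewrite ltW.
- by move=> k; apply: integral_ge0 => x _; rewrite lee_fin powR_ge0.
- move=> k; set a := 2 ^+ k * rho.
  have a0 : 0 < a by rewrite mulr_gt0 // exprn_gt0.
  apply: (@le_trans _ _ (\int[mu]_(x in S k) (a `^ (- q))%:E)%E).
    apply: ge0_le_integral => //.
    - by move=> x _; rewrite lee_fin powR_ge0.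
    - exact: measurable_funTS.
    - move=> x /andP[ax _]; rewrite lee_fin !powRN lef_pV2 ?posrE ?powR_gt0 //.
        by apply: ge0_ler_powR => //; rewrite nnegrE ltW // (lt_le_trans a0).
      exact: lt_le_trans ax.
  rewrite integral_cst //.
  apply: (@le_trans _ _ ((a `^ (- q))%:E * (A * (2 * a) `^ D)%:E)%E).
    rewrite lee_pmul2l //; last by rewrite lte_fin powR_gt0.
    apply: le_trans _ (HA _ _); last by rewrite mulr_gt0.
    apply: le_measure; rewrite ?inE //.
      rewrite -[X in measurable X]setTI (_ : [set _ | _] = N @^-1` `]-oo, 2 * a]%classic).
        by apply: mN => //; exact: measurable_itv.
      by apply/seteqP; split=> x /=; rewrite in_itv.
    by move=> x /andP[_] /=; rewrite exprS mulrA.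
  rewrite -EFinM lee_fin powRM ?(ltW a0) //.
  rewrite [leLHS](_ : _ = 2 `^ D * A * (a `^ (- q) * a `^ D)); last by ring.
  rewrite -gt0_powRD //.
  rewrite (addrC (- q)) /a powRM ?(ltW rho0) ?exprn_ge0 //.
  rewrite -powR_mulrn // -powRrM /z -[X in _ <= X * _ ^+ _]mulrA.
  rewrite -(powR_mulrn _ (powR_ge0 _ _)) -powRrM [(D - q) * _]mulrC.
  by rewrite le_eqVlt; apply/orP; left; apply/eqP; ring.
by rewrite lee_fin le_eqVlt; apply/orP; left; apply/eqP; ring.
Qed.

Lemma measurable_cos (R : realType) : measurable_fun [set: R] (@cos R).
Proof. by apply: continuous_measurable_fun; exact: continuous_cos. Qed.

Lemma measurable_sin (R : realType) : measurable_fun [set: R] (@sin R).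
Proof. by apply: continuous_measurable_fun; exact: continuous_sin. Qed.

Lemma le_integrableR d (T : measurableType d) (R : realType)
    (mu : {measure set T -> \bar R}) (D : set T) (f g : T -> R) :
  measurable D -> measurable_fun D f -> (forall x, D x -> `|f x| <= g x) ->
  mu.-integrable D (EFin \o g) -> mu.-integrable D (EFin \o f).
Proof.
move=> mD mf fg; apply: le_integrable => //; first exact/measurable_EFinP.
by move=> x Dx; rewrite /= lee_fin (le_trans (fg _ Dx)) // ler_norm.
Qed.

Lemma EFin_Rintegral d (T : measurableType d) (R : realType)
    (mu : {measure set T -> \bar R}) (D : set T) (f : T -> R) :
  measurable D -> mu.-integrable D (EFin \o f) ->
  (\int[mu]_(x in D) f x)%:E = (\int[mu]_(x in D) (f x)%:E)%E.
Proof. by move=> mD intf; rewrite fineK //; exact: integrable_fin_num. Qed.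

Lemma measurable_integrableR d (T : measurableType d) (R : realType)
    (mu : {measure set T -> \bar R}) (D : set T) (f : T -> R) :
  mu.-integrable D (EFin \o f) -> measurable_fun D f.
Proof. by move=> /measurable_int/measurable_EFinP. Qed.

(** * Bessel's inequality on boxes *)

Section dominated_product.
Context d1 d2 (X : measurableType d1) (Y : measurableType d2) (R : realType).
Variables (m1 : {sigma_finite_measure set X -> \bar R})
  (m2 : {sigma_finite_measure set Y -> \bar R}).
Implicit Types (f : X * Y -> R) (p : X -> R) (q : Y -> R).

Lemma measurable_section1 d (T : measurableType d) (f : X * Y -> T) x :
  measurable_fun setT f -> measurable_fun setT (fun y => f (x, y)).
Proof. by move=> mf; apply: measurableT_comp => //; exact: pair1_measurable. Qed.

Lemma measurable_section2 d (T : measurableType d) (f : X * Y -> T) y :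
  measurable_fun setT f -> measurable_fun setT (fun x => f (x, y)).
Proof. by move=> mf; apply: measurableT_comp => //; exact: pair2_measurable. Qed.

Lemma measurable_fun_Rintegral1 f : measurable_fun setT f ->
  measurable_fun setT (fun x => \int[m2]_y f (x, y)).
Proof.
move=> mf; apply: (measurableT_comp (fine_measurable measurableT)).
have mF : measurable_fun setT (EFin \o f) by exact/measurable_EFinP.
under eq_fun do rewrite integralE.
apply: emeasurable_funB.
  rewrite [X in measurable_fun _ X](_ : _ = fubini_F m2 (EFin \o f)^\+%E).
    by apply: measurable_fun_fubini_tonelli_F => //; exact: measurable_funepos.
  by apply/funext => x; apply: eq_integral => y _; rewrite !funeposE.
rewrite [X in measurable_fun _ X](_ : _ = fubini_F m2 (EFin \o f)^\-%E).
  by apply: measurable_fun_fubini_tonelli_F => //; exact: measurable_funeneg.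
by apply/funext => x; apply: eq_integral => y _; rewrite !funenegE.
Qed.

Lemma integrable_prod_dom f p q : measurable_fun setT f ->
  m1.-integrable setT (EFin \o p) -> m2.-integrable setT (EFin \o q) ->
  (forall x y, `|f (x, y)| <= p x * q y) ->
  (m1 \x m2)%E.-integrable setT (EFin \o f).
Proof.
move=> mf ip iq fpq; apply/integrable12ltyP; first exact/measurable_EFinP.
have mp := measurable_integrableR ip; have mq := measurable_integrableR iq.
have /integrableP[_ qoo] := iq; have /integrableP[_ poo] := ip.
pose Q := fine (\int[m2]_y `|(q y)%:E|)%E.
have QE : (\int[m2]_y `|(q y)%:E|)%E = Q%:E.
  by rewrite fineK // ge0_fin_numE ?integral_ge0.
apply: (@le_lt_trans _ _ (\int[m1]_x (Q%:E * `|(p x)%:E|))%E).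
  apply: ge0_le_integral => //.
  - by move=> x _; exact: integral_ge0.
  - apply: (measurable_fun_fubini_tonelli_F (m2 := m2) (abse \o (EFin \o f))) => //.
      by apply: measurableT_comp => //; exact/measurable_EFinP.
    by move=> z; exact: abse_ge0.
  - apply: emeasurable_funM => //; apply: measurableT_comp => //.
    exact/measurable_EFinP.
  - move=> x _; rewrite -QE muleC -ge0_integralZl //; last first.
      by apply: measurableT_comp => //; exact/measurable_EFinP.
    apply: ge0_le_integral => //.
    + apply: measurableT_comp => //; apply/measurable_EFinP.
      exact: measurable_section1.
    + apply: emeasurable_funM => //; apply: measurableT_comp => //.
      exact/measurable_EFinP.
    + move=> y _ /=; rewrite lee_fin (le_trans (fpq _ _)) //.
      by rewrite (le_trans (ler_norm _)) // normrM.
rewrite ge0_integralZl //.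
- by rewrite lte_mul_pinfty // lee_fin fine_ge0 // integral_ge0.
- by apply: measurableT_comp => //; exact/measurable_EFinP.
- by rewrite lee_fin fine_ge0 // integral_ge0.
Qed.

Lemma integrable_section1_dom f p q x : measurable_fun setT f ->
  m2.-integrable setT (EFin \o q) -> (forall x y, `|f (x, y)| <= p x * q y) ->
  m2.-integrable setT (EFin \o (fun y => f (x, y))).
Proof.
move=> mf iq fpq; apply: (@le_integrableR _ _ _ _ _ _ (fun y => p x * q y)) => //.
- exact: measurable_section1.
- exact: (integrableZl measurableT (p x) iq).
Qed.

Lemma integrable_section2_dom f p q y : measurable_fun setT f ->
  m1.-integrable setT (EFin \o p) -> (forall x y, `|f (x, y)| <= p x * q y) ->
  m1.-integrable setT (EFin \o (fun x => f (x, y))).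
Proof.
move=> mf ip fpq; apply: (@le_integrableR _ _ _ _ _ _ (fun x => p x * q y)) => //.
- exact: measurable_section2.
- rewrite (_ : _ \o _ = fun x => ((q y)%:E * (p x)%:E)%E); last first.
    by apply/funext => x /=; rewrite -EFinM mulrC.
  exact: (integrableZl measurableT (q y) ip).
Qed.

Lemma Rintegral_Fubini_dom f p q : measurable_fun setT f ->
  m1.-integrable setT (EFin \o p) -> m2.-integrable setT (EFin \o q) ->
  (forall x y, `|f (x, y)| <= p x * q y) ->
  \int[m1]_x \int[m2]_y f (x, y) = \int[m2]_y \int[m1]_x f (x, y).
Proof.
move=> mf ip iq fpq; have := Fubini (integrable_prod_dom mf ip iq fpq).
move=> /(congr1 fine); congr (fine _ = fine _); apply: eq_integral => z _.
  by rewrite EFin_Rintegral //; exact: (integrable_section1_dom z mf iq fpq).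
by rewrite EFin_Rintegral //; exact: (integrable_section2_dom z mf ip fpq).
Qed.

Lemma Rintegral_prod_dom f p q : measurable_fun setT f ->
  m1.-integrable setT (EFin \o p) -> m2.-integrable setT (EFin \o q) ->
  (forall x y, `|f (x, y)| <= p x * q y) ->
  \int[(m1 \x m2)%E]_z f z = \int[m1]_x \int[m2]_y f (x, y).
Proof.
move=> mf ip iq fpq; congr fine.
rewrite -(integral12_prod_meas1 (integrable_prod_dom mf ip iq fpq)).
apply: eq_integral => z _.
by rewrite EFin_Rintegral //; exact: (integrable_section1_dom z mf iq fpq).
Qed.

End dominated_product.

Section fourier_bessel.
Context {R : realType} {n : nat}.
Implicit Types (x y xi eta : 'rV[R]_n) (u W : 'rV[R]_n -> R).
Let mu : {sigma_finite_measure set 'rV[R]_n -> \bar R} := lebesgue_rV n.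

Lemma measurable_dotrV d (T : measurableType d) (f g : T -> 'rV[R]_n) :
  measurable_fun setT f -> measurable_fun setT g ->
  measurable_fun setT (fun t => dotrV (f t) (g t)).
Proof.
move=> mf mg; apply: measurable_sum => i; apply: measurable_funM.
  exact: (measurableT_comp (measurable_coord i) mf).
exact: (measurableT_comp (measurable_coord i) mg).
Qed.

Lemma measurable_fun_subrV d (T : measurableType d) (f g : T -> 'rV[R]_n) :
  measurable_fun setT f -> measurable_fun setT g ->
  measurable_fun setT (fun t => f t - g t).
Proof.
move=> mf mg; apply/measurable_fun_rVP => i; under eq_fun do rewrite !mxE.
apply: measurable_funB.
  exact: (measurableT_comp (measurable_coord i) mf).
exact: (measurableT_comp (measurable_coord i) mg).
Qed.

Lemma dotrVBl x y xi : dotrV (x - y) xi = dotrV x xi - dotrV y xi.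
Proof.
rewrite /dotrV -sumrB; apply: eq_bigr => i _; by rewrite !mxE mulrBl.
Qed.

Lemma dotrVNl x xi : dotrV (- x) xi = - dotrV x xi.
Proof.
rewrite /dotrV -sumrN; apply: eq_bigr => i _; by rewrite !mxE mulNr.
Qed.

Definition cos_transform u xi := \int[mu]_x (u x * cos (dotrV xi x)).
Definition sin_transform u xi := \int[mu]_x (u x * sin (dotrV xi x)).

Lemma cos_transformN u xi : cos_transform u (- xi) = cos_transform u xi.
Proof. by apply: eq_Rintegral => x _; rewrite dotrVNl cosN. Qed.

Let mcos d (T : measurableType d) (f : T -> R) :
  measurable_fun setT f -> measurable_fun setT (fun t => cos (f t)).
Proof. by move=> mf; exact: (measurableT_comp (@measurable_cos R) mf). Qed.

Let msin d (T : measurableType d) (f : T -> R) :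
  measurable_fun setT f -> measurable_fun setT (fun t => sin (f t)).
Proof. by move=> mf; exact: (measurableT_comp (@measurable_sin R) mf). Qed.

Let integrable_bd u (h : 'rV[R]_n -> R) : mu.-integrable setT (EFin \o u) ->
  measurable_fun setT h -> (forall x, `|h x| <= 1) ->
  mu.-integrable setT (EFin \o (fun x => u x * h x)).
Proof.
move=> iu mh h1; apply: (@le_integrableR _ _ _ _ _ _ (fun x => `|u x|)) => //.
- by apply: measurable_funM => //; exact: measurable_integrableR iu.
- by move=> x _; rewrite normrM ler_piMr.
- exact: (integrable_abse iu).
Qed.

Lemma integrable_mul_cos u xi : mu.-integrable setT (EFin \o u) ->
  mu.-integrable setT (EFin \o (fun x => u x * cos (dotrV xi x))).
Proof.
move=> iu; apply: integrable_bd => // [|x]; last exact: cos_max.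
by apply: mcos; apply: measurable_dotrV => //; exact: measurable_cst.
Qed.

Lemma integrable_mul_sin u xi : mu.-integrable setT (EFin \o u) ->
  mu.-integrable setT (EFin \o (fun x => u x * sin (dotrV xi x))).
Proof.
move=> iu; apply: integrable_bd => // [|x]; last exact: sin_max.
by apply: msin; apply: measurable_dotrV => //; exact: measurable_cst.
Qed.

Lemma measurable_cos_transform u : measurable_fun setT u ->
  measurable_fun setT (cos_transform u).
Proof.
move=> mu'; apply: (@measurable_fun_Rintegral1 _ _ _ _ R mu
  (fun p => u p.2 * cos (dotrV p.1 p.2))).
apply: measurable_funM; first exact: measurableT_comp.
by apply: mcos; exact: measurable_dotrV.
Qed.

Lemma measurable_sin_transform u : measurable_fun setT u ->
  measurable_fun setT (sin_transform u).
Proof.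
move=> mu'; apply: (@measurable_fun_Rintegral1 _ _ _ _ R mu
  (fun p => u p.2 * sin (dotrV p.1 p.2))).
apply: measurable_funM; first exact: measurableT_comp.
by apply: msin; exact: measurable_dotrV.
Qed.

Lemma dotrVC x y : dotrV x y = dotrV y x.
Proof. by apply: eq_bigr => i _; rewrite mulrC. Qed.

Let norm_transform_le u (h : R -> R) xi : mu.-integrable setT (EFin \o u) ->
  measurable_fun setT h -> (forall t, `|h t| <= 1) ->
  `|\int[mu]_x (u x * h (dotrV xi x))| <= \int[mu]_x `|u x|.
Proof.
move=> iu mh h1.
have ih : mu.-integrable setT (EFin \o (fun x => u x * h (dotrV xi x))).
  apply: integrable_bd => //; apply: (measurableT_comp mh).
  by apply: measurable_dotrV => //; exact: measurable_cst.
apply: le_trans (le_normr_Rintegral _ _) _ => //.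
apply: le_Rintegral => //.
- exact: (integrable_abse ih).
- exact: (integrable_abse iu).
- by move=> x _; rewrite normrM ler_piMr.
Qed.

Let shifted u xi x :=
  cos (dotrV x xi) * cos_transform u x + sin (dotrV x xi) * sin_transform u x.

Let shiftedE u xi x : mu.-integrable setT (EFin \o u) ->
  shifted u xi x = \int[mu]_eta (u eta * cos (dotrV (xi - eta) x)).
Proof.
move=> iu; rewrite /shifted -!RintegralZl //;
  [|exact: integrable_mul_sin|exact: integrable_mul_cos].
rewrite -RintegralD //.
- apply: eq_Rintegral => eta _; rewrite dotrVBl cosB.
  by rewrite (dotrVC eta) (dotrVC xi); ring.
- exact: (integrableZl measurableT _ (integrable_mul_cos x iu)).
- exact: (integrableZl measurableT _ (integrable_mul_sin x iu)).
Qed.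

Lemma sqr_transformE W u : mu.-integrable setT (EFin \o W) ->
  mu.-integrable setT (EFin \o u) ->
  \int[mu]_x (W x * (cos_transform u x ^+ 2 + sin_transform u x ^+ 2)) =
  \int[mu]_xi (u xi * \int[mu]_eta (u eta * cos_transform W (xi - eta))).
Proof.
move=> iW iu; pose M := \int[mu]_x `|u x|.
have mW := measurable_integrableR iW; have mmu := measurable_integrableR iu.
have cM x : `|cos_transform u x| <= M.
  by apply: norm_transform_le => //; [exact: measurable_cos|exact: cos_max].
have sM x : `|sin_transform u x| <= M.
  by apply: norm_transform_le => //; [exact: measurable_sin|exact: sin_max].
have iaW : mu.-integrable setT (EFin \o (fun x => `|W x|)) := integrable_abse iW.
have iau : mu.-integrable setT (EFin \o (fun x => `|u x|)) := integrable_abse iu.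
transitivity (\int[mu]_x \int[mu]_xi (W x * u xi * shifted u xi x)).
  apply: eq_Rintegral => x _.
  transitivity (\int[mu]_xi ((W x * cos_transform u x) * (u xi * cos (dotrV x xi))
    + (W x * sin_transform u x) * (u xi * sin (dotrV x xi)))).
    rewrite RintegralD //.
    - rewrite !RintegralZl //; [|exact: integrable_mul_sin|exact: integrable_mul_cos].
      by rewrite -/(cos_transform u x) -/(sin_transform u x); ring.
    - exact: (integrableZl measurableT _ (integrable_mul_cos x iu)).
    - exact: (integrableZl measurableT _ (integrable_mul_sin x iu)).
  by apply: eq_Rintegral => xi _; rewrite /shifted; ring.
rewrite (Rintegral_Fubini_dom (m1 := mu) (m2 := mu)
  (f := fun p => W p.1 * u p.2 * shifted u p.2 p.1)
  (p := fun x => `|W x|) (q := fun xi => `|u xi| * (M + M))) //; last first.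
- move=> x xi /=; rewrite !normrM -mulrA ler_wpM2l // ler_wpM2l //.
  rewrite (le_trans (ler_normD _ _)) // lerD // normrM.
    by rewrite -[M]mul1r ler_pM // cos_max.
  by rewrite -[M]mul1r ler_pM // sin_max.
- rewrite (_ : _ \o _ = fun x => ((M + M)%:E * (`|u x|%R)%:E)%E).
    exact: (integrableZl measurableT _ iau).
  by apply/funext => x /=; rewrite -EFinM mulrC.
- apply: measurable_funM.
    by apply: measurable_funM; exact: measurableT_comp.
  apply: measurable_funD; apply: measurable_funM.
  + by apply: mcos; exact: measurable_dotrV.
  + by apply: (measurableT_comp (measurable_cos_transform mmu)).
  + by apply: msin; exact: measurable_dotrV.
  + by apply: (measurableT_comp (measurable_sin_transform mmu)).
apply: eq_Rintegral => xi _ /=.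
transitivity (\int[mu]_x \int[mu]_eta
    (u xi * (W x * u eta * cos (dotrV (xi - eta) x)))).
  apply: eq_Rintegral => x _; rewrite shiftedE // -RintegralZl //.
    by apply: eq_Rintegral => eta _; ring.
  apply: integrable_bd => // [|eta]; last exact: cos_max.
  apply: mcos; apply: measurable_dotrV; last exact: measurable_cst.
  by apply: measurable_fun_subrV => //; exact: measurable_cst.
rewrite (Rintegral_Fubini_dom (m1 := mu) (m2 := mu)
  (f := fun p => u xi * (W p.1 * u p.2 * cos (dotrV (xi - p.2) p.1)))
  (p := fun x => `|u xi| * `|W x|) (q := fun xi => `|u xi|)) //; last first.
- move=> x eta /=; rewrite !normrM -!mulrA ler_wpM2l // ler_wpM2l //.
  by rewrite ler_piMr // cos_max.
- exact: (integrableZl measurableT _ iaW).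
- apply: measurable_funM; first exact: measurable_cst.
  apply: measurable_funM; first by apply: measurable_funM; exact: measurableT_comp.
  apply: mcos; apply: measurable_dotrV => //.
  by apply: measurable_fun_subrV => //; exact: measurable_cst.
have iuW : mu.-integrable setT
    (EFin \o (fun eta => u eta * cos_transform W (xi - eta))).
  apply: (@le_integrableR _ _ _ _ _ _ (fun x => (\int[mu]_x `|W x|) * `|u x|)) => //.
  - apply: measurable_funM => //.
    apply: (measurableT_comp (measurable_cos_transform mW)).
    by apply: measurable_fun_subrV => //; exact: measurable_cst.
  - move=> x _; rewrite normrM mulrC ler_wpM2r //.
    by apply: norm_transform_le => //; [exact: measurable_cos|exact: cos_max].
  - exact: (integrableZl measurableT _ iau).
rewrite -RintegralZl //; apply: eq_Rintegral => eta _ /=.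
rewrite -RintegralZl //; last exact: integrable_mul_cos.
rewrite -RintegralZl; last 2 first.
- by [].
- exact: (integrableZl measurableT _ (integrable_mul_cos (xi - eta) iW)).
by apply: eq_Rintegral => x _; ring.
Qed.

(* Schur's test for the kernel [cos_transform W (xi - eta)]. *)
Lemma weighted_bessel W u (C : R) : mu.-integrable setT (EFin \o W) ->
  (forall x, 0 <= W x) -> mu.-integrable setT (EFin \o u) ->
  (\int[mu]_zeta (`|cos_transform W zeta|)%:E <= C%:E)%E ->
  (\int[mu]_x (W x * (cos_transform u x ^+ 2 + sin_transform u x ^+ 2))%:E <=
   (2 * C)%:E * \int[mu]_xi (u xi ^+ 2)%:E)%E.
Proof.
move=> iW W0 iu HC.
have mW := measurable_integrableR iW; have mmu := measurable_integrableR iu.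
pose k zeta : R := `|cos_transform W zeta|.
have k0 z : 0 <= k z by exact: normr_ge0.
have mk : measurable_fun setT k.
  exact: (measurableT_comp (@normr_measurable _ setT) (measurable_cos_transform mW)).
have mkB : measurable_fun setT (fun p : 'rV[R]_n * 'rV[R]_n => k (p.1 - p.2)).
  apply: (measurableT_comp mk).
  by apply: measurable_fun_subrV.
have cM h x : h = cos \/ h = sin ->
    `|\int[mu]_xi (u xi * h (dotrV x xi))| <= \int[mu]_x `|u x|.
  case=> ->; apply: norm_transform_le => //.
  + exact: measurable_cos. + exact: cos_max.
  + exact: measurable_sin. + exact: sin_max.
have iau : mu.-integrable setT (EFin \o (fun x => `|u x|)) := integrable_abse iu.
have iLHS : mu.-integrable setT (EFin \o
    (fun x => W x * (cos_transform u x ^+ 2 + sin_transform u x ^+ 2))).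
  pose M := \int[mu]_x `|u x|.
  apply: (@le_integrableR _ _ _ _ _ _ (fun x => (M ^+ 2 + M ^+ 2) * W x)) => //.
  - apply: measurable_funM => //; apply: measurable_funD; apply: measurable_funX.
      exact: measurable_cos_transform.
    exact: measurable_sin_transform.
  - move=> x _; rewrite normrM (ger0_norm (W0 x)) mulrC ler_wpM2r //.
    rewrite ger0_norm ?addr_ge0 ?sqr_ge0 // lerD //.
      by rewrite -[leLHS]real_normK ?num_real // lerXn2r ?nnegrE ?cM ?(le_trans _ (cM cos x _)) //; left.
    by rewrite -[leLHS]real_normK ?num_real // lerXn2r ?nnegrE ?cM ?(le_trans _ (cM sin x _)) //; right.
  - exact: (integrableZl measurableT _ iW).
rewrite -EFin_Rintegral // sqr_transformE //.
pose G xi := \int[mu]_eta (u eta * cos_transform W (xi - eta)).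
have mG : measurable_fun setT G.
  have mf : measurable_fun setT (fun p : 'rV[R]_n * 'rV[R]_n =>
      u p.2 * cos_transform W (p.1 - p.2)).
    apply: measurable_funM; first exact: measurableT_comp.
    apply: (measurableT_comp (measurable_cos_transform mW)).
    exact: measurable_fun_subrV.
  exact: (measurable_fun_Rintegral1 mu mf).
have iuW xi : mu.-integrable setT
    (EFin \o (fun eta => u eta * cos_transform W (xi - eta))).
  apply: (@le_integrableR _ _ _ _ _ _ (fun x => (\int[mu]_x `|W x|) * `|u x|)) => //.
  - apply: measurable_funM => //.
    apply: (measurableT_comp (measurable_cos_transform mW)).
    by apply: measurable_fun_subrV => //; exact: measurable_cst.
  - move=> x _; rewrite normrM mulrC ler_wpM2r //.
    by apply: norm_transform_le => //; [exact: measurable_cos|exact: cos_max].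
  - exact: (integrableZl measurableT _ iau).
pose U : \bar R := (\int[mu]_xi (u xi ^+ 2)%:E)%E.
pose I : \bar R := (\int[mu]_zeta (k zeta)%:E)%E.
have mu2 : measurable_fun setT (fun xi => u xi ^+ 2) by exact: measurable_funX.
have I1 xi : (\int[mu]_eta (k (eta - xi))%:E = I)%E.
  apply: (@ge0_integral_rV_shift _ _ (- xi) (fun z => (k z)%:E)).
    exact/measurable_EFinP.
  by move=> z; rewrite lee_fin.
have I2 xi : (\int[mu]_eta (k (xi - eta))%:E = I)%E.
  by rewrite -(I1 xi); apply: eq_integral => eta _; rewrite /k -cos_transformN opprB.
have A1 : (\int[mu]_xi \int[mu]_eta (u xi ^+ 2 * k (xi - eta))%:E = U * I)%E.
  rewrite /U -ge0_integralZr //; last 3 first.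
  - exact/measurable_EFinP.
  - by move=> x _; rewrite lee_fin sqr_ge0.
  - by apply: integral_ge0 => x _; rewrite lee_fin.
  apply: eq_integral => xi _; under eq_integral do rewrite EFinM.
  rewrite ge0_integralZl ?I2 // ?lee_fin ?sqr_ge0 //.
    by apply/measurable_EFinP; exact: (measurable_section1 xi mkB).
  by move=> eta _; rewrite lee_fin.
have A2 : (\int[mu]_xi \int[mu]_eta (u eta ^+ 2 * k (xi - eta))%:E = U * I)%E.
  rewrite (fubini_tonelli (m1 := mu) (m2 := mu)
    (fun p => (u p.2 ^+ 2 * k (p.1 - p.2))%:E)); last 2 first.
  - apply/measurable_EFinP; apply: measurable_funM => //.
    exact: (measurableT_comp mu2 measurable_snd).
  - by move=> p; rewrite lee_fin mulr_ge0 ?sqr_ge0.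
  rewrite /U -ge0_integralZr //; last 3 first.
  - exact/measurable_EFinP.
  - by move=> x _; rewrite lee_fin sqr_ge0.
  - by apply: integral_ge0 => x _; rewrite lee_fin.
  apply: eq_integral => xi _ /=; under eq_integral do rewrite EFinM.
  rewrite ge0_integralZl ?I1 // ?lee_fin ?sqr_ge0 //.
    by apply/measurable_EFinP; exact: (measurable_section2 xi mkB).
  by move=> eta _; rewrite lee_fin.
have U0 : (0 <= U)%E by apply: integral_ge0 => x _; rewrite lee_fin sqr_ge0.
have I0 : (0 <= I)%E by apply: integral_ge0 => x _; rewrite lee_fin.
have m12 (f : 'rV[R]_n * 'rV[R]_n -> R) : measurable_fun setT f ->
    (forall p, 0 <= f p) ->
    measurable_fun setT (fun xi => \int[mu]_eta (f (xi, eta))%:E)%E.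
  move=> mf f0; apply: (measurable_fun_fubini_tonelli_F (m2 := mu) (EFin \o f)).
    exact/measurable_EFinP.
  by move=> p; rewrite lee_fin.
apply: (@le_trans _ _ (\int[mu]_xi \int[mu]_eta
    (u xi ^+ 2 * k (xi - eta) + u eta ^+ 2 * k (xi - eta))%:E)%E); last first.
  under eq_integral => xi _.
    under eq_integral do rewrite EFinD.
    rewrite ge0_integralD //; last 4 first.
    - by move=> x _; rewrite lee_fin mulr_ge0 ?sqr_ge0.
    - apply/measurable_EFinP; apply: measurable_funM; first exact: measurable_cst.
      exact: (measurable_section1 xi mkB).
    - by move=> x _; rewrite lee_fin mulr_ge0 ?sqr_ge0.
    - apply/measurable_EFinP; apply: measurable_funM => //.
      exact: (measurable_section1 xi mkB).
    over.
  rewrite ge0_integralD //; last 4 first.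
  - by move=> x _; apply: integral_ge0 => y _; rewrite lee_fin mulr_ge0 ?sqr_ge0.
  - apply: (m12 (fun p => u p.1 ^+ 2 * k (p.1 - p.2))).
      by apply: measurable_funM => //; exact: (measurableT_comp mu2 measurable_fst).
    by move=> p; rewrite mulr_ge0 ?sqr_ge0.
  - by move=> x _; apply: integral_ge0 => y _; rewrite lee_fin mulr_ge0 ?sqr_ge0.
  - apply: (m12 (fun p => u p.2 ^+ 2 * k (p.1 - p.2))).
      by apply: measurable_funM => //; exact: (measurableT_comp mu2 measurable_snd).
    by move=> p; rewrite mulr_ge0 ?sqr_ge0.
  rewrite A1 A2 -/U; apply: (@le_trans _ _ (U * C%:E + U * C%:E)%E).
    by apply: leeD; exact: lee_wpmul2l.
  have C0 : (0 <= C%:E)%E by apply: le_trans HC.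
  by rewrite -ge0_muleDr // -EFinD muleC mulr2n mulrDl !mul1r.
apply: (@le_trans _ _ (\int[mu]_xi `|(u xi * G xi)%:E|)%E).
  rewrite -/G; apply: (@le_trans _ _ `|\int[mu]_xi (u xi * G xi)%:E|%E); last first.
    by apply: le_abse_integral => //; apply/measurable_EFinP; exact: measurable_funM.
  rewrite /Rintegral; case: (\int[mu]_xi (u xi * G xi)%:E)%E => [r| |] /=.
  - by rewrite lee_fin ler_norm.
  - by rewrite leey.
  - by rewrite leey.
apply: ge0_le_integral => //.
- by apply: measurableT_comp => //; apply/measurable_EFinP; exact: measurable_funM.
- apply: (m12 (fun p => u p.1 ^+ 2 * k (p.1 - p.2) + u p.2 ^+ 2 * k (p.1 - p.2))).
    apply: measurable_funD; apply: measurable_funM => //.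
      exact: (measurableT_comp mu2 measurable_fst).
    exact: (measurableT_comp mu2 measurable_snd).
  by move=> p; rewrite addr_ge0 // mulr_ge0 ?sqr_ge0.
move=> xi _.
have mkx : measurable_fun setT (fun eta => k (xi - eta)).
  exact: (measurable_section1 xi mkB).
have maux : measurable_fun setT (fun eta => `|u eta * cos_transform W (xi - eta)|).
  apply: measurableT_comp => //.
  exact: (measurable_integrableR (iuW xi)).
apply: (@le_trans _ _ (`|u xi|%:E * \int[mu]_eta (`|u eta| * k (xi - eta))%:E)%E).
  rewrite abse_EFin normrM EFinM lee_wpmul2l ?lee_fin //.
  rewrite /G; have := EFin_normr_Rintegral measurableT (iuW xi) => ->.
  apply: le_trans (le_abse_integral _ _ _) _ => //.
    by apply/measurable_EFinP; exact: (measurable_integrableR (iuW xi)).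
  by rewrite le_eqVlt; apply/orP; left; apply/eqP; apply: eq_integral => eta _;
    rewrite /= normrM.
rewrite -ge0_integralZl ?lee_fin //; last 2 first.
- apply/measurable_EFinP; apply: measurable_funM => //.
  exact: (measurableT_comp (@normr_measurable _ setT) mmu).
- by move=> x _; rewrite lee_fin mulr_ge0.
apply: ge0_le_integral => //.
- by move=> x _; rewrite -EFinM lee_fin !mulr_ge0.
- apply/measurable_EFinP; apply: measurable_funM; first exact: measurable_cst.
  apply: measurable_funM => //.
  exact: (measurableT_comp (@normr_measurable _ setT) mmu).
- apply/measurable_EFinP; apply: measurable_funD; apply: measurable_funM => //.
- move=> eta _; rewrite -EFinM lee_fin mulrA -mulrDl ler_wpM2r //.
  rewrite -[u xi ^+ 2]real_normK ?num_real // -[u eta ^+ 2]real_normK ?num_real //.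
  have := sqr_ge0 (`|u xi| - `|u eta|); have := normr_ge0 (u xi).
  by have := normr_ge0 (u eta); nra.
Qed.

End fourier_bessel.

Lemma Rintegral_FTC (R : realType) (f F : R -> R) (a b : R) : a < b ->
  continuous f -> (forall x : R, is_derive x 1 F (f x)) ->
  \int[lebesgue_measure]_(x in `[a, b]) f x = F b - F a.
Proof.
move=> ab cf dF; rewrite /Rintegral.
have cF : continuous F.
  move=> x; apply: differentiable_continuous; apply/derivable1_diffP.
  exact: (@ex_derive _ _ _ _ _ _ _ (dF x)).
rewrite (continuous_FTC2 (F := F) ab) //.
- exact: continuous_subspaceT.
- split => [x _||].
  + exact: (@ex_derive _ _ _ _ _ _ _ (dF x)).
  + by apply: cvg_at_right_filter; exact: cF.
  + by apply: cvg_at_left_filter; exact: cF.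
- by move=> x _; rewrite derive1E; exact: (@derive_val _ _ _ _ _ _ _ (dF x)).
Qed.

Lemma ge0_integral_lebesgueN (R : realType) (F : R -> \bar R) :
  measurable_fun setT F -> (forall x, 0 <= F x)%E ->
  (\int[lebesgue_measure]_x F (- x)%R = \int[lebesgue_measure]_x F x)%E.
Proof.
move=> mF F0.
have mS : measurable_fun [set: measurableTypeR R]
    (-%R : measurableTypeR R -> measurableTypeR R) by exact: oppr_measurable.
transitivity (\int[pushforward (@lebesgue_measure R)
    (-%R : measurableTypeR R -> measurableTypeR R)]_x F x)%E.
  apply/esym; apply: (@ge0_integral_pushforward _ _ _ _ R _ mS lebesgue_measure
    setT F measurableT mF).
  by move=> y _.
by apply: eq_measure_integral => A mA _; exact: lebesgue_measureN.
Qed.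

Lemma Rintegral_odd (R : realType) (f : R -> R) : measurable_fun setT f ->
  (forall x, f (- x) = - f x) -> \int[lebesgue_measure]_x f x = 0.
Proof.
move=> mf fN; rewrite /Rintegral integralE.
have mF : measurable_fun setT (EFin \o f) by exact/measurable_EFinP.
have -> : (\int[lebesgue_measure]_x (EFin \o f)^\- x =
    \int[lebesgue_measure]_x (EFin \o f)^\+ x)%E.
  rewrite -[RHS](ge0_integral_lebesgueN (measurable_funepos mF)) //.
  by apply: eq_integral => x _; rewrite funeposE funenegE /= fN EFinN.
by case: (\int[_]_x _)%E => [r| |] //=; rewrite subrr.
Qed.

Section triangle.
Context {R : realType}.
Implicit Types (T a y : R).

Definition tri T y : R := Num.max 0 (1 - `|y| / T).

Lemma tri_ge0 T y : 0 <= tri T y.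
Proof. by rewrite le_max lexx. Qed.

Lemma tri_out T y : 0 < T -> T <= `|y| -> tri T y = 0.
Proof.
by move=> T0 Ty; apply/max_idPl; rewrite subr_le0 ler_pdivlMr // mul1r.
Qed.

Lemma tri_in T y : 0 < T -> `|y| <= T -> tri T y = 1 - `|y| / T.
Proof.
by move=> T0 Ty; apply/max_idPr; rewrite subr_ge0 ler_pdivrMr // mul1r.
Qed.

Lemma tri_le1 T y : 0 < T -> tri T y <= 1.
Proof.
move=> T0; rewrite ge_max ler01 /= gerBl.
by rewrite divr_ge0 // ltW.
Qed.

Lemma triN T y : tri T (- y) = tri T y.
Proof. by rewrite /tri normrN. Qed.

Lemma measurable_tri T : measurable_fun setT (tri T).
Proof.
apply: measurable_maxr; first exact: measurable_cst.
apply: measurable_funB; first exact: measurable_cst.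
by apply: measurable_funM => //; exact: measurable_cst.
Qed.

Lemma tri_le_indic T y : 0 < T -> tri T y <= \1_(`[- T, T]%classic) y.
Proof.
move=> T0; rewrite indicE; have [yT|Ty] := leP `|y| T.
  by rewrite mem_set ?tri_le1 //= in_itv /= -ler_norml.
by rewrite tri_out // ltW.
Qed.

Lemma integrable_tri T : 0 < T ->
  (@lebesgue_measure R).-integrable setT (EFin \o tri T).
Proof.
move=> T0; apply: (@le_integrableR _ (measurableTypeR R) R lebesgue_measure _ _
  (\1_(`[- T, T]%classic))) => //.
- exact: measurable_tri.
- by move=> y _; rewrite ger0_norm ?tri_ge0 // tri_le_indic.
- exact: integrable_indic_itv.
Qed.

Definition tri_cos T a : R := \int[lebesgue_measure]_y (tri T y * cos (a * y)).

Let mtrig (h : R -> R) T a : measurable_fun setT h ->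
  measurable_fun setT (fun y : R => tri T y * h (a * y)).
Proof.
move=> mh; apply: measurable_funM; first exact: measurable_tri.
by apply: (measurableT_comp mh); apply: measurable_funM.
Qed.

Lemma integrable_tri_trig (h : R -> R) T a : 0 < T -> measurable_fun setT h ->
  (forall t, `|h t| <= 1) ->
  (@lebesgue_measure R).-integrable setT (EFin \o (fun y => tri T y * h (a * y))).
Proof.
move=> T0 mh h1; apply: (@le_integrableR _ (measurableTypeR R) R lebesgue_measure _ _ (tri T)) => //.
- exact: mtrig.
- by move=> y _; rewrite normrM (ger0_norm (tri_ge0 _ _)) ler_piMr // tri_ge0.
- exact: integrable_tri.
Qed.

Lemma Rintegral_tri_sin T a : \int[lebesgue_measure]_y (tri T y * sin (a * y)) = 0.
Proof.
apply: Rintegral_odd => [|y]; first by apply: mtrig; exact: measurable_sin.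
by rewrite triN mulrN sinN mulrN.
Qed.

Lemma measurable_tri_cos T : measurable_fun setT (tri_cos T).
Proof.
have mf : measurable_fun setT
    (fun p : R * measurableTypeR R => tri T p.2 * cos (p.1 * p.2)).
  apply: measurable_funM; first exact: (measurableT_comp (measurable_tri T)).
  by apply: (measurableT_comp (@measurable_cos R)); exact: measurable_funM.
exact: (@measurable_fun_Rintegral1 _ _ _ _ R lebesgue_measure _ mf).
Qed.

Lemma tri_cos_le2T T a : 0 < T -> `|tri_cos T a| <= 2 * T.
Proof.
move=> T0.
have ic : (@lebesgue_measure R).-integrable setT
    (EFin \o (fun y => tri T y * cos (a * y))).
  by apply: integrable_tri_trig => //; [exact: measurable_cos|exact: cos_max].
apply: le_trans (le_normr_Rintegral _ ic) _ => //.
apply: (@le_trans _ _ (\int[lebesgue_measure]_x (\1_(`[- T, T]%classic) x : R))).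
  apply: le_Rintegral => //.
  - exact: (integrable_abse ic).
  - exact: integrable_indic_itv.
  - move=> y _; rewrite normrM (ger0_norm (tri_ge0 _ _)).
    by apply: le_trans (tri_le_indic _ T0); rewrite ler_piMr ?tri_ge0 ?cos_max.
rewrite /Rintegral.
have -> : (\int[lebesgue_measure]_x (\1_(`[- T, T]%classic) x : R)%:E = (2 * T)%:E)%E.
  have E : lebesgue_measure (`[- T, T]%classic : set R) = (2 * T)%:E.
    rewrite lebesgue_measure_itv /= lte_fin gtrN // -EFinD opprK.
    by congr EFin; ring.
  by rewrite integral_indic // setIT; exact: E.
by [].
Qed.

Lemma tri_cosE T a : 0 < T -> a != 0 ->
  tri_cos T a = 2 * (1 - cos (a * T)) / (T * a ^+ 2).
Proof.
move=> T0 a0.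
have ic : (@lebesgue_measure R).-integrable setT
    (EFin \o (fun y => tri T y * cos (a * y))).
  by apply: integrable_tri_trig => //; [exact: measurable_cos|exact: cos_max].
have icS (D : set (measurableTypeR R)) : measurable D ->
    (@lebesgue_measure R).-integrable D (EFin \o (fun y => tri T y * cos (a * y))).
  by move=> mD; apply: integrableS ic.
have -> : tri_cos T a =
    \int[lebesgue_measure]_(y in `[- T, T]) (tri T y * cos (a * y)).
  rewrite Rintegral_mkcond; apply: eq_Rintegral => y _; rewrite patchE.
  case: ifPn => // /negP yT; rewrite tri_out ?mul0r //.
  rewrite leNgt; apply/negP => yT'; apply: yT; rewrite mem_set //= in_itv /=.
  by rewrite -ler_norml ltW.
have -> : \int[lebesgue_measure]_(y in `[- T, T]) (tri T y * cos (a * y)) =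
    \int[lebesgue_measure]_(y in `[- T, 0]) (tri T y * cos (a * y)) +
    \int[lebesgue_measure]_(y in `[0, T]) (tri T y * cos (a * y)).
  rewrite -(@Rintegral_itv_obnd_cbnd R 0 (BRight T)); last exact: icS.
  rewrite -(@Rintegral_itvB R _ (BLeft (- T)) (BRight T) 0) ?bnd_simp ?ltW ?oppr_lt0 //.
    by rewrite addrC subrK.
  exact: icS.
pose G c y : R := (1 + c * y) * (sin (a * y) / a) + c * (cos (a * y) / a ^+ 2).
have dG c (y : R) : is_derive y 1 (G c) ((1 + c * y) * cos (a * y)).
  have da : is_derive y 1 (fun y : R => a * y) a.
    by apply: is_derive_eq; rewrite /GRing.scale /=; ring.
  have ds : is_derive y 1 (fun y : R => sin (a * y)) (cos (a * y) * a).
    exact: (@is_derive1_comp R sin (fun y => a * y) y _ _ _ da).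
  have dc : is_derive y 1 (fun y : R => cos (a * y)) (- sin (a * y) * a).
    exact: (@is_derive1_comp R cos (fun y => a * y) y _ _ _ da).
  apply: is_derive_eq; rewrite /GRing.scale /=.
  by field.
have cg c : continuous (fun y : R => (1 + c * y) * cos (a * y)).
  move=> y; apply: cvgM.
    apply: cvgD; first exact: cvg_cst.
    by apply: cvgM; [exact: cvg_cst|exact: cvg_id].
  apply: (@continuous_comp _ _ _ (fun y : R => a * y) cos).
    by apply: cvgM; [exact: cvg_cst|exact: cvg_id].
  exact: continuous_cos.
have tri_left (y : R) : - T <= y -> y <= 0 -> tri T y = 1 + T^-1 * y.
  move=> Ty y0; rewrite tri_in ?ler0_norm //; last by rewrite lerNl.
  by rewrite mulNr opprK mulrC.
have tri_right (y : R) : 0 <= y -> y <= T -> tri T y = 1 + (- T^-1) * y.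
  by move=> y0 yT; rewrite tri_in ?ger0_norm // mulNr mulrC.
have -> : \int[lebesgue_measure]_(y in `[- T, 0]) (tri T y * cos (a * y)) =
    \int[lebesgue_measure]_(y in `[- T, 0]) ((1 + T^-1 * y) * cos (a * y)).
  apply: eq_Rintegral => y /[!inE] /=; rewrite in_itv /= => /andP[Ty y0].
  by rewrite tri_left.
have -> : \int[lebesgue_measure]_(y in `[0, T]) (tri T y * cos (a * y)) =
    \int[lebesgue_measure]_(y in `[0, T]) ((1 + (- T^-1) * y) * cos (a * y)).
  apply: eq_Rintegral => y /[!inE] /=; rewrite in_itv /= => /andP[y0 Ty].
  by rewrite tri_right.
rewrite (Rintegral_FTC (F := G T^-1)) ?oppr_lt0 //.
rewrite (Rintegral_FTC (F := G (- T^-1))) //.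
rewrite /G !mulr0 (mulrN a) sinN cosN sin0 cos0; field.
by rewrite a0 gt_eqF.
Qed.

Lemma tri_cos_le_inv T a : 0 < T -> a != 0 ->
  `|tri_cos T a| <= 4 / T * `|a| `^ (- 2%:R).
Proof.
move=> T0 a0; rewrite tri_cosE // powR_invn //.
have a20 : 0 < a ^+ 2 by rewrite exprn_even_gt0.
rewrite ger0_norm; last first.
  apply: divr_ge0; first by rewrite mulr_ge0 // subr_ge0 cos_le1.
  by rewrite mulr_ge0 // ltW.
rewrite real_normK ?num_real // [leRHS](_ : _ = 2 * 2 / (T * a ^+ 2)); last first.
  by field; rewrite a0 gt_eqF.
apply: ler_wpM2r; first by rewrite invr_ge0 mulr_ge0 // ltW.
by have := cos_geN1 (a * T); lra.
Qed.

Lemma integral_tri_cos_le : exists2 K : R, 0 <= K & forall T, 0 < T ->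
  (\int[lebesgue_measure]_a (`|tri_cos T a|)%:E <= K%:E)%E.
Proof.
have [||K K0 HK] := @integral_layer_cake_le R 1 2%:R; [by []|by rewrite ltr1n|].
exists (4 + K * 8); first by rewrite addr_ge0 // mulr_ge0.
move=> T T0; pose A : set (measurableTypeR R) := [set a | T^-1 <= `|a|].
have mn : measurable_fun setT (fun a : measurableTypeR R => `|a|).
  exact: normr_measurable.
have mA : measurable A.
  rewrite (_ : A = (fun a : measurableTypeR R => `|a|) @^-1` `[T^-1, +oo[%classic).
    by rewrite -[X in measurable X]setTI; exact: mn.
  by apply/seteqP; split=> a /=; rewrite in_itv /= andbT.
have mt : measurable_fun setT (fun a => (`|tri_cos T a|)%:E).
  apply/measurable_EFinP.
  exact: (measurableT_comp (@normr_measurable _ setT) (measurable_tri_cos T)).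
have ball (r : R) : 0 < r -> (lebesgue_measure
    ([set x : measurableTypeR R | (`|x| <= r)%R] : set (measurableTypeR R))
    = (2 * r)%:E)%E.
  move=> r0; rewrite (_ : [set _ | _] = `[- r, r]%classic).
    rewrite lebesgue_measure_itv /= lte_fin gtrN // -EFinD opprK.
    by congr EFin; ring.
  by apply/seteqP; split=> a /=; rewrite in_itv /= ler_norml.
rewrite -(setvU A) ge0_integral_setU //; last 3 first.
- exact: measurableC.
- by rewrite setvU; exact: mt.
- by apply/disj_setPS => a [].
rewrite EFinD; apply: leeD.
  apply: (@le_trans _ _ (\int[lebesgue_measure]_(a in ~` A) (2 * T)%:E)%E).
    apply: ge0_le_integral => //.
    - exact: measurableC.
    - exact: measurable_funTS.
    - by move=> a _; rewrite lee_fin tri_cos_le2T.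
  rewrite integral_cst; last exact: measurableC.
  apply: (@le_trans _ _ ((2 * T)%:E * (2 * T^-1)%:E)%E).
    rewrite lee_wpmul2l ?lee_fin ?mulr_ge0 ?(ltW T0) // -ball ?invr_gt0 //.
    apply: le_measure; rewrite ?inE //; first exact: measurableC.
      rewrite (_ : [set _ | _] = (fun a : measurableTypeR R => `|a|) @^-1` `]-oo, T^-1]%classic).
        by rewrite -[X in measurable X]setTI; exact: mn.
      by apply/seteqP; split=> a /=; rewrite in_itv.
    by move=> a /= /negP; rewrite -ltNge => /ltW.
  by rewrite -EFinM lee_fin le_eqVlt; apply/orP; left; apply/eqP; field; rewrite gt_eqF.
apply: (@le_trans _ _ (\int[lebesgue_measure]_(a in A)
    ((4 / T)%:E * (`|a| `^ (- 2%:R))%:E))%E).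
  apply: ge0_le_integral => //.
  - exact: measurable_funTS.
  - apply: emeasurable_funM => //; apply/measurable_EFinP/measurable_funTS.
    exact: (measurableT_comp (measurable_powR _) mn).
  - move=> a Aa; rewrite -EFinM lee_fin tri_cos_le_inv //.
    by rewrite -normr_gt0 (lt_le_trans _ Aa) // invr_gt0.
rewrite ge0_integralZl //; last 2 first.
- apply/measurable_EFinP/measurable_funTS.
  exact: (measurableT_comp (measurable_powR _) mn).
- by rewrite lee_fin divr_ge0 // ltW.
apply: (@le_trans _ _ ((4 / T)%:E * (K * 2 * T^-1 `^ (1 - 2%:R))%:E)%E).
  rewrite lee_wpmul2l ?lee_fin ?divr_ge0 ?(ltW T0) //.
  apply: HK => //; first by rewrite invr_gt0.
  move=> r r0; rewrite powRr1 ?(ltW r0) //.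
  by apply: (@le_trans _ _ (2 * r)%:E) => //; rewrite -(ball _ r0) lexx.
rewrite -EFinM lee_fin (_ : 1 - 2%:R = -1 :> R); last by ring.
rewrite powR_inv1 ?invr_ge0 ?(ltW T0) // invrK.
by rewrite le_eqVlt; apply/orP; left; apply/eqP; field; rewrite gt_eqF.
Qed.

End triangle.

Lemma integral_rVS_dom (R : realType) n (f : 'rV[R]_n.+1 -> R)
    (p : R -> R) (q : 'rV[R]_n -> R) : measurable_fun setT f ->
  (@lebesgue_measure R).-integrable setT (EFin \o p) ->
  (lebesgue_rV n).-integrable setT (EFin \o q) ->
  (forall y v, `|f (rV_cons (y, v))| <= p y * q v) ->
  (lebesgue_rV n.+1).-integrable setT (EFin \o f) /\
  \int[lebesgue_rV n.+1]_x f x =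
    \int[lebesgue_measure]_y \int[lebesgue_rV n]_v f (rV_cons (y, v)).
Proof.
move=> mf ip iq fpq.
have mF : measurable_fun setT (EFin \o f) by exact/measurable_EFinP.
have mfc : measurable_fun setT (fun z : measurableTypeR R * 'rV[R]_n => f (rV_cons z)).
  exact: (measurableT_comp mf (@measurable_rV_cons R n)).
have ifc := @integrable_prod_dom _ _ _ _ _ lebesgue_measure (lebesgue_rV n)
  (fun z => f (rV_cons z)) p q mfc ip iq fpq.
split.
  exact: (@integrable_pushforward _ _ _ _ R _ (@measurable_rV_cons R n)
    (@lebesgue_measure R \x lebesgue_rV n)%E setT (EFin \o f) mF ifc measurableT).
rewrite -(@Rintegral_prod_dom _ _ _ _ _ lebesgue_measure (lebesgue_rV n)
  (fun z => f (rV_cons z)) p q mfc ip iq fpq).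
congr fine.
exact: (@integral_pushforward _ _ _ _ R _ (@measurable_rV_cons R n)
    (@lebesgue_measure R \x lebesgue_rV n)%E setT (EFin \o f) mF ifc measurableT).
Qed.

Section triangle_rV.
Context {R : realType}.
Implicit Types T : R.

Definition triV n T (x : 'rV[R]_n) : R := \prod_(i < n) tri T (x ord0 i).

Lemma triV_ge0 n T x : 0 <= @triV n T x.
Proof. by apply: prodr_ge0 => i _; exact: tri_ge0. Qed.

Lemma measurable_triV n T : measurable_fun setT (@triV n T).
Proof.
apply: measurable_prod => i _.
exact: (measurableT_comp (measurable_tri T) (measurable_coord i)).
Qed.

Lemma triV_cons n T y (v : 'rV[R]_n) : triV T (rV_cons (y, v)) = tri T y * triV T v.
Proof.
rewrite /triV big_ord_recl rV_cons0; congr (_ * _).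
by apply: eq_bigr => i _; rewrite rV_consS.
Qed.

Lemma dotrV_cons n (a y : R) (z v : 'rV[R]_n) :
  dotrV (rV_cons (a, z)) (rV_cons (y, v)) = a * y + dotrV z v.
Proof.
rewrite /dotrV big_ord_recl !rV_cons0; congr (_ + _).
by apply: eq_bigr => i _; rewrite !rV_consS.
Qed.

Lemma integrable_triV n T : 0 < T ->
  (lebesgue_rV n).-integrable setT (EFin \o @triV n T).
Proof.
move=> T0; elim: n => [|n ih].
  apply/integrableP; split; first by apply/measurable_EFinP; exact: measurable_triV.
  rewrite /= integral_dirac //; last first.
    apply/measurable_EFinP.
    exact: (measurableT_comp (@normr_measurable _ setT) (measurable_triV T)).
  by rewrite diracE mem_set //= mul1e ltry.
have [] // := @integral_rVS_dom R n (@triV n.+1 T) (tri T) (@triV n T).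
- exact: measurable_triV.
- exact: integrable_tri.
- by move=> y v; rewrite triV_cons ger0_norm // mulr_ge0 ?tri_ge0 ?triV_ge0.
Qed.

Lemma cos_transform_triV_cons n T (a : R) (z : 'rV[R]_n) : 0 < T ->
  cos_transform (@triV n.+1 T) (rV_cons (a, z)) =
  tri_cos T a * cos_transform (@triV n T) z.
Proof.
move=> T0; pose f (x : 'rV[R]_n.+1) := triV T x * cos (dotrV (rV_cons (a, z)) x).
have mf : measurable_fun setT f.
  apply: measurable_funM; first exact: measurable_triV.
  apply: (measurableT_comp (@measurable_cos R)).
  by apply: measurable_dotrV => //; exact: measurable_cst.
have iV := @integrable_triV n T T0.
have [|_ E] := @integral_rVS_dom R n f (tri T) (@triV n T) mf
  (integrable_tri T0) iV.
  move=> y v; rewrite /f normrM ger0_norm ?triV_ge0 // triV_cons.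
  by rewrite ler_piMr ?cos_max // mulr_ge0 ?tri_ge0 ?triV_ge0.
rewrite -[LHS]/(\int[lebesgue_rV n.+1]_x f x) E.
pose S := sin_transform (@triV n T) z.
pose C := cos_transform (@triV n T) z.
transitivity (\int[lebesgue_measure]_y
    (C * (tri T y * cos (a * y)) + (- S) * (tri T y * sin (a * y)))).
  apply: eq_Rintegral => y _.
  transitivity (\int[lebesgue_rV n]_v
     ((tri T y * cos (a * y)) * (triV T v * cos (dotrV z v)) +
      (- (tri T y * sin (a * y))) * (triV T v * sin (dotrV z v)))).
    apply: eq_Rintegral => v _; rewrite /f triV_cons dotrV_cons cosD; ring.
  rewrite RintegralD //.
  - rewrite !RintegralZl //; [|exact: integrable_mul_sin|exact: integrable_mul_cos].
    by rewrite -/(cos_transform _ z) -/(sin_transform _ z) /C /S; ring.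
  - exact: (integrableZl measurableT _ (integrable_mul_cos z iV)).
  - exact: (integrableZl measurableT _ (integrable_mul_sin z iV)).
have ic : (@lebesgue_measure R).-integrable setT
    (EFin \o (fun y => tri T y * cos (a * y))).
  by apply: integrable_tri_trig => //; [exact: measurable_cos|exact: cos_max].
have is_ : (@lebesgue_measure R).-integrable setT
    (EFin \o (fun y => tri T y * sin (a * y))).
  by apply: integrable_tri_trig => //; [exact: measurable_sin|exact: sin_max].
rewrite RintegralD //.
- rewrite !RintegralZl // Rintegral_tri_sin mulr0 addr0.
  by rewrite mulrC.
- exact: (integrableZl measurableT _ ic).
- exact: (integrableZl measurableT _ is_).
Qed.

Lemma integral_cos_transform_triV n : exists2 K : R, 0 <= K & forall T, 0 < T ->
  (\int[lebesgue_rV n]_z (`|cos_transform (@triV n T) z|)%:E <= K%:E)%E.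
Proof.
have mct m T : measurable_fun setT (fun z => (`|cos_transform (@triV m T) z|)%:E).
  apply/measurable_EFinP; apply: (measurableT_comp (@normr_measurable _ setT)).
  by apply: measurable_cos_transform; exact: measurable_triV.
have [K1 K10 HK1] := @integral_tri_cos_le R.
elim: n => [|n [K K0 HK]].
  exists 1 => // T T0; rewrite integral_dirac //; last exact: (mct 0%N T).
  rewrite diracE mem_set //= mul1e lee_fin.
  rewrite /cos_transform /Rintegral /= integral_dirac //; last first.
    apply/measurable_EFinP; apply: measurable_funM; first exact: measurable_triV.
    apply: (measurableT_comp (@measurable_cos R)).
    by apply: measurable_dotrV => //; exact: measurable_cst.
  rewrite diracE mem_set //= mul1r /triV big_ord0 mul1r.
  exact: cos_max.
exists (K1 * K) => [|T T0]; first exact: mulr_ge0.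
rewrite ge0_integral_lebesgue_rVS //.
apply: (@le_trans _ _ (\int[lebesgue_measure]_a ((`|tri_cos T a|)%:E * K%:E))%E).
  apply: ge0_le_integral => //.
  - by move=> a _; apply: integral_ge0.
  - apply: (@measurable_fun_fubini_tonelli_F _ _ (measurableTypeR R) 'rV[R]_n R
      (lebesgue_rV n) (fun p => (`|cos_transform (@triV n.+1 T) (rV_cons p)|)%:E)).
      exact: (measurableT_comp (mct n.+1 T) (@measurable_rV_cons R n)).
    by move=> p; rewrite lee_fin.
  - apply: emeasurable_funM => //; apply/measurable_EFinP.
    exact: (measurableT_comp (@normr_measurable _ setT) (measurable_tri_cos T)).
  - move=> a _; under eq_integral do rewrite cos_transform_triV_cons // normrM EFinM.
    rewrite ge0_integralZl ?lee_fin //.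
      by rewrite lee_wpmul2l ?lee_fin // HK.
    exact: mct.
rewrite ge0_integralZr ?lee_fin //.
  by rewrite EFinM lee_wpmul2r ?lee_fin // HK1.
apply/measurable_EFinP.
exact: (measurableT_comp (@normr_measurable _ setT) (measurable_tri_cos T)).
Qed.

Definition boxV n (A : R) : set 'rV[R]_n := [set x | forall i, `|x ord0 i| <= A].

Lemma measurable_boxV n A : measurable (@boxV n A).
Proof.
rewrite (_ : boxV A = \bigcap_(i in [set: 'I_n])
    ((fun x : 'rV[R]_n => x ord0 i) @^-1` `[- A, A]%classic)).
  apply: fin_bigcap_measurable => // i _; rewrite -[X in measurable X]setTI.
  exact: measurable_coord.
apply/seteqP; split=> x /= Bx i; first by move=> _ /=; rewrite in_itv /= -ler_norml.
by have := Bx i I; rewrite /= in_itv /= -ler_norml.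
Qed.

(* [triV (2 * A)] is at least [2 ^- n] on the box, and the integral of the modulus of its
   transform is bounded independently of [A]. *)
Lemma bessel_box n : exists2 K : R, 0 <= K & forall (u : 'rV[R]_n -> R) (A : R),
  0 < A -> (lebesgue_rV n).-integrable setT (EFin \o u) ->
  (\int[lebesgue_rV n]_(x in boxV A)
     (cos_transform u x ^+ 2 + sin_transform u x ^+ 2)%:E
   <= K%:E * \int[lebesgue_rV n]_xi (u xi ^+ 2)%:E)%E.
Proof.
have [K K0 HK] := integral_cos_transform_triV n.
exists (2 ^+ n * (2 * K)); first by rewrite mulr_ge0 ?exprn_ge0 // mulr_ge0.
move=> u A A0 iu; set B := boxV A.
have T0 : 0 < 2 * A by rewrite mulr_gt0.
have mB : measurable B by exact: measurable_boxV.
pose F x := cos_transform u x ^+ 2 + sin_transform u x ^+ 2.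
have mu := measurable_integrableR iu.
have mF : measurable_fun setT F.
  apply: measurable_funD; apply: measurable_funX.
    exact: measurable_cos_transform.
  exact: measurable_sin_transform.
have F0 x : 0 <= F x by rewrite addr_ge0 // sqr_ge0.
have mWF : measurable_fun setT (fun x => (triV (2 * A) x * F x)%:E).
  by apply/measurable_EFinP; apply: measurable_funM => //; exact: measurable_triV.
have WF0 x : (0 <= (triV (2 * A) x * F x)%:E)%E by rewrite lee_fin mulr_ge0 ?triV_ge0.
apply: (@le_trans _ _ (\int[lebesgue_rV n]_(x in B)
    ((2 ^+ n)%:E * (triV (2 * A) x * F x)%:E))%E).
  apply: ge0_le_integral => //.
  - by move=> x _; rewrite lee_fin addr_ge0 // sqr_ge0.
  - by apply/measurable_EFinP/measurable_funTS.
  - by apply: emeasurable_funM => //; exact: measurable_funTS.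
  - move=> x Bx; rewrite -EFinM lee_fin mulrA ler_peMl //; first exact: F0.
    rewrite /triV -[X in 2 ^+ X](card_ord n) -prodr_const -big_split /=.
    apply: (big_ind (fun y => 1 <= y)) => // [y y' *|i _].
      exact: mulr_ege1.
    have xA := Bx i; have xA2 : `|x ord0 i| <= 2 * A by lra.
    rewrite tri_in // mulrBr mulr1 lerBrDr -lerBrDl.
    by rewrite mulrA ler_pdivrMr //; lra.
rewrite ge0_integralZl //; last exact: measurable_funTS.
rewrite EFinM -muleA lee_wpmul2l ?lee_fin ?exprn_ge0 //.
apply: le_trans (weighted_bessel (integrable_triV n T0) (@triV_ge0 n _) iu (HK _ T0)).
by apply: ge0_subset_integral.
Qed.

End triangle_rV.

(** * Weighted bounds for a Fourier transform from differences of the function *)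

Section complex_fourier.
Context {R : realType} {d : nat}.
Implicit Types (f g : 'rV[R]_d -> R[i]) (x xi e : 'rV[R]_d) (z w : R[i]).
Let mu : {sigma_finite_measure set 'rV[R]_d -> \bar R} := lebesgue_rV d.
Local Notation Re := complex.Re.
Local Notation Im := complex.Im.
Local Notation normc := Normc.normc.

Definition cintegrable f :=
  mu.-integrable setT (EFin \o (fun xi => Re (f xi))) /\
  mu.-integrable setT (EFin \o (fun xi => Im (f xi))).

Definition cfourier f x : R[i] :=
  cintegral mu setT (fun xi => cexp (0 +i* dotrV xi x) * f xi).

Lemma normc_sqr z : normc z ^+ 2 = Re z ^+ 2 + Im z ^+ 2.
Proof. by case: z => p q; rewrite /= sqr_sqrtr // addr_ge0 ?sqr_ge0. Qed.

Lemma normc_ge0 z : 0 <= normc z.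
Proof. by case: z => p q; exact: sqrtr_ge0. Qed.

Lemma ReM z w : Re (z * w) = Re z * Re w - Im z * Im w.
Proof. by case: z => ? ?; case: w. Qed.

Lemma ImM z w : Im (z * w) = Re z * Im w + Im z * Re w.
Proof. by case: z => ? ?; case: w. Qed.

Lemma ReB z w : Re (z - w) = Re z - Re w.
Proof. by case: z => ? ?; case: w. Qed.

Lemma ImB z w : Im (z - w) = Im z - Im w.
Proof. by case: z => ? ?; case: w. Qed.

Lemma eq_ReIm z w : Re z = Re w -> Im z = Im w -> z = w.
Proof. by case: z => ? ?; case: w => ? ? /= -> ->. Qed.

Lemma normcD z w : normc (z + w) <= normc z + normc w.
Proof. by have := ler_normD z w; rewrite lecE => /andP[_]. Qed.

Lemma normcN z : normc (- z) = normc z.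
Proof. by case: z => p q /=; rewrite !sqrrN. Qed.

Lemma normcB z w : normc (z - w) <= normc z + normc w.
Proof. by rewrite -(normcN w); exact: normcD. Qed.

Lemma normRe_le z : `|Re z| <= normc z.
Proof.
by case: z => p q /=; rewrite -sqrtr_sqr ler_sqrt ?addr_ge0 ?sqr_ge0 // lerDl sqr_ge0.
Qed.

Lemma normIm_le z : `|Im z| <= normc z.
Proof.
by case: z => p q /=; rewrite -sqrtr_sqr ler_sqrt ?addr_ge0 ?sqr_ge0 // lerDr sqr_ge0.
Qed.

Lemma cexp_iE (t : R) : cexp (0 +i* t) = cos t +i* sin t.
Proof. by rewrite /cexp /= expR0 !mul1r. Qed.

Lemma cfourierE f x : cintegrable f ->
  cfourier f x =
    (cos_transform (fun xi => Re (f xi)) x - sin_transform (fun xi => Im (f xi)) x)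
    +i* (sin_transform (fun xi => Re (f xi)) x + cos_transform (fun xi => Im (f xi)) x).
Proof.
move=> [ir ii]; rewrite /cfourier /cintegral; apply: eq_ReIm => /=.
  rewrite -RintegralB //; [|exact: integrable_mul_cos|exact: integrable_mul_sin].
  by apply: eq_Rintegral => xi _; rewrite cexp_iE ReM /= dotrVC; ring.
rewrite -RintegralD //; [|exact: integrable_mul_sin|exact: integrable_mul_cos].
by apply: eq_Rintegral => xi _; rewrite cexp_iE ImM /= dotrVC; ring.
Qed.

Lemma normc_cfourier_sqr_le f x : cintegrable f ->
  normc (cfourier f x) ^+ 2 <=
  2 * ((cos_transform (fun xi => Re (f xi)) x ^+ 2 +
        sin_transform (fun xi => Re (f xi)) x ^+ 2) +
       (cos_transform (fun xi => Im (f xi)) x ^+ 2 +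
        sin_transform (fun xi => Im (f xi)) x ^+ 2)).
Proof.
move=> cf; rewrite normc_sqr cfourierE //=.
set p := cos_transform _ x; set q := sin_transform _ x.
set r := sin_transform _ x; set s := cos_transform _ x.
by have := sqr_ge0 (p + q); have := sqr_ge0 (r - s); nra.
Qed.

Lemma measurable_normc (dd : measure_display) (T : measurableType dd)
    (h : T -> R[i]) :
  measurable_fun setT (fun t => Re (h t)) -> measurable_fun setT (fun t => Im (h t)) ->
  measurable_fun setT (fun t => normc (h t)).
Proof.
move=> mr mi.
rewrite (_ : (fun t => normc (h t)) =
    (fun t => (Re (h t) ^+ 2 + Im (h t) ^+ 2) `^ (2^-1))).
  apply: (measurableT_comp (measurable_powR _)).
  by apply: measurable_funD; exact: measurable_funX.
apply/funext => t; rewrite powR12_sqrt ?addr_ge0 ?sqr_ge0 //.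
by case: (h t).
Qed.

Lemma measurable_normc_cfourier f : cintegrable f ->
  measurable_fun setT (fun x => normc (cfourier f x)).
Proof.
move=> cf; have [ir ii] := cf.
have mr := measurable_integrableR ir; have mi := measurable_integrableR ii.
under eq_fun do rewrite cfourierE //.
apply: measurable_normc => /=.
  by apply: measurable_funB;
    [exact: measurable_cos_transform|exact: measurable_sin_transform].
by apply: measurable_funD;
  [exact: measurable_sin_transform|exact: measurable_cos_transform].
Qed.

Lemma measurable_normc_cintegrable f : cintegrable f ->
  measurable_fun setT (fun x => normc (f x)).
Proof.
by move=> [ir ii]; apply: measurable_normc; [move: ir|move: ii];
  exact: measurable_integrableR.
Qed.

Lemma bessel_cfourier : exists2 K : R, 0 <= K & forall f (A : R), 0 < A ->
  cintegrable f ->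
  (\int[mu]_(x in boxV A) (normc (cfourier f x) ^+ 2)%:E <=
   K%:E * \int[mu]_xi (normc (f xi) ^+ 2)%:E)%E.
Proof.
have [K K0 HK] := @bessel_box R d.
exists (2 * (K + K)) => [|f A A0 cf]; first by rewrite mulr_ge0 // addr_ge0.
have [ir ii] := cf; have mB := @measurable_boxV R d A.
have mr := measurable_integrableR ir; have mi := measurable_integrableR ii.
pose T (u : 'rV[R]_d -> R) x := cos_transform u x ^+ 2 + sin_transform u x ^+ 2.
have mT u : measurable_fun setT u -> measurable_fun setT (T u).
  move=> mu'; apply: measurable_funD; apply: measurable_funX.
    exact: measurable_cos_transform.
  exact: measurable_sin_transform.
have T0 u x : 0 <= T u x by rewrite addr_ge0 // sqr_ge0.
pose I := (\int[mu]_xi (normc (f xi) ^+ 2)%:E)%E.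
have mn2 : measurable_fun setT (fun xi => (normc (f xi) ^+ 2)%:E).
  apply/measurable_EFinP; apply: measurable_funX.
  exact: measurable_normc_cintegrable.
have part (p : R[i] -> R) : (forall z, `|p z| <= normc z) ->
    mu.-integrable setT (EFin \o (fun xi => p (f xi))) ->
    (\int[mu]_(x in boxV A) (T (fun xi => p (f xi)) x)%:E <= K%:E * I)%E.
  move=> pn ip; apply: le_trans (HK _ _ A0 ip) _.
  rewrite lee_wpmul2l ?lee_fin //; apply: ge0_le_integral => //.
  - by move=> xi _; rewrite lee_fin sqr_ge0.
  - apply/measurable_EFinP; apply: measurable_funX.
    exact: (measurable_integrableR ip).
  - move=> xi _; rewrite lee_fin -[leLHS]real_normK ?num_real //.
    by rewrite lerXn2r ?nnegrE ?normc_ge0.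
apply: (@le_trans _ _ (\int[mu]_(x in boxV A) (2%:E *
    ((T (fun xi => Re (f xi)) x)%:E + (T (fun xi => Im (f xi)) x)%:E)))%E).
  apply: ge0_le_integral => //.
  - by move=> x _; rewrite lee_fin sqr_ge0.
  - apply/measurable_EFinP/measurable_funTS; apply: measurable_funX.
    exact: measurable_normc_cfourier.
  - apply: emeasurable_funM => //; apply: emeasurable_funD.
      by apply/measurable_EFinP/measurable_funTS; exact: mT.
    by apply/measurable_EFinP/measurable_funTS; exact: mT.
  - by move=> x _; rewrite -EFinD -EFinM lee_fin; exact: normc_cfourier_sqr_le.
have mTB u : measurable_fun setT u -> measurable_fun (boxV A) (fun x => (T u x)%:E).
  by move=> mu'; apply/measurable_EFinP/measurable_funTS; exact: mT.
rewrite ge0_integralZl //; last 2 first.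
- by apply: emeasurable_funD; exact: mTB.
- by move=> x _; rewrite -EFinD lee_fin addr_ge0.
rewrite ge0_integralD //; last 4 first.
- by move=> x _; rewrite lee_fin.
- exact: mTB.
- by move=> x _; rewrite lee_fin.
- exact: mTB.
apply: (@le_trans _ _ (2%:E * (K%:E * I + K%:E * I))%E).
  rewrite lee_wpmul2l ?lee_fin //; apply: leeD.
    by apply: part => //; exact: normRe_le.
  by apply: part => //; exact: normIm_le.
have I0 : (0 <= I)%E by apply: integral_ge0 => x _; rewrite lee_fin sqr_ge0.
by rewrite -ge0_muleDl ?lee_fin // muleA -EFinD -EFinM.
Qed.

Lemma cintegrableB f g : cintegrable f -> cintegrable g ->
  cintegrable (fun xi => f xi - g xi).
Proof.
move=> [fr fi] [gr gi]; split.
  under [X in _.-integrable _ X]eq_fun do rewrite /= ReB EFinB.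
  exact: integrableB.
under [X in _.-integrable _ X]eq_fun do rewrite /= ImB EFinB.
exact: integrableB.
Qed.

Lemma integrable_shift (u : 'rV[R]_d -> R) e :
  mu.-integrable setT (EFin \o u) ->
  mu.-integrable setT (EFin \o (fun xi => u (xi + e))).
Proof.
move=> iu; have mu' := measurable_integrableR iu; apply/integrableP; split.
  apply/measurable_EFinP; apply: (measurableT_comp mu').
  exact: measurable_fun_rV_shift.
have /integrableP[_] := iu.
rewrite -[X in (X < _)%E -> _](ge0_integral_rV_shift e) //.
by apply: measurableT_comp => //; exact/measurable_EFinP.
Qed.

Lemma cintegrable_shift f e : cintegrable f -> cintegrable (fun xi => f (xi + e)).
Proof.
by move=> [ir ii]; split; [apply: (@integrable_shift (fun xi => Re (f xi)))|
  apply: (@integrable_shift (fun xi => Im (f xi)))].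
Qed.

Lemma cfourierB f g x : cintegrable f -> cintegrable g ->
  cfourier (fun xi => f xi - g xi) x = cfourier f x - cfourier g x.
Proof.
move=> cf cg; have [fr fi] := cf; have [gr gi] := cg.
rewrite !cfourierE //; last exact: cintegrableB.
have cB (u v : 'rV[R]_d -> R) : mu.-integrable setT (EFin \o u) ->
    mu.-integrable setT (EFin \o v) ->
    cos_transform (fun xi => u xi - v xi) x = cos_transform u x - cos_transform v x.
  move=> iu iv; rewrite /cos_transform -RintegralB //; last 2 first.
  - exact: integrable_mul_cos.
  - exact: integrable_mul_cos.
  by apply: eq_Rintegral => xi _; ring.
have sB (u v : 'rV[R]_d -> R) : mu.-integrable setT (EFin \o u) ->
    mu.-integrable setT (EFin \o v) ->
    sin_transform (fun xi => u xi - v xi) x = sin_transform u x - sin_transform v x.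
  move=> iu iv; rewrite /sin_transform -RintegralB //; last 2 first.
  - exact: integrable_mul_sin.
  - exact: integrable_mul_sin.
  by apply: eq_Rintegral => xi _; ring.
have -> : (fun xi => Re (f xi - g xi)) = (fun xi => Re (f xi) - Re (g xi)).
  by apply/funext => xi; rewrite ReB.
have -> : (fun xi => Im (f xi - g xi)) = (fun xi => Im (f xi) - Im (g xi)).
  by apply/funext => xi; rewrite ImB.
apply: eq_ReIm; rewrite ?ReB ?ImB /= !cB // !sB //; ring.
Qed.

Lemma Rintegral_rV_shift (u : 'rV[R]_d -> R) e : measurable_fun setT u ->
  \int[mu]_xi u (xi + e) = \int[mu]_xi u xi.
Proof.
move=> mu'; congr fine.
by apply: (integral_rV_shift e (F := fun xi => (u xi)%:E)); exact/measurable_EFinP.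
Qed.

Lemma cfourier_shift f x e : cintegrable f ->
  cfourier (fun xi => f (xi + e)) x = cexp (0 +i* (- dotrV e x)) * cfourier f x.
Proof.
move=> cf; have [fr fi] := cf.
rewrite !cfourierE //; last exact: cintegrable_shift.
have cs (u : 'rV[R]_d -> R) : mu.-integrable setT (EFin \o u) ->
    cos_transform (fun xi => u (xi + e)) x =
    cos (dotrV e x) * cos_transform u x + sin (dotrV e x) * sin_transform u x.
  move=> iu; rewrite /cos_transform /sin_transform -!RintegralZl //; last 2 first.
  - exact: integrable_mul_sin.
  - exact: integrable_mul_cos.
  rewrite -RintegralD //; last 2 first.
  - exact: (integrableZl measurableT _ (integrable_mul_cos x iu)).
  - exact: (integrableZl measurableT _ (integrable_mul_sin x iu)).
  rewrite -[RHS](Rintegral_rV_shift e).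
    apply: eq_Rintegral => xi _.
    have -> : dotrV x xi = dotrV x (xi + e) - dotrV e x.
      by rewrite !(dotrVC x) -dotrVBl addrK.
    by rewrite cosB; ring.
  apply: measurable_funD; apply: measurable_funM => //; apply: measurable_integrableR.
    exact: integrable_mul_cos.
  exact: integrable_mul_sin.
have ss (u : 'rV[R]_d -> R) : mu.-integrable setT (EFin \o u) ->
    sin_transform (fun xi => u (xi + e)) x =
    cos (dotrV e x) * sin_transform u x - sin (dotrV e x) * cos_transform u x.
  move=> iu; rewrite /cos_transform /sin_transform -!RintegralZl //; last 2 first.
  - exact: integrable_mul_cos.
  - exact: integrable_mul_sin.
  rewrite -RintegralB //; last 2 first.
  - exact: (integrableZl measurableT _ (integrable_mul_sin x iu)).
  - exact: (integrableZl measurableT _ (integrable_mul_cos x iu)).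
  rewrite -[RHS](Rintegral_rV_shift e).
    apply: eq_Rintegral => xi _.
    have -> : dotrV x xi = dotrV x (xi + e) - dotrV e x.
      by rewrite !(dotrVC x) -dotrVBl addrK.
    by rewrite sinB; ring.
  apply: measurable_funB; apply: measurable_funM => //; apply: measurable_integrableR.
    exact: integrable_mul_sin.
  exact: integrable_mul_cos.
rewrite cexp_iE cosN sinN.
rewrite (cs (fun xi => Re (f xi))) // (cs (fun xi => Im (f xi))) //.
rewrite (ss (fun xi => Re (f xi))) // (ss (fun xi => Im (f xi))) //.
by apply: eq_ReIm; rewrite ?ReM ?ImM /=; ring.
Qed.

Definition diffV e f : 'rV[R]_d -> R[i] := fun xi => f (xi + e) - f xi.

Lemma cintegrable_diff m e f : cintegrable f -> cintegrable (iter m (diffV e) f).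
Proof.
move=> cf; elim: m => //= m ih; apply: cintegrableB => //.
exact: (cintegrable_shift e ih).
Qed.

Lemma cfourier_diff m e f x : cintegrable f ->
  cfourier (iter m (diffV e) f) x =
  (cexp (0 +i* (- dotrV e x)) - 1) ^+ m * cfourier f x.
Proof.
move=> cf; elim: m => [|m ih]; first by rewrite expr0 mul1r.
rewrite iterS /diffV cfourierB; last 2 first.
- exact/cintegrable_shift/cintegrable_diff.
- exact: cintegrable_diff.
by rewrite cfourier_shift ?ih; [rewrite exprS; ring|exact: cintegrable_diff].
Qed.

Lemma normc_cexpB1_ge1 (t : R) : pi / 2 <= `|t| <= pi ->
  1 <= normc (cexp (0 +i* (- t)) - 1).
Proof.
move=> /andP[t1 t2].
have ct : cos t <= 0.
  rewrite -cos_norm -[`|t|](subrK (pi / 2)) cosDpihalf oppr_le0.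
  by apply: sin_ge0_pi; have := @pi_ge0 R; lra.
rewrite -(@ler_pXn2r _ 2) ?nnegrE ?normc_ge0 // expr1n normc_sqr cexp_iE ReB ImB /=.
rewrite cosN sinN; have := cos2Dsin2 t.
by nra.
Qed.

(* There the multiplier [e^(-i h x_i) - 1] of a difference has modulus at least 1. *)
Lemma normc_cfourier_le_diff m (h : R) i f x : cintegrable f ->
  pi / 2 <= `|h * x ord0 i| <= pi ->
  normc (cfourier f x) <=
  normc (cfourier (iter m (diffV (h *: delta_mx ord0 i)) f) x).
Proof.
move=> cf ht; rewrite cfourier_diff // Normc.normcM ler_peMl ?normc_ge0 //.
have -> : dotrV (h *: delta_mx ord0 i) x = h * x ord0 i.
  rewrite /dotrV (bigD1 i) //= big1 ?addr0 ?mxE ?eqxx ?mulr1 // => j ji.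
  by rewrite !mxE (negbTE ji) andbF mulr0 mul0r.
have := normc_cexpB1_ge1 ht; elim: m => [|m ih] h1.
  by rewrite expr0 Normc.normc1.
by rewrite exprS Normc.normcM mulr_ege1 // ih.
Qed.

Lemma normc_iter_diff_le m e g xi (B : R) :
  (forall k, (k <= m)%N -> normc (g (xi + k%:R *: e)) <= B) ->
  normc (iter m (diffV e) g xi) <= 2 ^+ m * B.
Proof.
elim: m g xi B => [|m ih] g xi B HB.
  by have := HB 0%N isT; rewrite scale0r addr0 expr0 mul1r.
rewrite iterSr exprSr -mulrA; apply: ih => k km.
apply: le_trans (normcB _ _) _; rewrite mulr2n mulrDl mul1r lerD //.
  rewrite -addrA -{2}[e]scale1r -scalerDl natr1.
  exact: HB.
by apply: HB; rewrite ltnW.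
Qed.

Lemma iter_diff_subc m e g (c : R[i]) :
  iter m.+1 (diffV e) (fun xi => g xi - c) = iter m.+1 (diffV e) g.
Proof.
rewrite !iterSr; congr iter; apply/funext => xi; rewrite /diffV.
by rewrite opprB addrA subrK.
Qed.

End complex_fourier.

Section weighted_fourier.
Context {R : realType} {d : nat}.
Implicit Types (f g : 'rV[R]_d -> R[i]) (x xi e : 'rV[R]_d).
Let mu : {sigma_finite_measure set 'rV[R]_d -> \bar R} := lebesgue_rV d.
Local Notation Re := complex.Re.
Local Notation Im := complex.Im.
Local Notation normc := Normc.normc.

Lemma enorm_ge0 x : 0 <= enorm x.
Proof. exact: sqrtr_ge0. Qed.

Lemma dotrV_ge0 x : 0 <= dotrV x x.
Proof. by apply: sumr_ge0 => i _; rewrite -expr2 sqr_ge0. Qed.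

Lemma enorm_sqr x : enorm x ^+ 2 = dotrV x x.
Proof. by rewrite sqr_sqrtr ?dotrV_ge0. Qed.

Lemma normr_coord_le x i : `|x ord0 i| <= enorm x.
Proof.
rewrite -(@ler_pXn2r _ 2) ?nnegrE ?enorm_ge0 // enorm_sqr real_normK ?num_real //.
rewrite /dotrV (bigD1 i) //= -expr2 lerDl.
by apply: sumr_ge0 => j _; rewrite -expr2 sqr_ge0.
Qed.

Lemma enorm0 : enorm (0 : 'rV[R]_d) = 0.
Proof.
by rewrite /enorm /dotrV big1 ?sqrtr0 // => i _; rewrite mxE mul0r.
Qed.

Lemma enorm_eq0 x : (enorm x == 0) = (x == 0).
Proof.
apply/eqP/eqP => [x0|->]; last exact: enorm0.
apply/rowP => i; rewrite mxE; apply/eqP; rewrite -normr_le0 -x0.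
exact: normr_coord_le.
Qed.

Lemma enormZ (r : R) x : enorm (r *: x) = `|r| * enorm x.
Proof.
rewrite /enorm (_ : dotrV _ _ = r ^+ 2 * dotrV x x).
  by rewrite sqrtrM ?sqr_ge0 // sqrtr_sqr.
by rewrite /dotrV mulr_sumr; apply: eq_bigr => i _; rewrite !mxE; ring.
Qed.

Lemma enormD_delta_le x i (t : R) :
  enorm (x + t *: delta_mx ord0 i) <= enorm x + `|t|.
Proof.
rewrite -(@ler_pXn2r _ 2) ?nnegrE ?addr_ge0 ?enorm_ge0 // enorm_sqr sqrrD enorm_sqr.
rewrite real_normK ?num_real //.
have -> : dotrV (x + t *: delta_mx ord0 i) (x + t *: delta_mx ord0 i) =
    dotrV x x + 2 * t * x ord0 i + t ^+ 2.
  rewrite /dotrV (bigD1 i) //= [X in _ = X + _ + _](bigD1 i) //= !mxE !eqxx mulr1.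
  rewrite (eq_bigr (fun j => x ord0 j * x ord0 j)); first by ring.
  by move=> j ji; rewrite !mxE (negbTE ji) andbF mulr0 addr0.
rewrite lerD2r lerD2l.
have tx : t * x ord0 i <= `|t| * enorm x.
  by apply: le_trans (ler_norm _) _; rewrite normrM ler_wpM2l // normr_coord_le.
by rewrite mulr2n; lra.
Qed.

Lemma measurable_enorm : measurable_fun setT (@enorm R d).
Proof.
rewrite (_ : @enorm R d = fun x => dotrV x x `^ (2^-1)).
  by apply: (measurableT_comp (measurable_powR _)); exact: measurable_dotrV.
by apply/funext => x; rewrite powR12_sqrt ?dotrV_ge0.
Qed.

Lemma lebesgue_boxV (A : R) : 0 < A -> (mu (boxV A) = ((2 * A) ^+ d)%:E)%E.
Proof.
move=> A0; rewrite (_ : boxV A = [set x | forall i, `[- A, A]%classic (x ord0 i)]).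
  rewrite (@lebesgue_rV_box R d (fun=> `[- A, A]%classic)) //.
  rewrite (eq_bigr (fun=> (2 * A)%:E)) => [|i _].
    by rewrite prodEFin prodr_const card_ord.
  rewrite lebesgue_measure_itv /= lte_fin gtrN // -EFinD opprK.
  by congr EFin; ring.
by apply/seteqP; split=> x /= xA i; move: (xA i); rewrite /= in_itv /= -ler_norml.
Qed.

Lemma lebesgue_enorm_le (r : R) : 0 < r ->
  (mu [set x | (enorm x <= r)%R] <= (2 ^+ d * r `^ d%:R)%:E)%E.
Proof.
move=> r0; rewrite powR_mulrn ?(ltW r0) // -exprMn -lebesgue_boxV //.
apply: le_measure; rewrite ?inE.
- rewrite -[X in measurable X]setTI.
  rewrite (_ : [set _ | _] = @enorm R d @^-1` `]-oo, r]%classic).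
    by apply: measurable_enorm => //; exact: measurable_itv.
  by apply/seteqP; split=> x /=; rewrite in_itv.
- exact: measurable_boxV.
- by move=> x /= xr i; exact: le_trans (normr_coord_le _ _) xr.
Qed.

Lemma enorm_boxV_le (A : R) x : 0 <= A -> boxV A x -> enorm x <= d%:R * A.
Proof.
move=> A0 xA; rewrite -(@ler_pXn2r _ 2) ?nnegrE ?enorm_ge0 ?mulr_ge0 // enorm_sqr.
apply: (@le_trans _ _ (\sum_(i < d) A ^+ 2)).
  apply: ler_sum => i _; rewrite -expr2 -[leLHS]real_normK ?num_real //.
  by rewrite lerXn2r ?nnegrE.
rewrite sumr_const card_ord exprMn -[leLHS]mulr_natl ler_wpM2r ?sqr_ge0 //.
by rewrite -natrX ler_nat; case: (d) => // n; rewrite expnS leq_pmulr // expn1.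
Qed.

(* Near the origin the difference is controlled by [f - c]; far from it the second bound is
   square integrable since [2 * (m - sigma) > d]. *)
Lemma diff_L2_le (m : nat) (sigma : R) : 0 < sigma -> d%:R + 2 * sigma < 2 * m%:R ->
  exists2 K : R, 0 <= K & forall (C1 C2 : R) f (c : R[i]) i (h : R),
  0 <= C1 -> 0 <= C2 -> 0 < h -> cintegrable f ->
  (forall xi, normc (f xi - c) <= C1 * enorm xi `^ sigma) ->
  (forall xi, 2 * m%:R * h <= enorm xi ->
    normc (iter m (diffV (h *: delta_mx ord0 i)) f xi) <=
      C2 * h ^+ m * enorm xi `^ (sigma - m%:R)) ->
  (\int[mu]_xi (normc (iter m (diffV (h *: delta_mx ord0 i)) f xi) ^+ 2)%:E
    <= (K * (C1 ^+ 2 + C2 ^+ 2) * h `^ (d%:R + 2 * sigma))%:E)%E.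
Proof.
move=> s0 dm; pose q := 2 * m%:R - 2 * sigma.
have m0 : (0 < m)%N.
  rewrite lt0n; apply/negP => /eqP mE; move: dm; rewrite mE mulr0.
  by have := ler0n R d; lra.
have M0 : 0 < m%:R :> R by rewrite ltr0n.
have [||K1 K10 HK1] := @integral_layer_cake_le R d%:R q; [by []|by rewrite /q; lra|].
pose Kn := (2 ^+ m * (3 * m%:R) `^ sigma) ^+ 2 * (2 ^+ d * (2 * m%:R) `^ d%:R).
pose Kf := K1 * 2 ^+ d * (2 * m%:R) `^ (d%:R - q).
have Kn0 : 0 <= Kn by rewrite mulr_ge0 ?sqr_ge0 // mulr_ge0 ?exprn_ge0 ?powR_ge0.
have Kf0 : 0 <= Kf by rewrite !mulr_ge0 ?exprn_ge0 ?powR_ge0.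
exists (Kn + Kf) => [|C1 C2 f c i h C10 C20 h0 cf Hn Hf]; first by rewrite addr_ge0.
set e := h *: _; pose D xi := normc (iter m (diffV e) f xi).
have mD : measurable_fun setT (fun xi => (D xi ^+ 2)%:E).
  apply/measurable_EFinP; apply: measurable_funX.
  by apply: measurable_normc_cintegrable; exact: cintegrable_diff.
have rho0 : 0 < 2 * m%:R * h by rewrite !mulr_gt0.
pose A := [set xi : 'rV[R]_d | 2 * m%:R * h <= enorm xi].
have mA : measurable A.
  rewrite (_ : A = @enorm R d @^-1` `[2 * m%:R * h, +oo[%classic).
    rewrite -[X in measurable X]setTI.
    by apply: measurable_enorm => //; exact: measurable_itv.
  by apply/seteqP; split=> x /=; rewrite in_itv /= andbT.
have mpow (p : R) : measurable_fun A (fun xi => (enorm xi `^ p)%:E).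
  apply/measurable_EFinP/measurable_funTS.
  exact: (measurableT_comp (measurable_powR _) measurable_enorm).
pose H := h `^ (d%:R + 2 * sigma).
have H0 : 0 <= H by exact: powR_ge0.
have hs (t : R) : 0 <= t -> ((t * h) `^ sigma) ^+ 2 = (t `^ sigma) ^+ 2 * h `^ (2 * sigma).
  move=> t0; rewrite powRM ?(ltW h0) // exprMn; congr (_ * _).
  by rewrite -powR_mulrn ?powR_ge0 // -powRrM mulrC.
rewrite -(setvU A) ge0_integral_setU //; last 4 first.
- exact: measurableC.
- by rewrite setvU; exact: mD.
- by move=> a _; rewrite lee_fin sqr_ge0.
- by apply/disj_setPS => a [].
apply: (@le_trans _ _ ((Kn * C1 ^+ 2 * H)%:E + (Kf * C2 ^+ 2 * H)%:E)%E); last first.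
  rewrite -EFinD lee_fin -mulrDl ler_wpM2r //.
  have := sqr_ge0 C1; have := sqr_ge0 C2; nra.
apply: leeD.
  pose B := C1 * (3 * m%:R * h) `^ sigma.
  have B0 : 0 <= B by rewrite mulr_ge0 ?powR_ge0.
  apply: (@le_trans _ _ (\int[mu]_(xi in ~` A) ((2 ^+ m * B) ^+ 2)%:E)%E).
    apply: ge0_le_integral => //.
    - exact: measurableC.
    - by move=> x _; rewrite lee_fin sqr_ge0.
    - exact: measurable_funTS.
    - move=> xi /= /negP; rewrite -ltNge => xiA; rewrite lee_fin.
      have B20 : 0 <= 2 ^+ m * B by apply: mulr_ge0 => //; exact: exprn_ge0.
      rewrite lerXn2r ?nnegrE ?normc_ge0 // {B20}.
      rewrite /D; case: m m0 M0 {dm q Hf K1 K10 HK1 Kn Kf Kn0 Kf0 D mD A mA mpow H H0}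
        @B B0 xiA rho0 => // n _ M0 B B0 xiA rho0.
      rewrite -(iter_diff_subc n e f c); apply: normc_iter_diff_le => k kn.
      apply: le_trans (Hn _) _; rewrite ler_wpM2l // ge0_ler_powR ?nnegrE ?(ltW s0) ?enorm_ge0 //.
        by rewrite !mulr_ge0 // ltW.
      rewrite scalerA; apply: le_trans (enormD_delta_le _ _ _) _.
      rewrite ger0_norm ?mulr_ge0 ?(ltW h0) //.
      have : k%:R * h <= n.+1%:R * h by rewrite ler_wpM2r ?(ltW h0) // ler_nat.
      by lra.
  rewrite integral_cst; last exact: measurableC.
  apply: (@le_trans _ _ (((2 ^+ m * B) ^+ 2)%:E *
      (2 ^+ d * (2 * m%:R * h) `^ d%:R)%:E)%E).
    rewrite lee_wpmul2l ?lee_fin ?sqr_ge0 //.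
    apply: le_trans _ (lebesgue_enorm_le rho0).
    apply: le_measure; rewrite ?inE //; first exact: measurableC.
      rewrite -[X in measurable X]setTI.
      rewrite (_ : [set _ | _] = @enorm R d @^-1` `]-oo, 2 * m%:R * h]%classic).
        by apply: measurable_enorm => //; exact: measurable_itv.
      by apply/seteqP; split=> x /=; rewrite in_itv.
    by move=> x /= /negP; rewrite -ltNge => /ltW.
  rewrite -EFinM lee_fin /B /Kn /H !exprMn hs ?mulr_ge0 //.
  rewrite [(2 * m%:R * h) `^ _]powRM ?mulr_ge0 ?(ltW h0) // gt0_powRD //.
  by rewrite le_eqVlt; apply/orP; left; apply/eqP; ring.
apply: (@le_trans _ _ (\int[mu]_(xi in A)
    (((C2 * h ^+ m) ^+ 2)%:E * (enorm xi `^ (- q))%:E))%E).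
  apply: ge0_le_integral => //.
  - by move=> x _; rewrite lee_fin sqr_ge0.
  - exact: measurable_funTS.
  - by apply: emeasurable_funM.
  - move=> xi Axi; rewrite -EFinM lee_fin.
    have -> : enorm xi `^ (- q) = (enorm xi `^ (sigma - m%:R)) ^+ 2.
      rewrite -powR_mulrn ?powR_ge0 // -powRrM /q; congr (_ `^ _); ring.
    rewrite -exprMn lerXn2r ?nnegrE ?normc_ge0 ?mulr_ge0 ?exprn_ge0 ?powR_ge0 ?(ltW h0) //.
    exact: Hf.
rewrite ge0_integralZl //; last 2 first.
- by move=> x _; rewrite lee_fin powR_ge0.
- by rewrite lee_fin sqr_ge0.
apply: (@le_trans _ _ (((C2 * h ^+ m) ^+ 2)%:E *
   (K1 * 2 ^+ d * (2 * m%:R * h) `^ (d%:R - q))%:E)%E).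
  rewrite lee_wpmul2l ?lee_fin ?sqr_ge0 //.
  apply: HK1 => //; first exact: measurable_enorm.
  by move=> r r0; exact: lebesgue_enorm_le.
rewrite -EFinM lee_fin /Kf exprMn [(2 * m%:R * h) `^ _]powRM ?mulr_ge0 ?(ltW h0) //.
have -> : H = h `^ (d%:R - q) * (h ^+ m) ^+ 2.
  rewrite -exprM -powR_mulrn ?(ltW h0) // -gt0_powRD // natrM /H /q.
  by congr (_ `^ _); ring.
by rewrite le_eqVlt; apply/orP; left; apply/eqP; ring.
Qed.

Lemma normc_cfourier_le (C0 : R) f x : cintegrable f ->
  (\int[mu]_xi (normc (f xi))%:E <= C0%:E)%E ->
  normc (cfourier f x) ^+ 2 <= 8 * C0 ^+ 2.
Proof.
move=> cf fC; have [ir ii] := cf.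
have C00 : 0 <= C0.
  by rewrite -lee_fin; apply: le_trans fC; apply: integral_ge0 => y _; rewrite lee_fin normc_ge0.
have mn := measurable_normc_cintegrable cf.
have part (p : R[i] -> R) (t : 'rV[R]_d -> R) : (forall z, `|p z| <= normc z) ->
    mu.-integrable setT (EFin \o (fun xi => p (f xi))) ->
    mu.-integrable setT (EFin \o (fun xi => p (f xi) * t xi)) ->
    (forall y, `|t y| <= 1) -> (\int[mu]_xi (p (f xi) * t xi)) ^+ 2 <= C0 ^+ 2.
  move=> pn ip ipt t1; rewrite -[leLHS]real_normK ?num_real // lerXn2r ?nnegrE //.
  rewrite -lee_fin EFin_normr_Rintegral //.
  apply: le_trans (le_abse_integral _ _ _) _ => //.
    exact: (measurable_int _ ipt).
  apply: le_trans fC; apply: ge0_le_integral => //.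
  - by apply: measurableT_comp => //; exact: (measurable_int _ ipt).
  - exact/measurable_EFinP.
  - move=> y _; rewrite /= lee_fin normrM (le_trans _ (pn _)) // ler_piMr //.
have fin_ (p : R[i] -> R) : (forall z, `|p z| <= normc z) ->
    mu.-integrable setT (EFin \o (fun xi => p (f xi))) ->
    cos_transform (fun xi => p (f xi)) x ^+ 2 + sin_transform (fun xi => p (f xi)) x ^+ 2
      <= C0 ^+ 2 + C0 ^+ 2.
  move=> pn ip; apply: lerD; apply: part => //.
  - exact: integrable_mul_cos.
  - by move=> y; exact: cos_max.
  - exact: integrable_mul_sin.
  - by move=> y; exact: sin_max.
apply: le_trans (normc_cfourier_sqr_le x cf) _.
have h1 := fin_ _ (@normRe_le R) ir; have h2 := fin_ _ (@normIm_le R) ii.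
by move: h1 h2; lra.
Qed.

Lemma weighted_cfourier_le (m : nat) (sigma delta C0 C1 C2 : R) :
  (0 < d)%N -> 0 < delta < sigma -> d%:R + 2 * sigma < 2 * m%:R ->
  0 <= C1 -> 0 <= C2 ->
  exists N : R, forall f (c : R[i]), cintegrable f ->
  (\int[mu]_xi (normc (f xi))%:E <= C0%:E)%E ->
  (forall xi, normc (f xi - c) <= C1 * enorm xi `^ sigma) ->
  (forall i (h : R) xi, 0 < h -> 2 * m%:R * h <= enorm xi ->
    normc (iter m (diffV (h *: delta_mx ord0 i)) f xi) <=
      C2 * h ^+ m * enorm xi `^ (sigma - m%:R)) ->
  (\int[mu]_x ((enorm x `^ (d%:R / 2 + delta) * normc (cfourier f x)) ^+ 2)%:E
    <= N%:E)%E.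
Proof.
move=> d0 /andP[delta0 ds] dm C10 C20; have s0 : 0 < sigma by exact: lt_trans ds.
have D0 : 0 < d%:R :> R by rewrite ltr0n.
have [K1 K10 HK1] := diff_L2_le s0 dm.
have [KB KB0 HKB] := @bessel_cfourier R d.
pose p := d%:R + 2 * delta.
have p0 : 0 < p by rewrite addr_gt0 // mulr_gt0.
pose z : R := 2 `^ (2 * delta - 2 * sigma).
have z0 : 0 <= z by exact: powR_ge0.
have z1 : z < 1.
  rewrite /z /powR pnatr_eq0 /= expR_lt1 nmulr_rlt0 ?ln_gt0 ?ltr1n //.
  by rewrite subr_lt0 ltr_pM2l.
pose c0 := d%:R `^ p * (8 * C0 ^+ 2) * 2 ^+ d.
pose c1 := d%:R `^ p * (d%:R * (KB * (K1 * (C1 ^+ 2 + C2 ^+ 2) * pi `^ (d%:R + 2 * sigma)))).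
have c00 : 0 <= c0.
  apply: mulr_ge0; last exact: exprn_ge0.
  by apply: mulr_ge0; [exact: powR_ge0|apply: mulr_ge0 => //; exact: sqr_ge0].
have c10 : 0 <= c1.
  by rewrite !mulr_ge0 ?powR_ge0 // addr_ge0 // sqr_ge0.
exists ((c0 + c1) / (1 - z)) => f c cf fC Hn Hf.
pose w x := enorm x `^ (d%:R / 2 + delta).
have w2 x : w x ^+ 2 = enorm x `^ p.
  by rewrite -powR_mulrn ?powR_ge0 // -powRrM; congr (_ `^ _); rewrite /p; field.
pose F x := ((w x * normc (cfourier f x)) ^+ 2)%:E.
have mw : measurable_fun setT w.
  exact: (measurableT_comp (measurable_powR _) measurable_enorm).
have mF : measurable_fun setT F.
  apply/measurable_EFinP; apply: measurable_funX; apply: measurable_funM => //.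
  exact: measurable_normc_cfourier.
have F0 x : (0 <= F x)%E by rewrite lee_fin sqr_ge0.
pose S (k : nat) : set 'rV[R]_d :=
  if k is j.+1 then boxV (2 ^+ j.+1) `\` boxV (2 ^+ j) else boxV 1.
have mS k : measurable (S k).
  case: k => [|j]; first exact: measurable_boxV.
  by apply: measurableD; exact: measurable_boxV.
have wA (A : R) x : 0 < A -> boxV A x -> w x ^+ 2 <= d%:R `^ p * A `^ p.
  move=> A0 xA; rewrite w2 -powRM ?(ltW A0) // ge0_ler_powR ?nnegrE ?(ltW p0) ?enorm_ge0 //.
    by rewrite mulr_ge0 // ltW.
  by apply: enorm_boxV_le => //; exact: ltW.
have ST : setT = \bigcup_k S k.
  apply/seteqP; split=> // x _.
  have ex : exists J, `[< boxV (2 ^+ J : R) x >].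
    have [J xJ] : exists J : nat, enorm x <= 2 ^+ J.
      have [|J /andP[_ /ltW xJ]] := @exists_dyadic R (enorm x + 1).
        by rewrite lerDr enorm_ge0.
      by exists J.+1; apply: le_trans xJ; rewrite lerDl.
    by exists J; apply/asboolP => i; exact: le_trans (normr_coord_le _ _) xJ.
  case: (ex_minnP ex) => -[|J] /asboolP xJ minJ.
    by exists 0%N => //=; rewrite -[1](expr0 2).
  exists J.+1 => //=; split => // xJ'.
  by have := minJ J (asboolT xJ'); rewrite ltnn.
rewrite -/F [X in (\int[_]_(_ in X) _ <= _)%E]ST.
apply: le_trans (ge0_integral_bigcup_le mu mS mF F0) _.
apply: nneseries_le_geometric; [exact: addr_ge0|by rewrite z0|by move=> k; exact: integral_ge0|].
case=> [|j].
  rewrite expr0 mulr1 /=.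
  apply: (@le_trans _ _ (\int[mu]_(x in boxV 1) (d%:R `^ p * (8 * C0 ^+ 2))%:E)%E).
    apply: ge0_le_integral => //.
    - exact: measurable_boxV.
    - exact: measurable_funTS.
    - move=> x x1; rewrite lee_fin exprMn ler_pM ?sqr_ge0 //.
        by have := wA 1 x ltr01 x1; rewrite powR1 mulr1.
      exact: normc_cfourier_le.
  rewrite integral_cst; last exact: measurable_boxV.
  rewrite [X in (_ * X <= _)%E](_ : _ = ((2 * 1) ^+ d)%:E); last exact: lebesgue_boxV.
  by rewrite mulr1 -EFinM lee_fin lerDl.
pose A : R := 2 ^+ j.+1; have A0 : 0 < A by exact: exprn_gt0.
pose h : R := pi / A; have h0 : 0 < h by rewrite divr_gt0 ?pi_gt0.
pose G i x := normc (cfourier (iter m (diffV (h *: delta_mx ord0 i)) f) x) ^+ 2.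
have mG i : measurable_fun setT (G i).
  apply: measurable_funX; apply: measurable_normc_cfourier.
  exact: cintegrable_diff.
have G0 i x : 0 <= G i x by exact: sqr_ge0.
have mGB i : measurable_fun (boxV A) (fun x => (G i x)%:E).
  by apply/measurable_EFinP/measurable_funTS.
have mB := @measurable_boxV R d A.
have W0 : 0 <= d%:R `^ p * A `^ p by rewrite mulr_ge0 ?powR_ge0.
have mGs : measurable_fun (boxV A) (fun x => \sum_(i < d) (G i x)%:E)%E.
  by apply: emeasurable_sum => i; exact: mGB.
apply: (@le_trans _ _ (\int[mu]_(x in boxV A)
    ((d%:R `^ p * A `^ p)%:E * \sum_(i < d) (G i x)%:E))%E).
  apply: (@le_trans _ _ (\int[mu]_(x in S j.+1)
      ((d%:R `^ p * A `^ p)%:E * \sum_(i < d) (G i x)%:E))%E); last first.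
    apply: ge0_subset_integral => //.
    - by apply: emeasurable_funM.
    - by move=> x _; rewrite mule_ge0 ?lee_fin // sume_ge0 // => i _; rewrite lee_fin.
    - by move=> x [].
  apply: ge0_le_integral => //.
  - exact: measurable_funTS.
  - apply: emeasurable_funM => //; apply: emeasurable_sum => i.
    by apply/measurable_EFinP/measurable_funTS.
  - move=> x [xA xj]; rewrite sumEFin -EFinM lee_fin exprMn.
    apply: ler_pM; rewrite ?sqr_ge0 //; first exact: wA.
    have [i xi] : exists i, 2 ^+ j < `|x ord0 i|.
      apply: contrapT => nx; apply: xj => i; rewrite leNgt; apply/negP => xi.
      by apply: nx; exists i.
    rewrite (bigD1 i) //=; apply: (@le_trans _ _ (G i x)).
      rewrite lerXn2r ?nnegrE ?normc_ge0 //; apply: normc_cfourier_le_diff => //.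
      rewrite normrM (ger0_norm (ltW h0)) /h.
      have xiA := xA i; apply/andP; split.
        rewrite -mulrA ler_wpM2l ?pi_ge0 // mulrC ler_pdivlMr //.
        by rewrite /A exprS mulrA mulVf // mul1r ltW.
      by rewrite -mulrA ler_piMr ?pi_ge0 // mulrC ler_pdivrMr // mul1r.
    by rewrite lerDl; apply: sumr_ge0 => k _.
rewrite ge0_integralZl ?lee_fin //; last first.
  by move=> x _; apply: sume_ge0 => i _; rewrite lee_fin.
rewrite ge0_integral_sum //; last by move=> i x _; rewrite lee_fin.
apply: (@le_trans _ _ ((d%:R `^ p * A `^ p)%:E * \sum_(i < d)
   (KB * (K1 * (C1 ^+ 2 + C2 ^+ 2) * h `^ (d%:R + 2 * sigma)))%:E)%E).
  rewrite lee_wpmul2l ?lee_fin //; apply: lee_sum => i _.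
  apply: le_trans (HKB _ A A0 (cintegrable_diff m (h *: delta_mx ord0 i) cf)) _.
  rewrite EFinM lee_wpmul2l ?lee_fin //.
  by apply: (HK1 C1 C2 f c i h) => // xi; exact: Hf.
rewrite sumEFin -EFinM lee_fin sumr_const card_ord -[X in _ * X <= _]mulr_natl.
have -> : z ^+ j.+1 = A `^ (2 * delta - 2 * sigma).
  by rewrite /z -powR_mulrn ?powR_ge0 // -powRrM mulrC powRrM powR_mulrn.
have hE : h `^ (d%:R + 2 * sigma) = pi `^ (d%:R + 2 * sigma) * A `^ (- (d%:R + 2 * sigma)).
  rewrite /h powRM ?pi_ge0 ?invr_ge0 ?(ltW A0) //; congr (_ * _).
  by rewrite -powR_inv1 ?(ltW A0) // -powRrM mulN1r.
have AE : A `^ (2 * delta - 2 * sigma) = A `^ p * A `^ (- (d%:R + 2 * sigma)).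
  by rewrite -gt0_powRD //; congr (_ `^ _); rewrite /p; ring.
rewrite hE AE [X in _ <= X]mulrDl; apply: ler_wpDl.
  by apply: mulr_ge0 => //; rewrite -AE powR_ge0.
by rewrite /c1 le_eqVlt; apply/orP; left; apply/eqP; ring.
Qed.

End weighted_fourier.

(** * Derivative bounds along lines *)

Section line_calculus.
Context {R : realType}.
Local Notation Re := complex.Re.
Local Notation Im := complex.Im.
Local Notation normc := Normc.normc.

Definition is_cderive (f : R -> R[i]) (u : R) (z : R[i]) : Prop :=
  is_derive u 1 (fun v => Re (f v)) (Re z) /\ is_derive u 1 (fun v => Im (f v)) (Im z).

Lemma is_derive_congr (f g : R -> R) (u df dg : R) :
  is_derive u 1 f df -> f =1 g -> df = dg -> is_derive u 1 g dg.
Proof. by move=> df' /funext <- <-. Qed.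

Lemma ReD (z y : R[i]) : Re (z + y) = Re z + Re y.
Proof. by case: z => ? ?; case: y. Qed.

Lemma ImD (z y : R[i]) : Im (z + y) = Im z + Im y.
Proof. by case: z => ? ?; case: y. Qed.

Lemma is_cderive_cst (c : R[i]) u : is_cderive (fun=> c) u 0.
Proof. by split; exact: is_derive_cst. Qed.

Lemma is_cderiveD f g u y z : is_cderive f u y -> is_cderive g u z ->
  is_cderive (fun v => f v + g v) u (y + z).
Proof.
move=> [fr fi] [gr gi]; split.
  by apply: (is_derive_congr (is_deriveD fr gr)) => [v|]; rewrite ReD.
by apply: (is_derive_congr (is_deriveD fi gi)) => [v|]; rewrite ImD.
Qed.

Lemma is_cderiveM f g u y z : is_cderive f u y -> is_cderive g u z ->
  is_cderive (fun v => f v * g v) u (y * g u + f u * z).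
Proof.
move=> [fr fi] [gr gi]; split.
  apply: (is_derive_congr (is_deriveB (is_deriveM fr gr) (is_deriveM fi gi))) => [v|].
    by rewrite ReM.
  by rewrite /GRing.scale /= ReD !ReM; ring.
apply: (is_derive_congr (is_deriveD (is_deriveM fr gi) (is_deriveM fi gr))) => [v|].
  by rewrite ImM.
by rewrite /GRing.scale /= ImD !ImM; ring.
Qed.

Lemma is_cderive_exp f u z : is_cderive f u z ->
  is_cderive (fun v => cexp (f v)) u (z * cexp (f u)).
Proof.
move=> [fr fi].
have de : is_derive u 1 (fun v => expR (Re (f v))) (expR (Re (f u)) * Re z).
  exact: (@is_derive1_comp R expR (fun v => Re (f v))).
have dc : is_derive u 1 (fun v => cos (Im (f v))) (- sin (Im (f u)) * Im z).
  exact: (@is_derive1_comp R cos (fun v => Im (f v))).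
have ds : is_derive u 1 (fun v => sin (Im (f v))) (cos (Im (f u)) * Im z).
  exact: (@is_derive1_comp R sin (fun v => Im (f v))).
split.
  apply: (is_derive_congr (is_deriveM de dc)) => [v|]; first by [].
  by rewrite /GRing.scale /= ReM /=; ring.
apply: (is_derive_congr (is_deriveM de ds)) => [v|]; first by [].
by rewrite /GRing.scale /= ImM /=; ring.
Qed.

Lemma is_cderive_real (f : R -> R) (u y : R) : is_derive u 1 f y ->
  is_cderive (fun v => (f v)%:C) u y%:C.
Proof. by move=> df; split => //=; exact: is_derive_cst. Qed.

Lemma normc_real (y : R) : normc y%:C = `|y|.
Proof. by rewrite /= expr0n addr0 sqrtr_sqr. Qed.

Variables (lo hi : R) (w : R -> R).
Let U u := lo < u < hi.
Hypothesis w0 : forall u, U u -> 0 < w u.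

(* [f] has [n] successive derivatives on [U], the [k]-th one bounded by [P / w ^+ k]. *)
Fixpoint csym n (P : R -> R) (f : R -> R[i]) : Prop :=
  (forall u, U u -> normc (f u) <= P u) /\
  if n is n'.+1 then exists2 f', (forall u, U u -> is_cderive f u (f' u)) &
    csym n' (fun u => P u / w u) f' else True.

Lemma csym_bound n P f : csym n P f -> forall u, U u -> normc (f u) <= P u.
Proof. by case: n => [|n] []. Qed.

Lemma csym_le n P Q f : (forall u, U u -> P u <= Q u) -> csym n P f -> csym n Q f.
Proof.
elim: n P Q f => [|n ih] P Q f PQ [fP Hf]; have b u : U u -> normc (f u) <= Q u by
  move=> Uu; exact: le_trans (fP u Uu) (PQ u Uu).
  by split.
split => //; case: Hf => f' df sf'; exists f' => //; apply: ih sf' => u Uu.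
by rewrite ler_pM2r ?invr_gt0 ?w0 // PQ.
Qed.

Lemma csymS n P f : csym n.+1 P f -> csym n P f.
Proof.
elim: n P f => [|n ih] P f; first by case=> fP _; split.
by case=> fP [f' df sf']; split=> //; exists f' => //; exact: ih.
Qed.

Lemma csym0 n P : (forall u, U u -> 0 <= P u) -> csym n P (fun=> 0).
Proof.
elim: n P => [|n ih] P P0; have b u : U u -> normc 0 <= P u by
  move=> Uu; rewrite Normc.normc0 P0.
  by split.
split => //; exists (fun=> 0) => [u _|]; first exact: is_cderive_cst.
by apply: ih => u Uu; apply: divr_ge0; [exact: P0|exact/ltW/w0].
Qed.

Lemma csym_cst n (c : R[i]) : csym n (fun=> normc c) (fun=> c).
Proof.
case: n => [|n]; split => //.
exists (fun=> 0) => [u _|]; first exact: is_cderive_cst.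
by apply: csym0 => u Uu; apply: divr_ge0; [exact: normc_ge0|exact/ltW/w0].
Qed.

Lemma csymD n P Q f g : csym n P f -> csym n Q g ->
  csym n (fun u => P u + Q u) (fun u => f u + g u).
Proof.
have bnd (P1 Q1 : R -> R) (f1 g1 : R -> R[i]) :
    (forall u, U u -> normc (f1 u) <= P1 u) -> (forall u, U u -> normc (g1 u) <= Q1 u) ->
    forall u, U u -> normc (f1 u + g1 u) <= P1 u + Q1 u.
  by move=> fP gQ u Uu; apply: le_trans (normcD _ _) _; rewrite lerD ?fP ?gQ.
elim: n P Q f g => [|n ih] P Q f g [fP Hf] [gQ Hg].
  by split => //; exact: bnd.
split; first exact: bnd.
case: Hf => f' df sf; case: Hg => g' dg sg.
exists (fun u => f' u + g' u) => [u Uu|]; first by apply: is_cderiveD; [exact: df|exact: dg].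
by apply: csym_le (ih _ _ _ _ sf sg) => u Uu; rewrite mulrDl.
Qed.

Lemma csymM n P Q f g : csym n P f -> csym n Q g ->
  csym n (fun u => 2 ^+ n * (P u * Q u)) (fun u => f u * g u).
Proof.
have bnd k (P1 Q1 : R -> R) (f1 g1 : R -> R[i]) :
    (forall u, U u -> normc (f1 u) <= P1 u) -> (forall u, U u -> normc (g1 u) <= Q1 u) ->
    forall u, U u -> normc (f1 u * g1 u) <= 2 ^+ k * (P1 u * Q1 u).
  move=> fP gQ u Uu; rewrite Normc.normcM.
  apply: (@le_trans _ _ (P1 u * Q1 u)); first by rewrite ler_pM ?normc_ge0 ?fP ?gQ.
  rewrite ler_peMl ?exprn_ege1 ?ler1n // mulr_ge0 //.
    exact: le_trans (normc_ge0 _) (fP u Uu).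
  exact: le_trans (normc_ge0 _) (gQ u Uu).
elim: n P Q f g => [|n ih] P Q f g sf sg.
  by split => //; exact: (bnd 0%N _ _ _ _ (csym_bound sf) (csym_bound sg)).
have sf0 := csymS sf; have sg0 := csymS sg.
case: sf => fP [f' df sf]; case: sg => gQ [g' dg sg].
split; first exact: (bnd n.+1).
exists (fun u => f' u * g u + f u * g' u) => [u Uu|].
  by apply: is_cderiveM; [exact: df|exact: dg].
apply: csym_le (csymD (ih _ _ _ _ sf sg0) (ih _ _ _ _ sf0 sg)) => u Uu.
by rewrite exprS le_eqVlt; apply/orP; left; apply/eqP; ring.
Qed.

Lemma csymZ n P f (c : R[i]) : csym n P f ->
  csym n (fun u => normc c * P u) (fun u => c * f u).
Proof.
elim: n P f => [|n ih] P f [fP Hf]; have b u : U u ->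
    normc (c * f u) <= normc c * P u by
  move=> Uu; rewrite Normc.normcM ler_wpM2l ?normc_ge0 ?fP.
  by split.
split => //; case: Hf => f' df sf; exists (fun u => c * f' u) => [u Uu|].
  have := is_cderiveM (is_cderive_cst c u) (df u Uu).
  by rewrite mul0r add0r.
by apply: csym_le (ih _ _ sf) => u Uu; rewrite mulrA.
Qed.

Lemma csymX n P f a : csym n P f ->
  csym n (fun u => (2 ^+ n * P u) ^+ a) (fun u => f u ^+ a).
Proof.
move=> sf; elim: a => [|a ih].
  by have := csym_cst n 1; rewrite Normc.normc1.
under [X in csym _ _ X]eq_fun do rewrite exprS.
apply: csym_le (csymM sf ih) => u Uu.
by rewrite exprS mulrA.
Qed.

Section exponential.
Variables (Q G : R -> R) (E E' : R -> R[i]).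
Hypothesis Q0 : forall u, U u -> 0 <= Q u.
Hypothesis expG : forall u, U u -> normc (cexp (E u)) <= G u.
Hypothesis dE : forall u, U u -> is_cderive E u (E' u).

Let G0 u : U u -> 0 <= G u.
Proof. by move=> Uu; exact: le_trans (normc_ge0 _) (expG Uu). Qed.

Lemma csym_dexp n : csym n (fun u => Q u / w u) E' ->
  csym n (fun u => 2 ^+ (n ^ 2) * (Q u * (1 + Q u) ^+ n * G u) / w u)
    (fun u => E' u * cexp (E u)).
Proof.
elim: n => [|n ih] sE.
  split => // u Uu; rewrite Normc.normcM expr0 expr0 mul1r mulr1.
  rewrite mulrAC ler_pM ?normc_ge0 ?expG //.
  exact: (csym_bound sE).
have sexp : csym n.+1 (fun u => 2 ^+ (n ^ 2) * ((1 + Q u) ^+ n.+1 * G u))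
    (fun u => cexp (E u)).
  split => [u Uu|].
    apply: le_trans (expG Uu) _; rewrite mulrA ler_peMl ?G0 // mulr_ege1 //.
      by rewrite exprn_ege1 // ler1n.
    by rewrite exprn_ege1 // lerDl Q0.
  exists (fun u => E' u * cexp (E u)) => [u Uu|].
    exact/is_cderive_exp/dE.
  apply: csym_le (ih (csymS sE)) => u Uu.
  rewrite ler_pM2r ?invr_gt0 ?w0 // ler_pM2l ?exprn_gt0 //.
  rewrite ler_wpM2r ?G0 // exprS ler_wpM2r ?exprn_ge0 ?addr_ge0 ?Q0 //.
  by rewrite lerDr.
apply: csym_le (csymM sE sexp) => u Uu.
set q := Q u; set v := (w u)^-1; have v0 : 0 <= v by rewrite invr_ge0 ltW // w0.
rewrite [leLHS](_ : _ = 2 ^+ (n.+1 + n ^ 2) * (q * (1 + q) ^+ n.+1 * G u * v)).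
  rewrite -[leRHS]mulrA ler_wpM2r //.
    by rewrite !mulr_ge0 ?G0 ?Q0 ?exprn_ge0 // addr_ge0 // Q0.
  rewrite ler_eXn2l ?ltr1n // !expnS expn0 !muln1 mulnS mulSn.
  by rewrite leq_add2l leq_addl.
by rewrite exprD; ring.
Qed.

Lemma csym_exp n : csym n (fun u => Q u / w u) E' ->
  csym n.+1 (fun u => 2 ^+ (n ^ 2) * ((1 + Q u) ^+ n.+1 * G u)) (fun u => cexp (E u)).
Proof.
move=> sE; split => [u Uu|].
  apply: le_trans (expG Uu) _; rewrite mulrA ler_peMl ?G0 // mulr_ege1 //.
    by rewrite exprn_ege1 // ler1n.
  by rewrite exprn_ege1 // lerDl Q0.
exists (fun u => E' u * cexp (E u)) => [u Uu|].
  exact/is_cderive_exp/dE.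
apply: csym_le (csym_dexp sE) => u Uu.
rewrite ler_pM2r ?invr_gt0 ?w0 // ler_pM2l ?exprn_gt0 //.
rewrite ler_wpM2r ?G0 // exprS ler_wpM2r ?exprn_ge0 ?addr_ge0 ?Q0 //.
by rewrite lerDr.
Qed.

End exponential.

Lemma csym_chain n (P : R -> R) (D : nat -> R -> R[i]) :
  (forall k u, (k < n)%N -> U u -> is_cderive (D k) u (D k.+1 u)) ->
  (forall k u, (k <= n)%N -> U u -> normc (D k u) <= P u / w u ^+ k) ->
  csym n P (D 0%N).
Proof.
elim: n P D => [|n ih] P D dD bD; have b u : U u -> normc (D 0%N u) <= P u by
  move=> Uu; have := bD 0%N u isT Uu; rewrite expr0 divr1.
  by split.
split => //.
exists (D 1%N) => [u Uu|]; first exact: dD.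
apply: (ih _ (fun k => D k.+1)) => k u kn Uu; first exact: dD.
by have := bD k.+1 u kn Uu; rewrite exprS invfM mulrA.
Qed.

End line_calculus.

Section differences.
Context {R : realType}.
Local Notation Re := complex.Re.
Local Notation Im := complex.Im.
Local Notation normc := Normc.normc.

Definition diff1 {V : zmodType} (h : R) (f : R -> V) : R -> V := fun u => f (u + h) - f u.

Fixpoint bounded_der (lo hi M : R) n (f : R -> R) : Prop :=
  if n is n'.+1 then exists2 f', (forall u, lo < u < hi -> is_derive u 1 f (f' u)) &
    bounded_der lo hi M n' f'
  else forall u, lo < u < hi -> `|f u| <= M.

Lemma bounded_der_diff1 lo hi M n f h : 0 < h -> bounded_der lo hi M n.+1 f ->
  bounded_der lo (hi - h) (h * M) n (diff1 h f).
Proof.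
move=> h0; elim: n f => [|n ih] f [f' df bf].
  move=> u /andP[lu uh].
  have uh' : u < u + h by rewrite ltrDl.
  have inU v : v \in `[u, u + h] -> lo < v < hi.
    by rewrite in_itv /= => /andP[uv vh]; apply/andP; split; lra.
  rewrite /diff1; have [v vu||c cu ->] := @MVT R f f' u (u + h) uh'.
  - by apply/df/inU; exact: subset_itv_oo_cc.
  - apply: derivable_within_continuous => v vu.
    exact: (@ex_derive _ _ _ _ _ _ _ (df v (inU v vu))).
  rewrite normrM mulrC [u + h]addrC addrK (ger0_norm (ltW h0)) ler_wpM2l ?(ltW h0) //.
  by apply: bf; apply: inU; exact: subset_itv_oo_cc.
exists (diff1 h f'); last exact: ih.
move=> u /andP[lu uh].
have d1 : is_derive u 1 (fun v => f (v + h)) (f' (u + h)).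
  have ds : is_derive u 1 (fun v : R => v + h) 1.
    by apply: is_derive_eq; rewrite addr0.
  have dh : is_derive (u + h) 1 f (f' (u + h)) by apply: df; apply/andP; split; lra.
  have := @is_derive1_comp R f (fun v : R => v + h) u _ _ dh ds.
  by rewrite mulr1.
by apply: is_deriveB => //; apply: df; apply/andP; split; lra.
Qed.

Lemma bounded_der_iter_diff lo hi M n f h u : 0 < h -> bounded_der lo hi M n f ->
  lo < u -> u + n%:R * h < hi -> `|iter n (diff1 h) f u| <= h ^+ n * M.
Proof.
move=> h0; elim: n lo hi M f => [|n ih] lo hi M f bf lu uh.
  by rewrite expr0 mul1r; apply: bf; rewrite lu /=; move: uh; rewrite mul0r addr0.
rewrite iterSr exprSr -mulrA; apply: (ih lo (hi - h)) => //.
  exact: bounded_der_diff1.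
by rewrite ltrBrDr -addrA -[X in _ + (_ + X)]mul1r -mulrDl natr1.
Qed.

Lemma csym_iter_diff lo hi (w : R -> R) n (P : R -> R) f f' (h M u : R) :
  0 < h -> (forall v, lo < v < hi -> is_cderive f v (f' v)) -> csym lo hi w n P f' ->
  (forall v, lo < v < hi -> P v / w v ^+ n <= M) ->
  lo < u -> u + n.+1%:R * h < hi ->
  normc (iter n.+1 (diff1 h) f u) <= 2 * (h ^+ n.+1 * M).
Proof.
move=> h0 df sf PM lu uh.
have part (p : R[i] -> R) : (forall z, `|p z| <= normc z) ->
    (forall (g : R -> R[i]) v z, is_cderive g v z -> is_derive v 1 (fun t => p (g t)) (p z)) ->
    (forall y z, p (y - z) = p y - p z) ->
    `|p (iter n.+1 (diff1 h) f u)| <= h ^+ n.+1 * M.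
  move=> pn pd pB.
  have bf : bounded_der lo hi M n.+1 (fun v => p (f v)).
    exists (fun v => p (f' v)) => [v Uv|]; first exact/pd/df.
    elim: n P f' sf PM {df uh} => [|n ih] P f1 /= [fP Hf] PM.
      move=> v Uv; apply: le_trans (pn _) (le_trans (fP v Uv) _).
      by have := PM v Uv; rewrite expr0 divr1.
    case: Hf => f2 df sf; exists (fun v => p (f2 v)) => [v Uv|]; first exact/pd/df.
    apply: (ih _ _ sf) => v Uv; have := PM v Uv.
    by rewrite exprS invfM mulrA.
  have -> : p (iter n.+1 (diff1 h) f u) = iter n.+1 (diff1 h) (fun v => p (f v)) u.
    elim: (n.+1) u {sf df PM lu uh bf} => //= k ih u.
    by rewrite /diff1 pB !ih.
  exact: bounded_der_iter_diff bf lu uh.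
have hr := part _ (@normRe_le R) (fun _ _ _ d => d.1) (@ReB R).
have hi_ := part _ (@normIm_le R) (fun _ _ _ d => d.2) (@ImB R).
rewrite -(@ler_pXn2r _ 2) ?nnegrE ?normc_ge0 //; last first.
  by rewrite mulr_ge0 // (le_trans _ hr).
rewrite normc_sqr -[X in X + _]real_normK ?num_real // -[X in _ + X]real_normK ?num_real //.
have := normr_ge0 (Re (iter n.+1 (diff1 h) f u)).
have := normr_ge0 (Im (iter n.+1 (diff1 h) f u)).
by nra.
Qed.

Lemma is_derive_Rintegral (s t lo hi : R) (f f' : R -> R -> R) (B : R -> R) (G : R) :
  (forall x, lo < x < hi -> measurable_fun setT (f x)) ->
  (forall x r, lo < x < hi -> `|f x r| <= B x) ->
  (forall x r, lo < x < hi -> is_derive x 1 (f^~ r) (f' x r)) ->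
  (forall x r, lo < x < hi -> `|f' x r| <= G) ->
  forall x, lo < x < hi ->
  is_derive x 1 (fun x => \int[lebesgue_measure]_(r in `[s, t]) f x r)
    (\int[lebesgue_measure]_(r in `[s, t]) f' x r).
Proof.
move=> mf fB df fG x xU.
have G0 : 0 <= G by apply: le_trans (fG x 0 xU).
have icst (k : R) : (@lebesgue_measure R).-integrable `[s, t] (EFin \o cst k).
  by apply: continuous_compact_integrable; [exact: segment_compact|
    exact/continuous_subspaceT/cst_continuous].
have intf y : `]lo, hi[%classic y ->
    (@lebesgue_measure R).-integrable `[s, t] (EFin \o f y).
  rewrite /= in_itv /= => yU.
  apply: (@le_integrableR _ (measurableTypeR R) R lebesgue_measure _ _ (cst (B y))) => //.
  - by apply: measurable_funTS; exact: mf.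
  - by move=> r _; exact: fB.
have derf y r : `]lo, hi[%classic y -> `[s, t]%classic r -> derivable (f^~ r) y 1.
  rewrite /= in_itv /= => yU _.
  exact: (@ex_derive _ _ _ _ _ _ _ (df y r yU)).
have dE y r : `]lo, hi[%classic y -> partial1of2 f y r = f' y r.
  rewrite /= in_itv /= => yU; rewrite partial1of2E.
  exact: (@derive_val _ _ _ _ _ _ _ (df y r yU)).
have fG' y r : `]lo, hi[%classic y -> `[s, t]%classic r -> `|partial1of2 f y r| <= G.
  by move=> yU _; rewrite dE //; apply: fG; move: yU; rewrite /= in_itv.
have xI : `]lo, hi[%classic x by rewrite /= in_itv.
have mI : measurable (`[s, t]%classic : set (measurableTypeR R)).
  exact: measurable_itv.
have dd := @derivable_under_integral R _ (measurableTypeR R) lebesgue_measure f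
  `[s, t]%classic mI x lo hi xI intf derf (cst G) (fun=> G0) (icst G) fG'.
have vv := @differentiation_under_integral R _ (measurableTypeR R) lebesgue_measure f
  `[s, t]%classic mI x lo hi xI intf derf (cst G) (fun=> G0) (icst G) fG'.
apply: DeriveDef; first exact: dd.
rewrite -derive1E vv; apply: eq_Rintegral => r _.
exact: (dE x r xI).
Qed.

End differences.

Section weight_on_lines.
Context {R : realType} {d : nat}.
Implicit Types (xi : 'rV[R]_d).
Local Notation normc := Normc.normc.

Lemma is_derive_line (f : 'rV[R]_d -> R) (lambda u : R) xi (v : 'rV[R]_d) :
  derivable f (lambda *: (xi + u *: v)) v ->
  is_derive u 1 (fun t : R => f (lambda *: (xi + t *: v)))
    (lambda * 'D_v f (lambda *: (xi + u *: v))).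
Proof.
move=> df; pose H (y : R) := f (lambda *: xi + y *: v).
have E : lambda *: (xi + u *: v) = lambda *: xi + (lambda * u) *: v.
  by rewrite scalerDr scalerA.
have quo : (fun k : R => k^-1 *: ((H \o shift (lambda * u)) (k *: 1) - H (lambda * u))) =
    (fun k : R => k^-1 *: ((f \o shift (lambda *: (xi + u *: v))) (k *: v) -
      f (lambda *: (xi + u *: v)))).
  apply/funext => k; rewrite /H /= E; congr (_ *: (f _ - _)).
  by rewrite (_ : k%:A = k); [rewrite scalerDl addrCA|exact: mulr1].
have dH : is_derive (lambda * u) 1 H ('D_v f (lambda *: (xi + u *: v))).
  apply: DeriveDef; first by rewrite /derivable quo.
  by rewrite /derive quo.
have dl : is_derive u 1 (fun t : R => lambda * t) lambda.
  by apply: is_derive_eq; rewrite /GRing.scale /=; ring.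
apply: (is_derive_congr (@is_derive1_comp R H (fun t : R => lambda * t) u _ _ dH dl)).
  by move=> t; rewrite /H /= scalerDr scalerA.
by rewrite mulrC.
Qed.

Lemma is_derive_enorm_powR xi i (b u : R) : 0 < enorm (xi + u *: delta_mx ord0 i) ->
  is_derive u 1 (fun t : R => enorm (xi + t *: delta_mx ord0 i) `^ b)
    (b * ((xi ord0 i + u) * enorm (xi + u *: delta_mx ord0 i) `^ (b - 2))).
Proof.
move=> w0; pose v (t : R) := dotrV xi xi + 2 * xi ord0 i * t + t ^+ 2.
have vE t : dotrV (xi + t *: delta_mx ord0 i) (xi + t *: delta_mx ord0 i) = v t.
  rewrite /dotrV (bigD1 i) //= /v /dotrV [X in _ = X + _ + _](bigD1 i) //= !mxE !eqxx mulr1.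
  rewrite (eq_bigr (fun j => xi ord0 j * xi ord0 j)); first by ring.
  by move=> j ji; rewrite !mxE (negbTE ji) andbF mulr0 addr0.
have powE c t : enorm (xi + t *: delta_mx ord0 i) `^ c = v t `^ (c / 2).
  by rewrite /enorm vE -powR12_sqrt ?(-vE, dotrV_ge0) // -?vE ?dotrV_ge0 // -powRrM mulrC.
have v0 : 0 < v u by rewrite -vE -enorm_sqr exprn_gt0.
have dv : is_derive u 1 v (2 * xi ord0 i + 2 * u).
  by apply: is_derive_eq; rewrite /GRing.scale /=; ring.
have dp : is_derive (v u) 1 (fun y : R => y `^ (b / 2)) (b / 2 * v u `^ (b / 2 - 1)).
  apply: DeriveDef.
    by apply: derivable_powR; rewrite in_itv /= v0.
  by rewrite -derive1E powR_derive1 // in_itv /= v0.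
apply: (is_derive_congr (@is_derive1_comp R (fun y : R => y `^ (b / 2)) v u _ _ dp dv)).
  by move=> t; rewrite powE.
rewrite powE (_ : (b - 2) / 2 = b / 2 - 1); last by field.
by field.
Qed.

Lemma csym_enorm_powR n (b : R) : exists2 C : R, 0 <= C & forall lo hi xi i,
  (forall u, lo < u < hi -> 0 < enorm (xi + u *: delta_mx ord0 i)) ->
  csym lo hi (fun u => enorm (xi + u *: delta_mx ord0 i)) n
    (fun u => C * enorm (xi + u *: delta_mx ord0 i) `^ b)
    (fun u => (enorm (xi + u *: delta_mx ord0 i) `^ b)%:C).
Proof.
elim: n b => [|n ih] b.
  exists 1 => // lo hi xi i w0; split => // u Uu.
  by rewrite normc_real mul1r ger0_norm // powR_ge0.
have [C C0 HC] := ih (b - 2).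
exists (1 + `|b| * (2 ^+ n * C)).
  by rewrite addr_ge0 // mulr_ge0 // mulr_ge0 // exprn_ge0.
move=> lo hi xi i w0; pose w u := enorm (xi + u *: delta_mx ord0 i).
split => [u Uu|].
  rewrite normc_real ger0_norm ?powR_ge0 // ler_peMl ?powR_ge0 // lerDl.
  by rewrite mulr_ge0 // mulr_ge0 // exprn_ge0.
exists (fun u => b%:C * ((xi ord0 i + u)%:C * (w u `^ (b - 2))%:C)) => [u Uu|].
  have := is_cderive_real (is_derive_enorm_powR b (w0 u Uu)).
  by rewrite !rmorphM.
have sx : csym lo hi w n w (fun u => (xi ord0 i + u)%:C).
  have bx u : normc (xi ord0 i + u)%:C <= w u.
    rewrite normc_real; have := normr_coord_le (xi + u *: delta_mx ord0 i) i.
    by rewrite !mxE !eqxx mulr1.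
  case: n {ih HC} => [|n]; split => //.
  exists (fun=> 1) => [u Uu|].
    by apply: is_cderive_real; apply: is_derive_eq; rewrite add0r.
  apply: (csym_le w0 _ (csym_cst w0 n 1)) => u Uu.
  by rewrite Normc.normc1 divff // gt_eqF // w0.
apply: (csym_le w0 _ (csymZ w0 b%:C (csymM w0 sx (HC lo hi xi i w0)))) => u Uu.
have w1 := w0 u Uu; rewrite normc_real mulrDl mul1r mulrDl.
apply: ler_wpDl; first by rewrite divr_ge0 ?powR_ge0 // ltW.
rewrite -[X in _ <= X]mulrA.
have -> : enorm (xi + u *: delta_mx ord0 i) `^ b / enorm (xi + u *: delta_mx ord0 i) =
    w u * w u `^ (b - 2).
  rewrite -/(w u) -[X in _ = X * _]powRr1 ?(ltW w1) // -gt0_powRD //.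
  by rewrite -powR_inv1 ?(ltW w1) // -gt0_powRD //; congr (_ `^ _); ring.
by rewrite -/(w u) le_eqVlt; apply/orP; left; apply/eqP; ring.
Qed.

Lemma iter_diffVE n (g : 'rV[R]_d -> R[i]) (h u : R) xi (e : 'rV[R]_d) :
  iter n (diffV (h *: e)) g (xi + u *: e) = iter n (diff1 h) (fun t => g (xi + t *: e)) u.
Proof.
elim: n u => //= n ih u; rewrite /diffV /diff1 -!ih.
by rewrite -addrA -scalerDl.
Qed.

Lemma eq_iter_diffV n (f g : 'rV[R]_d -> R[i]) xi (e : 'rV[R]_d) :
  (forall k, (k <= n)%N -> f (xi + k%:R *: e) = g (xi + k%:R *: e)) ->
  iter n (diffV e) f xi = iter n (diffV e) g xi.
Proof.
elim: n xi => [|n ih] xi fg.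
  by have := fg 0%N isT; rewrite scale0r addr0.
rewrite !iterS /diffV; congr (_ - _); apply: ih => k kn.
  by rewrite -addrA -{1 3}[e]scale1r -scalerDl -[1]/(1%:R) -natrD add1n; exact: fg.
by apply: fg; exact: leqW.
Qed.

End weight_on_lines.

Lemma powR_exp_bounded (R : realType) (gamma nu p c : R) N :
  0 < gamma -> 0 < nu -> 0 <= p -> 0 <= c ->
  exists2 C : R, 0 <= C & forall x, 0 < x ->
    x `^ p * (1 + c * x `^ gamma) ^+ N * expR (- nu * x `^ gamma) <= C.
Proof.
move=> g0 nu0 p0 c0.
pose n0 := (Num.trunc (p / gamma)).+1.
have n0p : p / gamma <= n0%:R.
  by apply: ltW; have /andP[_] := Num.Theory.truncn_itv (divr_ge0 p0 (ltW g0)).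
pose M := (n0 + N)%N; have M0 : 0 < M%:R :> R by rewrite ltr0n.
pose K : R := 1 + M%:R / nu.
have K1 : 1 <= K by rewrite lerDl divr_ge0 // ltW.
have K0 : 0 <= K by apply: le_trans K1.
exists ((1 + c) ^+ N * K ^+ M).
  by rewrite mulr_ge0 ?exprn_ge0 // addr_ge0.
move=> x x0; pose y := x `^ gamma; have y0 : 0 <= y by exact: powR_ge0.
have y1 : 1 <= 1 + y by rewrite lerDl.
have xp : x `^ p <= (1 + y) ^+ n0.
  have -> : x `^ p = y `^ (p / gamma).
    by rewrite -powRrM; congr (_ `^ _); field; rewrite gt_eqF.
  apply: (@le_trans _ _ ((1 + y) `^ (p / gamma))).
    apply: ge0_ler_powR; rewrite ?nnegrE ?addr_ge0 ?divr_ge0 ?(ltW g0) //.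
    by rewrite lerDr.
  rewrite -powR_mulrn ?addr_ge0 //.
  by apply: ler_powR.
have cy : (1 + c * y) ^+ N <= (1 + c) ^+ N * (1 + y) ^+ N.
  rewrite -exprMn lerXn2r ?nnegrE ?mulr_ge0 ?addr_ge0 ?mulr_ge0 //.
  by have := mulr_ge0 c0 y0; nra.
have ey : (1 + y) ^+ M <= K ^+ M * expR (nu * y).
  have -> : expR (nu * y) = expR (nu * y / M%:R) ^+ M.
    by rewrite -expRM_natr; congr expR; field; rewrite gt_eqF.
  have q0 : 0 <= K * expR (nu * y / M%:R) by apply: mulr_ge0 => //; exact: expR_ge0.
  have q1 : 0 <= 1 + y by exact: le_trans y1.
  rewrite -exprMn lerXn2r ?nnegrE //.
  apply: (@le_trans _ _ (K * (1 + nu * y / M%:R))); last first.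
    by rewrite ler_wpM2l // expR_ge1Dx.
  rewrite /K mulrDl mul1r mulrDr mulr1 (_ : M%:R / nu * (nu * y / M%:R) = y); last first.
    by field; rewrite !gt_eqF.
  rewrite -addrA lerD2l addrA lerDr.
  by rewrite addr_ge0 // divr_ge0 ?mulr_ge0 // ltW.
rewrite mulNr expRN -/y.
rewrite ler_pdivrMr ?expR_gt0 //.
apply: (@le_trans _ _ ((1 + y) ^+ n0 * ((1 + c) ^+ N * (1 + y) ^+ N))).
  by rewrite ler_pM ?powR_ge0 // exprn_ge0 // addr_ge0 // mulr_ge0.
rewrite mulrCA -exprD -mulrA ler_wpM2l ?exprn_ge0 // addr_ge0 //.
Qed.

Lemma normc_cexp (R : realType) (z : R[i]) : Normc.normc (cexp z) = expR (complex.Re z).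
Proof.
rewrite /cexp /= !exprMn -mulrDr cos2Dsin2 mulr1 sqrtr_sqr.
by rewrite ger0_norm // expR_ge0.
Qed.

Lemma abs_sin_le (R : realType) (y : R) : `|sin y| <= `|y|.
Proof.
suff H (h : R) : 0 < h -> `|sin h| <= h.
  have [y0|y0|->] := ltgtP y 0; last by rewrite sin0.
    by rewrite -normrN -sinN (ltr0_norm y0) H // oppr_gt0.
  by rewrite (gtr0_norm y0) H.
move=> h0; have b : bounded_der (-1) (h + 1) 1 1 (@sin R).
  by exists cos => [u _|u _]; [exact: is_derive_sin|exact: cos_max].
have := bounded_der_iter_diff (u := 0) h0 b; rewrite /= /diff1 add0r sin0 subr0 mul1r.
by rewrite add0r expr1 mulr1; apply; rewrite ?ltrDl // ltrN10.
Qed.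

Lemma abs_cosB1_le (R : realType) (y : R) : `|cos y - 1| <= `|y|.
Proof.
suff H (h : R) : 0 < h -> `|cos h - 1| <= h.
  have [y0|y0|->] := ltgtP y 0; last by rewrite cos0 subrr.
    by rewrite -cosN (ltr0_norm y0) H // oppr_gt0.
  by rewrite (gtr0_norm y0) H.
move=> h0; have b : bounded_der (-1) (h + 1) 1 1 (@cos R).
  by exists (fun u => - sin u) => [u _|u _]; [exact: is_derive_cos|rewrite normrN; exact: sin_max].
have := bounded_der_iter_diff (u := 0) h0 b; rewrite /= /diff1 add0r cos0 mul1r.
by rewrite add0r expr1 mulr1; apply; rewrite ?ltrDl // ltrN10.
Qed.

Lemma normc_cexpB1_le (R : realType) (z : R[i]) : complex.Re z <= 0 ->
  Normc.normc (cexp z - 1) <= 3 * Normc.normc z.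
Proof.
move=> z0; have hr := normRe_le z; have hi := normIm_le z.
have s0 := abs_sin_le (complex.Im z); have c0 := abs_cosB1_le (complex.Im z).
have n0 := normc_ge0 z.
set x := complex.Re z in z0 hr *; set y := complex.Im z in hi s0 c0 *.
have ex1 : expR x <= 1 by rewrite expR_le1.
have ex0 := expR_ge0 x; have exx := expR_ge1Dx x.
have xr : `|x| = - x by rewrite ler0_norm.
have R1 : `|expR x * cos y - 1| <= `|x| + `|y|.
  have -> : expR x * cos y - 1 = expR x * (cos y - 1) + (expR x - 1) by ring.
  apply: le_trans (ler_normD _ _) _; rewrite addrC lerD //.
    by rewrite ler0_norm ?subr_le0 // xr; lra.
  rewrite normrM (ger0_norm ex0); apply: le_trans _ c0.
  by rewrite ler_piMl.
have I1 : `|expR x * sin y| <= `|y|.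
  rewrite normrM (ger0_norm ex0); apply: le_trans _ s0.
  by rewrite ler_piMl.
rewrite -(@ler_pXn2r _ 2) ?nnegrE ?normc_ge0 ?mulr_ge0 ?normc_ge0 // normc_sqr.
rewrite ReB ImB /= subr0 -/x -/y.
rewrite -[X in X + _]real_normK ?num_real // -[X in _ + X]real_normK ?num_real //.
have := normr_ge0 (expR x * cos y - 1); have := normr_ge0 (expR x * sin y).
set r := `|_ - 1| in R1 *; set q := `|expR x * sin y| in I1 *.
by move=> q0 r0; nra.
Qed.

(** * The symbol of the kernel *)

Section symbol_estimates.
Context {R : realType} {d : nat}.
Implicit Types (psi : R -> 'rV[R]_d -> R[i]) (xi eta : 'rV[R]_d).
Local Notation Re := complex.Re.
Local Notation Im := complex.Im.
Local Notation normc := Normc.normc.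
Local Notation e_ i := (delta_mx ord0 i).

Lemma is_cderive_line (f : 'rV[R]_d -> R[i]) (lambda u : R) xi (v : 'rV[R]_d) :
  cderivable f (lambda *: (xi + u *: v)) v ->
  is_cderive (fun t : R => f (lambda *: (xi + t *: v))) u
    (lambda%:C * cderive f (lambda *: (xi + u *: v)) v).
Proof.
move=> [fr fi]; split.
  apply: (is_derive_congr (is_derive_line fr)) => //.
  by rewrite ReM /= mul0r subr0.
apply: (is_derive_congr (is_derive_line fi)) => //.
by rewrite ImM /= mul0r addr0.
Qed.

Variables (gamma nu : R).
Hypotheses (g0 : 0 < gamma) (nu0 : 0 < nu).

Section fixed_symbol.
Variables (psi : R -> 'rV[R]_d -> R[i]) (s t : R).
Hypotheses (Hpsi : is_symbol gamma nu psi) (st : s < t).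

Let tau := t - s.
Let lambda := tau `^ (- gamma^-1).

Let tau0 : 0 < tau. Proof. by rewrite subr_gt0. Qed.
Let lambda0 : 0 < lambda. Proof. by rewrite powR_gt0 // tau0. Qed.

Let tau_lambda : tau * lambda `^ gamma = 1.
Proof.
rewrite /lambda -powRrM mulNr mulVf ?gt_eqF // powR_inv1 ?ltW ?tau0 //.
by rewrite divff // gt_eqF // tau0.
Qed.

Let lambda_xi0 xi : xi != 0 -> lambda *: xi != 0.
Proof. by move=> x0; rewrite scaler_eq0 negb_or x0 andbT gt_eqF // lambda0. Qed.

(* The [k]-th derivative of [fun xi => psi r (lambda *: xi)] in the direction [e_ i]. *)
Definition scaled_partial i k r xi : R[i] :=
  (lambda ^+ k)%:C * partials (nseq k i) (psi r) (lambda *: xi).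

Lemma scaled_partial_derive i k r xi (u : R) : (k < d./2.+1)%N ->
  xi + u *: e_ i != 0 ->
  is_cderive (fun v => scaled_partial i k r (xi + v *: e_ i)) u
    (scaled_partial i k.+1 r (xi + u *: e_ i)).
Proof.
move=> km x0.
have cd : cderivable (partials (nseq k i) (psi r)) (lambda *: (xi + u *: e_ i)) (e_ i).
  apply: (symbol_derivable Hpsi); first exact: lambda_xi0.
  by rewrite /= size_nseq.
have := is_cderiveM (is_cderive_cst (lambda ^+ k)%:C u) (is_cderive_line cd).
rewrite mul0r add0r mulrA -rmorphM -exprSr; exact.
Qed.

Lemma scaled_partial_le i k r xi : (k <= d./2.+1)%N -> xi != 0 ->
  normc (scaled_partial i k r xi) <=
  nu^-1 * (lambda `^ gamma * enorm xi `^ gamma) / enorm xi ^+ k.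
Proof.
move=> km x0.
have w0 : 0 < enorm xi by rewrite lt_def enorm_ge0 enorm_eq0 x0.
rewrite Normc.normcM normc_real ger0_norm ?exprn_ge0 ?(ltW lambda0) //.
have := symbol_bound Hpsi r (s := nseq k i) (lambda_xi0 x0).
rewrite size_nseq => /(_ km) b.
apply: le_trans (ler_wpM2l _ b) _; first by rewrite exprn_ge0 // ltW // lambda0.
rewrite enormZ gtr0_norm ?lambda0 // powRM ?(ltW lambda0) ?(ltW w0) //.
rewrite !gt0_powRD ?lambda0 // !powR_invn ?(ltW lambda0) ?(ltW w0) //.
have l1 : lambda ^+ k != 0 by rewrite gt_eqF // exprn_gt0 // lambda0.
rewrite le_eqVlt; apply/orP; left; apply/eqP.
rewrite -[RHS]mul1r -[X in _ = X * _](divff l1); ring.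
Qed.

(* A derivative is a limit of difference quotients, hence measurable in time. *)
Lemma measurable_scaled_partial i k xi : (k <= d./2.+1)%N -> xi != 0 ->
  cmeasurable_fun setT (fun r => scaled_partial i k r xi).
Proof.
elim: k xi => [|k ih] xi km x0.
  have [mr mi] := symbol_measurable Hpsi.
  have E : (fun r => scaled_partial i 0 r xi) = (fun r => psi r (lambda *: xi)).
    by apply/funext => r; rewrite /scaled_partial expr0 mul1r.
  rewrite E; split.
    exact: (measurableT_comp mr (pair2_measurable (lambda *: xi))).
  exact: (measurableT_comp mi (pair2_measurable (lambda *: xi))).
have w0 : 0 < enorm xi by rewrite lt_def enorm_ge0 enorm_eq0 x0.
pose h (n : nat) : R := enorm xi / n.+2%:R.
have h0 n : 0 < h n by rewrite divr_gt0.
have hlt n : h n < enorm xi by rewrite ltr_pdivrMr // ltr_pMr // ltr1n.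
have xh n : xi + h n *: e_ i != 0.
  apply/eqP => xE; have := enormD_delta_le (xi + h n *: e_ i) i (- h n).
  rewrite -addrA -scalerDl subrr scale0r addr0 normrN gtr0_norm // xE enorm0 add0r.
  by rewrite leNgt hlt.
have hcvg : h n @[n --> \oo] --> 0.
  rewrite -(mulr0 (enorm xi)); apply: cvgM; first exact: cvg_cst.
  by have := @cvg_harmonic R; rewrite -cvg_shiftS.
have lim (p : R[i] -> R) :
    (forall r : R, is_derive (0 : R) 1 (fun v : R => p (scaled_partial i k r (xi + v *: e_ i)))
       (p (scaled_partial i k.+1 r xi))) ->
    (forall eta, eta != 0 -> measurable_fun setT (fun r => p (scaled_partial i k r eta))) ->
    measurable_fun setT (fun r => p (scaled_partial i k.+1 r xi)).
  move=> dp mp.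
  apply: (@measurable_fun_cvg _ _ R setT (fun n r => (h n)^-1 *
     (p (scaled_partial i k r (xi + h n *: e_ i)) - p (scaled_partial i k r xi)))).
    move=> n; apply: measurable_funM; first exact: measurable_cst.
    by apply: measurable_funB; exact: mp.
  move=> r _; have dr := dp r.
  have /cvgr_dnbhsP H := (@ex_derive _ _ _ _ _ _ _ dr).
  have {H} := H h (conj (fun n => lt0r_neq0 (h0 n)) hcvg).
  rewrite [X in _ --> X -> _](_ : _ = p (scaled_partial i k.+1 r xi)); last first.
    exact: (@derive_val _ _ _ _ _ _ _ dr).
  apply: cvg_trans; apply: near_eq_cvg; apply: nearW => n /=.
  by rewrite addr0 scale0r addr0 (_ : (h n)%:A = h n) //; exact: mulr1.
have dk r : is_cderive (fun v => scaled_partial i k r (xi + v *: e_ i)) 0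
    (scaled_partial i k.+1 r xi).
  have := @scaled_partial_derive i k r xi 0 km.
  by rewrite scale0r addr0; exact.
split.
  apply: lim => [r|eta e0]; first by have [] := dk r.
  by have [] := ih eta (ltnW km) e0.
apply: lim => [r|eta e0]; first by have [] := dk r.
by have [] := ih eta (ltnW km) e0.
Qed.

Definition phase_partial i k xi : R[i] :=
  cintegral lebesgue_measure `[s, t] (fun r => scaled_partial i k r xi).

Let mI : measurable (`[s, t]%classic : set (measurableTypeR R)).
Proof. exact: measurable_itv. Qed.

Let icst (c : R) : (@lebesgue_measure R).-integrable `[s, t] (EFin \o cst c).
Proof.
by apply: continuous_compact_integrable; [exact: segment_compact|
  exact/continuous_subspaceT/cst_continuous].
Qed.

Let Rint_cst (c : R) : \int[lebesgue_measure]_(r in `[s, t]) c = c * tau.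
Proof.
rewrite Rintegral_cst //; congr (_ * _).
have E : (lebesgue_measure (`[s, t]%classic : set R) = tau%:E)%E.
  by rewrite lebesgue_measure_itv /= lte_fin st EFinB.
exact: (congr1 fine E).
Qed.

Let integrable_scaled_partial (p : R[i] -> R) i k xi : (forall z, `|p z| <= normc z) ->
  measurable_fun setT (fun r => p (scaled_partial i k r xi)) ->
  (k <= d./2.+1)%N -> xi != 0 ->
  (@lebesgue_measure R).-integrable `[s, t] (EFin \o (fun r => p (scaled_partial i k r xi))).
Proof.
move=> pn mp km x0.
apply: (@le_integrableR _ (measurableTypeR R) R lebesgue_measure _ _
  (cst (nu^-1 * (lambda `^ gamma * enorm xi `^ gamma) / enorm xi ^+ k))) => //.
- exact: measurable_funTS.
- by move=> r _; apply: le_trans (pn _) _; exact: scaled_partial_le.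
Qed.

Lemma phase_partial_le i k xi : (k <= d./2.+1)%N -> xi != 0 ->
  normc (phase_partial i k xi) <= 2 * (nu^-1 * enorm xi `^ gamma) / enorm xi ^+ k.
Proof.
move=> km x0; have [mr mi] := measurable_scaled_partial i km x0.
pose B := nu^-1 * (lambda `^ gamma * enorm xi `^ gamma) / enorm xi ^+ k.
have part (p : R[i] -> R) : (forall z, `|p z| <= normc z) ->
    measurable_fun setT (fun r => p (scaled_partial i k r xi)) ->
    `|\int[lebesgue_measure]_(r in `[s, t]) p (scaled_partial i k r xi)| <= B * tau.
  move=> pn mp; have ip := integrable_scaled_partial pn mp km x0.
  apply: le_trans (le_normr_Rintegral mI ip) _.
  rewrite -Rint_cst; apply: le_Rintegral => //.
  - exact: (integrable_abse ip).
  - exact: icst.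
  - by move=> r _; apply: le_trans (pn _) _; exact: scaled_partial_le.
have BE : B * tau = nu^-1 * enorm xi `^ gamma / enorm xi ^+ k.
  rewrite -[RHS]mul1r -tau_lambda /B; ring.
have h1 := part _ (@normRe_le R) mr; have h2 := part _ (@normIm_le R) mi.
rewrite BE in h1 h2.
have B0 : 0 <= nu^-1 * enorm xi `^ gamma / enorm xi ^+ k.
  by apply: le_trans h1.
rewrite -[leRHS]mulrA -(@ler_pXn2r _ 2) ?nnegrE //; first last.
  by apply: mulr_ge0.
  exact: normc_ge0.
rewrite normc_sqr.
rewrite -[X in X + _]real_normK ?num_real // -[X in _ + X]real_normK ?num_real //.
move: h1 h2; rewrite /phase_partial /cintegral /=.
set q := _ / _ => h1 h2; rewrite exprMn.
have sq (y : R) : `|y| <= q -> `|y| ^+ 2 <= q ^+ 2.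
  by move=> yq; rewrite lerXn2r ?nnegrE ?(le_trans _ yq).
apply: le_trans (lerD (sq _ h1) (sq _ h2)) _.
by have := sqr_ge0 q; lra.
Qed.

Lemma phase_partial_derive i k lo hi xi (c0 : R) : (k < d./2.+1)%N -> 0 < c0 ->
  (forall u, lo < u < hi -> c0 <= enorm (xi + u *: e_ i)) ->
  forall u, lo < u < hi ->
  is_cderive (fun v => phase_partial i k (xi + v *: e_ i)) u
    (phase_partial i k.+1 (xi + u *: e_ i)).
Proof.
move=> km c00 wc u Uu.
have x0 v : lo < v < hi -> xi + v *: e_ i != 0.
  by move=> /wc cv; rewrite -enorm_eq0 gt_eqF // (lt_le_trans c00).
pose c1 := enorm xi + `|lo| + `|hi|.
have wle v : lo < v < hi -> enorm (xi + v *: e_ i) <= c1.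
  move=> /andP[lv vh]; apply: le_trans (enormD_delta_le _ _ _) _.
  rewrite /c1 -addrA lerD2l ler_norml.
  have := ler_norm (- lo); have := ler_norm hi; rewrite normrN.
  have := normr_ge0 lo; have := normr_ge0 hi.
  by move=> ? ? ? ?; apply/andP; split; lra.
pose G := nu^-1 * (lambda `^ gamma * c1 `^ gamma) / c0 ^+ k.+1.
have bG v r : lo < v < hi -> normc (scaled_partial i k.+1 r (xi + v *: e_ i)) <= G.
  move=> Uv; apply: le_trans (scaled_partial_le i r km (x0 v Uv)) _.
  have wv := wc v Uv; have wv1 := wle v Uv.
  have wv0 : 0 < enorm (xi + v *: e_ i) by exact: lt_le_trans wv.
  apply: ler_pM.
  - by rewrite !mulr_ge0 ?powR_ge0 // invr_ge0 ltW.
  - by rewrite invr_ge0 exprn_ge0 // ltW.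
  - rewrite ler_wpM2l ?invr_ge0 ?(ltW nu0) // ler_wpM2l ?powR_ge0 //.
    by apply: ge0_ler_powR; rewrite ?nnegrE ?enorm_ge0 ?(ltW g0) // (le_trans _ wv1) // ltW.
  - by rewrite lef_pV2 ?posrE ?exprn_gt0 // lerXn2r ?nnegrE // ltW.
have part (p : R[i] -> R) : (forall z, `|p z| <= normc z) ->
    (forall (g : R -> R[i]) v z, is_cderive g v z -> is_derive v 1 (fun t => p (g t)) (p z)) ->
    (forall eta, eta != 0 -> measurable_fun setT (fun r => p (scaled_partial i k r eta))) ->
    is_derive u 1 (fun v => \int[lebesgue_measure]_(r in `[s, t])
        p (scaled_partial i k r (xi + v *: e_ i)))
      (\int[lebesgue_measure]_(r in `[s, t]) p (scaled_partial i k.+1 r (xi + u *: e_ i))).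
  move=> pn pd mp.
  apply: (@is_derive_Rintegral R s t lo hi
    (fun v r => p (scaled_partial i k r (xi + v *: e_ i)))
    (fun v r => p (scaled_partial i k.+1 r (xi + v *: e_ i)))
    (fun v => nu^-1 * (lambda `^ gamma * enorm (xi + v *: e_ i) `^ gamma)
       / enorm (xi + v *: e_ i) ^+ k) G) => //.
  - by move=> v Uv; apply: mp; exact: x0.
  - move=> v r Uv; apply: le_trans (pn _) _; apply: scaled_partial_le.
      exact: ltnW.
    exact: x0.
  - move=> v r Uv; apply: (pd (fun v => scaled_partial i k r (xi + v *: e_ i))).
    by apply: scaled_partial_derive => //; exact: x0.
  - by move=> v r Uv; apply: le_trans (pn _) _; exact: bG.
split.
  apply: part; [exact: normRe_le|by move=> g v z []|].
  by move=> eta e0; have [] := measurable_scaled_partial i (ltnW km) e0.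
apply: part; [exact: normIm_le|by move=> g v z []|].
by move=> eta e0; have [] := measurable_scaled_partial i (ltnW km) e0.
Qed.

Definition phase xi : R[i] :=
  cintegral lebesgue_measure `[s, t] (fun r => psi r (lambda *: xi)).

Lemma phaseE i xi : phase xi = phase_partial i 0 xi.
Proof.
rewrite /phase /phase_partial /cintegral; congr (_ +i* _);
  by apply: eq_Rintegral => r _; rewrite /scaled_partial expr0 mul1r.
Qed.

Lemma Re_phase_le (i : 'I_d) xi : xi != 0 -> Re (phase xi) <= - nu * enorm xi `^ gamma.
Proof.
move=> x0; have [mr _] := measurable_scaled_partial i (leq0n d./2.+1) x0.
rewrite (phaseE i).
have -> : - nu * enorm xi `^ gamma = (- nu * (lambda `^ gamma * enorm xi `^ gamma)) * tau.
  rewrite -[LHS]mul1r -tau_lambda; ring.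
rewrite -Rint_cst /phase_partial /cintegral /=; apply: le_Rintegral => //.
- exact: (integrable_scaled_partial (@normRe_le R) mr (leq0n _) x0).
- exact: icst.
- move=> r _; rewrite /scaled_partial expr0 mul1r.
  have := symbol_elliptic Hpsi r (lambda *: xi).
  by rewrite enormZ gtr0_norm ?lambda0 // powRM ?(ltW lambda0) ?enorm_ge0.
Qed.

Variables (a : nat) (b : R).

Definition amplitude xi : R[i] := tau%:C * psi t (lambda *: xi).

(* [qker psi gamma a b s t] is [(2 * pi) ^- d] times the [cfourier] of this function. *)
Definition ker_symbol xi : R[i] :=
  amplitude xi ^+ a * (enorm xi `^ b)%:C * cexp (phase xi).

Lemma amplitude_le xi (i : 'I_d) : xi != 0 ->
  normc (amplitude xi) <= nu^-1 * enorm xi `^ gamma.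
Proof.
move=> x0; rewrite /amplitude Normc.normcM normc_real (ger0_norm (ltW tau0)).
have := scaled_partial_le i t (leq0n d./2.+1) x0.
rewrite /scaled_partial expr0 mul1r expr0 divr1 => H.
apply: le_trans (ler_wpM2l (ltW tau0) H) _.
rewrite -[leRHS]mul1r -tau_lambda.
by rewrite le_eqVlt; apply/orP; left; apply/eqP; ring.
Qed.

Lemma ker_symbol_le xi (i : 'I_d) : xi != 0 ->
  normc (ker_symbol xi) <=
  nu^-1 ^+ a * enorm xi `^ (gamma * a%:R + b) * expR (- nu * enorm xi `^ gamma).
Proof.
move=> x0; have w0 : 0 < enorm xi by rewrite lt_def enorm_ge0 enorm_eq0 x0.
rewrite /ker_symbol !Normc.normcM normc_cexp normc_real (ger0_norm (powR_ge0 _ _)).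
apply: ler_pM.
- by rewrite mulr_ge0 ?normc_ge0 ?powR_ge0.
- exact: expR_ge0.
- rewrite gt0_powRD // mulrA ler_wpM2r ?powR_ge0 // powRrM powR_mulrn ?powR_ge0 // -exprMn.
  have -> : normc (amplitude xi ^+ a) = normc (amplitude xi) ^+ a.
    by elim: (a) => [|k ih]; rewrite ?expr0 ?Normc.normc1 // !exprS Normc.normcM ih.
  by rewrite lerXn2r ?nnegrE ?normc_ge0 ?mulr_ge0 ?powR_ge0 ?invr_ge0 ?(ltW nu0) ?amplitude_le.
- by rewrite ler_expR; exact: (Re_phase_le i x0).
Qed.

Section on_line.
Variables (i : 'I_d) (xi : 'rV[R]_d) (lo hi c0 : R).
Hypotheses (c00 : 0 < c0)
  (wc : forall u, lo < u < hi -> c0 <= enorm (xi + u *: e_ i)).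
Let w u := enorm (xi + u *: e_ i).

Let w0 u : lo < u < hi -> 0 < w u.
Proof. by move=> Uu; exact: lt_le_trans (wc Uu). Qed.

Let x0 u : lo < u < hi -> xi + u *: e_ i != 0.
Proof. by move=> /w0 wu; rewrite -enorm_eq0 gt_eqF. Qed.

Lemma csym_amplitude : csym lo hi w d./2.+1 (fun u => nu^-1 * w u `^ gamma)
  (fun u => amplitude (xi + u *: e_ i)).
Proof.
have -> : (fun u => amplitude (xi + u *: e_ i)) =
    (fun u => tau%:C * scaled_partial i 0 t (xi + u *: e_ i)).
  by apply/funext => u; rewrite /scaled_partial expr0 mul1r.
have E v : nu^-1 * v = normc tau%:C * (nu^-1 * (lambda `^ gamma * v)).
  rewrite normc_real (ger0_norm (ltW tau0)) -[LHS]mul1r -tau_lambda; ring.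
apply: (csym_le w0 (P := fun u => normc tau%:C * (nu^-1 * (lambda `^ gamma * w u `^ gamma)))).
  by move=> u _; rewrite -E.
apply: (csymZ w0).
apply: (csym_chain (D := fun k u => scaled_partial i k t (xi + u *: e_ i))).
  by move=> k u km Uu; apply: scaled_partial_derive => //; exact: x0.
by move=> k u km Uu; apply: scaled_partial_le => //; exact: x0.
Qed.

Lemma csym_phase : csym lo hi w d./2.+1 (fun u => 2 * (nu^-1 * w u `^ gamma))
  (fun u => phase (xi + u *: e_ i)).
Proof.
have -> : (fun u => phase (xi + u *: e_ i)) =
    (fun u => phase_partial i 0 (xi + u *: e_ i)).
  by apply/funext => u; rewrite (phaseE i).
apply: (csym_chain (D := fun k u => phase_partial i k (xi + u *: e_ i))).
  move=> k u km Uu; exact: (phase_partial_derive km c00 wc Uu).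
by move=> k u km Uu; apply: phase_partial_le => //; exact: x0.
Qed.

End on_line.

End fixed_symbol.

End symbol_estimates.

Section kernel_differences.
Context {R : realType} {d : nat}.
Implicit Types (psi : R -> 'rV[R]_d -> R[i]) (xi : 'rV[R]_d).
Local Notation normc := Normc.normc.
Local Notation e_ i := (delta_mx ord0 i).

Lemma enorm_line_ge n (h : R) xi (i : 'I_d) (u : R) :
  2 * n%:R * h <= enorm xi ->
  - (enorm xi / 4) < u < n%:R * h + enorm xi / 4 ->
  enorm xi / 4 <= enorm (xi + u *: e_ i).
Proof.
move=> hx /andP[lu uh].
have := enormD_delta_le (xi + u *: e_ i) i (- u).
rewrite -addrA -scalerDl subrr scale0r addr0 normrN => H.
have : `|u| <= enorm xi * (3 / 4).
  by have := enorm_ge0 xi => x0; rewrite ler_norml; apply/andP; split; lra.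
lra.
Qed.

Lemma iter_diffV_csym_le n (g : 'rV[R]_d -> R[i]) (i : 'I_d) xi (h K sigma : R) P f' :
  let U u := - (enorm xi / 4) < u < n.+1%:R * h + enorm xi / 4 in
  let w u := enorm (xi + u *: e_ i) in
  0 < h -> 2 * n.+1%:R * h <= enorm xi -> 0 <= K -> sigma <= n.+1%:R ->
  (forall u, U u -> is_cderive (fun t => g (xi + t *: e_ i)) u (f' u)) ->
  csym (- (enorm xi / 4)) (n.+1%:R * h + enorm xi / 4) w n P f' ->
  (forall u, U u -> P u / w u ^+ n <= K * w u `^ (sigma - n.+1%:R)) ->
  normc (iter n.+1 (diffV (h *: e_ i)) g xi) <=
    2 * (K * (4^-1) `^ (sigma - n.+1%:R)) * h ^+ n.+1 * enorm xi `^ (sigma - n.+1%:R).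
Proof.
move=> U w h0 hx K0 sn df cf bP.
have x0 : 0 < enorm xi by apply: lt_le_trans hx; rewrite !mulr_gt0.
rewrite -[X in iter _ _ _ X]addr0 -(scale0r (e_ i)) iter_diffVE.
have cU u : U u -> enorm xi / 4 <= w u by exact: enorm_line_ge.
apply: le_trans (csym_iter_diff (M := K * (enorm xi / 4) `^ (sigma - n.+1%:R))
  h0 df cf _ _ _) _.
- move=> u Uu; apply: le_trans (bP u Uu) _; rewrite ler_wpM2l //.
  have wu := cU u Uu.
  rewrite -opprB !powRN lef_pV2 ?posrE ?powR_gt0 ?(lt_le_trans _ wu) ?divr_gt0 //.
  have xw : 0 <= enorm xi / 4 by rewrite divr_ge0 // ltW.
  apply: ge0_ler_powR => //; first by rewrite subr_ge0.
  by rewrite nnegrE; exact: le_trans wu.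
- lra.
- by rewrite add0r ltrDl divr_gt0.
rewrite powRM ?invr_ge0 ?(ltW x0) //.
by rewrite le_eqVlt; apply/orP; left; apply/eqP; ring.
Qed.

Variables (gamma nu : R).
Hypotheses (g0 : 0 < gamma) (nu0 : 0 < nu).
Let n := d./2.
Let m := n.+1.

Lemma phase_line psi s t (i : 'I_d) xi (lo hi c0 : R) :
  let w u := enorm (xi + u *: e_ i) in
  is_symbol gamma nu psi -> s < t -> 0 < c0 ->
  (forall u, lo < u < hi -> c0 <= w u) ->
  [/\ forall u, lo < u < hi -> 0 <= 2 * (nu^-1 * w u `^ gamma),
      forall u, lo < u < hi ->
        normc (cexp (phase gamma psi s t (xi + u *: e_ i))) <= expR (- nu * w u `^ gamma) &
      exists2 E', forall u, lo < u < hi ->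
        is_cderive (fun v => phase gamma psi s t (xi + v *: e_ i)) u (E' u) &
      csym lo hi w n (fun u => 2 * (nu^-1 * w u `^ gamma) / w u) E'].
Proof.
move=> w Hpsi st c00 wc; split.
- by move=> u _; rewrite !mulr_ge0 ?powR_ge0 // invr_ge0 ltW.
- move=> u Uu; rewrite normc_cexp ler_expR; apply: (Re_phase_le g0 Hpsi st i).
  by rewrite -enorm_eq0 gt_eqF // (lt_le_trans c00) // wc.
- by have [_ [E' dE cE]] := csym_phase g0 nu0 Hpsi st c00 wc; exists E'.
Qed.

Lemma cexp_phase_diff_le (sigma : R) : sigma <= gamma -> sigma <= m%:R ->
  exists2 C : R, 0 <= C & forall psi s t, is_symbol gamma nu psi -> s < t ->
  forall (i : 'I_d) (h : R) xi, 0 < h -> 2 * m%:R * h <= enorm xi ->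
    normc (iter m (diffV (h *: e_ i)) (fun xi => cexp (phase gamma psi s t xi)) xi) <=
      C * h ^+ m * enorm xi `^ (sigma - m%:R).
Proof.
move=> sg sm.
have p0 : 0 <= gamma - sigma by rewrite subr_ge0.
have c0 : 0 <= 2 * nu^-1 by rewrite mulr_ge0 // invr_ge0 ltW.
have [Ce Ce0 bCe] := powR_exp_bounded n g0 nu0 p0 c0.
pose K := 2 ^+ (n ^ 2) * (2 * nu^-1) * Ce.
have K0 : 0 <= K by rewrite /K; apply: mulr_ge0 => //; apply: mulr_ge0.
exists (2 * (K * (4^-1) `^ (sigma - m%:R))).
  by apply: mulr_ge0 => //; apply: mulr_ge0 => //; exact: powR_ge0.
move=> psi s t Hpsi st i h xi h0 hx.
have x0 : 0 < enorm xi by apply: lt_le_trans hx; rewrite !mulr_gt0.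
have wc u : - (enorm xi / 4) < u < m%:R * h + enorm xi / 4 ->
    enorm xi / 4 <= enorm (xi + u *: e_ i) by exact: enorm_line_ge.
have x40 : 0 < enorm xi / 4 by rewrite divr_gt0.
have w0 u (Uu : - (enorm xi / 4) < u < m%:R * h + enorm xi / 4) :=
  lt_le_trans x40 (wc u Uu).
have [Q0 eG [E' dE cE]] := phase_line Hpsi st x40 wc.
apply: (iter_diffV_csym_le h0 hx K0 sm
  (f' := fun u => E' u * cexp (phase gamma psi s t (xi + u *: e_ i)))).
- by move=> u Uu; apply: is_cderive_exp; exact: dE.
- exact: (csym_dexp w0 Q0 eG dE cE).
move=> u Uu; have wu := w0 u Uu; move: (enorm _) wu => w wu /=.
have -> : sigma - m%:R = sigma - 1 - n%:R by rewrite /m -natr1; ring.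
have wn : 0 < w ^+ n by rewrite exprn_gt0.
have -> : w `^ (sigma - 1 - n%:R) = w `^ sigma / w / w ^+ n.
  by rewrite !gt0_powRD // powR_invn ?(ltW wu) // powRN powRr1 // ltW.
rewrite !mulrA ler_pM2r ?invr_gt0 // ler_pM2r ?invr_gt0 //.
have -> : w `^ gamma = w `^ (gamma - sigma) * w `^ sigma by rewrite -gt0_powRD // subrK.
have := bCe w wu.
set A := w `^ (gamma - sigma); rewrite /K.
have -> : w `^ gamma = A * w `^ sigma by rewrite -gt0_powRD // subrK.
move=> H.
have S0 := powR_ge0 w sigma.
have D0 : 0 <= 2 ^+ (n ^ 2) * (2 * nu^-1) * w `^ sigma.
  by apply: mulr_ge0 => //; apply: mulr_ge0.
have := ler_wpM2l D0 H.
rewrite (_ : 2 ^+ (n ^ 2) * (2 * nu^-1) * w `^ sigma * Ce =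
  2 ^+ (n ^ 2) * (2 / nu) * Ce * w `^ sigma); last by ring.
apply: le_trans; rewrite le_eqVlt; apply/orP; left; apply/eqP.
move: (_ ^+ n) (_ ^+ (n ^ 2)) (expR _) => *; ring.
Qed.

Lemma ker_symbol_diff_le (a : nat) (b sigma : R) :
  sigma <= gamma * a%:R + b -> sigma <= m%:R ->
  exists2 C : R, 0 <= C & forall psi s t, is_symbol gamma nu psi -> s < t ->
  forall (i : 'I_d) (h : R) xi, 0 < h -> 2 * m%:R * h <= enorm xi ->
    normc (iter m (diffV (h *: e_ i)) (ker_symbol gamma psi s t a b) xi) <=
      C * h ^+ m * enorm xi `^ (sigma - m%:R).
Proof.
move=> sg sm.
have p0 : 0 <= gamma * a%:R + b - sigma by rewrite subr_ge0.
have c0 : 0 <= 2 * nu^-1 by rewrite mulr_ge0 // invr_ge0 ltW.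
have [Ce Ce0 bCe] := powR_exp_bounded m g0 nu0 p0 c0.
have [Cb Cb0 symb] := @csym_enorm_powR R d m b.
pose K1 := 2 ^+ m * (2 ^+ m * ((2 ^+ m * nu^-1) ^+ a * Cb) * 2 ^+ (n ^ 2)).
have K10 : 0 <= K1.
  apply: mulr_ge0 => //; apply: mulr_ge0 => //; apply: mulr_ge0 => //.
  apply: mulr_ge0 => //; apply: exprn_ge0; apply: mulr_ge0 => //.
  by rewrite invr_ge0 ltW.
have K0 : 0 <= K1 * Ce by exact: mulr_ge0.
exists (2 * (K1 * Ce * (4^-1) `^ (sigma - m%:R))).
  by apply: mulr_ge0 => //; apply: mulr_ge0 => //; exact: powR_ge0.
move=> psi s t Hpsi st i h xi h0 hx.
have x0 : 0 < enorm xi by apply: lt_le_trans hx; rewrite !mulr_gt0.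
have wc u : - (enorm xi / 4) < u < m%:R * h + enorm xi / 4 ->
    enorm xi / 4 <= enorm (xi + u *: e_ i) by exact: enorm_line_ge.
have x40 : 0 < enorm xi / 4 by rewrite divr_gt0.
have w0 u (Uu : - (enorm xi / 4) < u < m%:R * h + enorm xi / 4) :=
  lt_le_trans x40 (wc u Uu).
have [Q0 eG [E' dE cE]] := phase_line Hpsi st x40 wc.
have ca := csymX w0 a (csym_amplitude g0 Hpsi st x40 wc).
have := csymM w0 (csymM w0 ca (symb _ _ xi i w0)) (csym_exp w0 Q0 eG dE cE).
move=> [_ [f' df cf]].
apply: (iter_diffV_csym_le h0 hx K0 sm df cf).
move=> u Uu; have wu := w0 u Uu; move: (enorm _) wu => w wu /=.
have -> : w `^ (sigma - m%:R) = w `^ sigma / w / w ^+ n.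
  have -> : sigma - m%:R = sigma - 1 - n%:R by rewrite /m -natr1; ring.
  by rewrite !gt0_powRD // powR_invn ?(ltW wu) // powRN powRr1 // ltW.
have wn : 0 < w ^+ n by rewrite exprn_gt0.
rewrite [leRHS]mulrA ler_pM2r ?invr_gt0 // [leRHS]mulrA ler_pM2r ?invr_gt0 //.
have S0 := powR_ge0 w sigma.
have := ler_wpM2l (mulr_ge0 K10 S0) (bCe w wu).
rewrite (_ : K1 * w `^ sigma * Ce = K1 * Ce * w `^ sigma); last by ring.
apply: le_trans; rewrite le_eqVlt; apply/orP; left; apply/eqP.
have E : w `^ (gamma * a%:R + b - sigma) * w `^ sigma = (w `^ gamma) ^+ a * w `^ b.
  by rewrite -gt0_powRD // subrK gt0_powRD // powRrM powR_mulrn ?powR_ge0.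
have -> : K1 * w `^ sigma * (w `^ (gamma * a%:R + b - sigma) *
    (1 + 2 / nu * w `^ gamma) ^+ m * expR (- nu * w `^ gamma)) =
  K1 * (w `^ (gamma * a%:R + b - sigma) * w `^ sigma) *
    (1 + 2 / nu * w `^ gamma) ^+ m * expR (- nu * w `^ gamma) by ring.
rewrite E /K1 (mulrA 2 nu^-1) (mulrA (2 ^+ m) nu^-1) [(_ * w `^ gamma) ^+ a]exprMn.
move: (_ ^+ a) (_ ^+ m) (_ ^+ (n ^ 2)) (expR _) => *; ring.
Qed.

End kernel_differences.

Section complex_measurability.
Context {dd : measure_display} {T : measurableType dd} {R : realType}.
Implicit Types (f g : T -> R[i]).

Lemma cmeasurable_funM f g : cmeasurable_fun setT f -> cmeasurable_fun setT g ->
  cmeasurable_fun setT (fun x => f x * g x).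
Proof.
move=> [fr fi] [gr gi]; split.
  under eq_fun do rewrite ReM.
  by apply: measurable_funB; exact: measurable_funM.
under eq_fun do rewrite ImM.
by apply: measurable_funD; exact: measurable_funM.
Qed.

Lemma cmeasurable_real (f : T -> R) : measurable_fun setT f ->
  cmeasurable_fun setT (fun x => (f x)%:C).
Proof. by move=> mf; split => //=; exact: measurable_cst. Qed.

Lemma cmeasurable_funX f n : cmeasurable_fun setT f ->
  cmeasurable_fun setT (fun x => f x ^+ n).
Proof.
move=> mf; elim: n => [|n ih].
  by split => /=; exact: measurable_cst.
by under eq_fun do rewrite exprS; exact: cmeasurable_funM.
Qed.

Lemma cmeasurable_cexp f : cmeasurable_fun setT f ->
  cmeasurable_fun setT (fun x => cexp (f x)).
Proof.
move=> [fr fi]; have me := measurableT_comp (@measurable_expR R) fr.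
split; apply: measurable_funM => //.
  by apply: (measurableT_comp _ fi); exact: measurable_cos.
by apply: (measurableT_comp _ fi); exact: measurable_sin.
Qed.

Lemma cmeasurable_cintegral1 (s t : R) (F : R -> T -> R[i]) :
  cmeasurable_fun [set: measurableTypeR R * T] (fun p => F p.1 p.2) ->
  cmeasurable_fun setT (fun x => cintegral lebesgue_measure `[s, t] (fun r => F r x)).
Proof.
have sw : measurable_fun setT
    (fun p : T * measurableTypeR R => (p.2, p.1) : measurableTypeR R * T).
  by apply/measurable_fun_pairP; split; [exact: measurable_snd|exact: measurable_fst].
have m1 : measurable_fun setT (fun p : T * measurableTypeR R => \1_(`[s, t]%classic) p.2 : R).
  by apply: (measurableT_comp _ measurable_snd); exact: measurable_indic.
have part (p : R[i] -> R) :
    measurable_fun setT (fun q : measurableTypeR R * T => p (F q.1 q.2)) ->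
    measurable_fun setT (fun x => \int[lebesgue_measure]_(r in `[s, t]) p (F r x)).
  move=> mp.
  under eq_fun do rewrite Rintegral_mkcond patch_indic.
  apply: (@measurable_fun_Rintegral1 _ _ _ _ _ _
    (fun q : T * measurableTypeR R => p (F q.2 q.1) * \1_(`[s, t]%classic) q.2)).
  apply: measurable_funM m1.
  exact: (measurableT_comp mp sw).
by move=> [mr mi]; split; exact: part.
Qed.

End complex_measurability.

Section kernel_bounds.
Context {R : realType} {d : nat}.
Implicit Types (psi : R -> 'rV[R]_d -> R[i]) (xi : 'rV[R]_d) (f g : 'rV[R]_d -> R[i]).
Local Notation normc := Normc.normc.
Local Notation e_ i := (delta_mx ord0 i).
Local Notation mu := (@lebesgue_rV R d).
Hypothesis d0 : (0 < d)%N.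

Lemma cmeasurable_ker_symbol gamma nu psi s t a b : is_symbol gamma nu psi ->
  cmeasurable_fun setT (@ker_symbol R d gamma psi s t a b).
Proof.
move=> Hpsi; have [mr mi] := symbol_measurable Hpsi.
pose l := (t - s) `^ (- gamma^-1).
have ml : measurable_fun setT (fun xi : 'rV[R]_d => l *: xi).
  apply/measurable_fun_rVP => i; under eq_fun do rewrite mxE.
  by apply: measurable_funM => //; exact: measurable_coord.
have mp (r : R) : measurable_fun setT (fun xi : 'rV[R]_d => (r, l *: xi)).
  by apply/measurable_fun_pairP; split => //; exact: measurable_cst.
apply: cmeasurable_funM; first apply: cmeasurable_funM.
- apply: cmeasurable_funX; apply: cmeasurable_funM.
    by apply: cmeasurable_real; exact: measurable_cst.
  by split; [exact: (measurableT_comp mr (mp t))|exact: (measurableT_comp mi (mp t))].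
- apply: cmeasurable_real.
  exact: (measurableT_comp (measurable_powR b) measurable_enorm).
- apply: cmeasurable_cexp; apply: (@cmeasurable_cintegral1 _ _ R s t (fun r xi => psi r (l *: xi))).
  have mq : measurable_fun setT (fun p : measurableTypeR R * 'rV[R]_d => (p.1, l *: p.2)).
    apply/measurable_fun_pairP; split; first exact: measurable_fst.
    exact: (measurableT_comp ml measurable_snd).
  by split; [exact: (measurableT_comp mr mq)|exact: (measurableT_comp mi mq)].
Qed.

Lemma lebesgue_rV_set0 : mu [set 0] = 0%E.
Proof.
rewrite (_ : [set 0] = [set x : 'rV[R]_d | forall i, [set (0 : R)] (x ord0 i)]); last first.
  apply/seteqP; split => [x -> i|x H]; first by rewrite /= mxE.
  by apply/rowP => i; rewrite mxE; exact: H.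
rewrite (@lebesgue_rV_box R d (fun=> [set 0])); last by move=> i; exact: measurable_set1.
rewrite (eq_bigr (fun=> 0%E)) => [|i _]; last exact: lebesgue_measure_set1.
by rewrite (bigD1 (Ordinal d0)) //= mul0e.
Qed.

Lemma measurable_rV_set0 : measurable [set (0 : 'rV[R]_d)].
Proof.
rewrite (_ : [set 0] = (@enorm R d) @^-1` [set 0]).
  by rewrite -[X in measurable X]setTI; apply: measurable_enorm.
apply/seteqP; split => [x ->|x /= /eqP]; first exact: enorm0.
by rewrite enorm_eq0 => /eqP.
Qed.

(* [is_symbol] does not control [psi r 0], and one point does not affect the transform. *)
Definition punctured (c : R[i]) f xi := if xi == 0 then c else f xi.

Lemma cmeasurable_punctured c f : cmeasurable_fun setT f ->
  cmeasurable_fun setT (punctured c f).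
Proof.
have part (p : R[i] -> R) : measurable_fun setT (fun xi => p (f xi)) ->
    measurable_fun setT (fun xi => p (punctured c f xi)).
  move=> mf; rewrite (_ : (fun xi => _) =
    (fun xi => p (f xi) + (p c - p (f 0)) * \1_[set (0 : 'rV[R]_d)] xi)).
    apply: measurable_funD => //; apply: measurable_funM => //.
    exact: measurable_indic measurable_rV_set0.
  apply/funext => xi; rewrite /punctured indicE; case: eqP => [->|x0].
    by rewrite mem_set // mulr1 addrC subrK.
  by rewrite memNset // mulr0 addr0.
by move=> [fr fi]; split; exact: part.
Qed.

Lemma cfourier_punctured c f x : cmeasurable_fun setT f ->
  cfourier (punctured c f) x = cfourier f x.
Proof.
move=> mf.
have mE : cmeasurable_fun setT (fun xi : 'rV[R]_d => cexp (0 +i* dotrV xi x)).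
  apply: cmeasurable_cexp; split => /=; first exact: measurable_cst.
  by apply: measurable_dotrV; [exact: measurable_id|exact: measurable_cst].
have [fr fi] := cmeasurable_funM mE mf.
have [hr hi] := cmeasurable_funM mE (cmeasurable_punctured c mf).
have part (p : R[i] -> R) :
    measurable_fun setT (fun xi => p (cexp (0 +i* dotrV xi x) * f xi)) ->
    measurable_fun setT (fun xi => p (cexp (0 +i* dotrV xi x) * punctured c f xi)) ->
    \int[mu]_xi p (cexp (0 +i* dotrV xi x) * punctured c f xi) =
    \int[mu]_xi p (cexp (0 +i* dotrV xi x) * f xi).
  move=> m1 m2; congr fine; apply: ae_eq_integral => //.
  - exact/measurable_EFinP.
  - exact/measurable_EFinP.
  - exists [set 0]; split; [exact: measurable_rV_set0|exact: lebesgue_rV_set0|].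
    move=> xi /= H; apply/eqP/negP => x0; apply: H => _.
    by rewrite /punctured (negbTE (introN idP x0)).
by rewrite /cfourier /cintegral; congr (_ +i* _); exact: part.
Qed.

Lemma iter_diff_punctured c m f (h : R) (i : 'I_d) xi :
  0 < h -> 2 * m%:R * h <= enorm xi -> xi != 0 ->
  iter m (diffV (h *: e_ i)) (punctured c f) xi = iter m (diffV (h *: e_ i)) f xi.
Proof.
move=> h0 hx x0; apply: eq_iter_diffV => k km; rewrite /punctured ifN //.
have e0 : 0 < enorm xi by rewrite lt_def enorm_ge0 enorm_eq0 x0.
apply/eqP => xE.
have := enormD_delta_le (xi + k%:R *: (h *: e_ i)) i (- (k%:R * h)).
rewrite scalerA -addrA -scalerDl subrr scale0r addr0 normrN.
rewrite -[in X in _ <= X -> _]scalerA xE enorm0 add0r ger0_norm ?mulr_ge0 ?(ltW h0) //.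
have : k%:R * h <= m%:R * h by rewrite ler_pM2r // ler_nat.
by lra.
Qed.

Lemma integral_normc_le (B0 B1 : R) : 0 <= B0 -> 0 <= B1 ->
  exists C0 : R, forall f, cmeasurable_fun setT f ->
  (forall xi, normc (f xi) <= B0) ->
  (forall xi, 1 <= enorm xi -> normc (f xi) <= B1 * enorm xi `^ (- d.+1%:R)) ->
  (\int[mu]_xi (normc (f xi))%:E <= C0%:E)%E.
Proof.
move=> B00 B10.
have [K K0 HK] := @integral_layer_cake_le R d%:R d.+1%:R (ler0n _ _)
  (eq_rect _ is_true (ltnSn d) _ (esym (ltr_nat R d d.+1))).
exists (B0 * 2 ^+ d + B1 * (K * 2 ^+ d)) => f [mr mi] fB0 fB1.
have mn : measurable_fun setT (fun xi => normc (f xi)) by exact: measurable_normc.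
have mne (D : set 'rV[R]_d) : measurable_fun D (fun xi => (normc (f xi))%:E).
  by apply: measurable_funTS; exact/measurable_EFinP.
pose D : set 'rV[R]_d := [set xi | (1 <= enorm xi)%R].
have mD : measurable D.
  rewrite (_ : D = (@enorm R d) @^-1` `[1, +oo[); last first.
    by apply/seteqP; split => x; rewrite /D /= in_itv /= andbT.
  by rewrite -[X in measurable X]setTI; exact: measurable_enorm.
have mC : measurable (~` D) by exact: measurableC.
have -> : setT = ~` D `|` D by rewrite setUC setUv.
rewrite ge0_integral_setU //=; last 2 first.
- by move=> xi _; rewrite lee_fin normc_ge0.
- by rewrite disj_set2E setICl.
rewrite EFinD; apply: leeD.
  apply: (@le_trans _ _ (\int[mu]_(xi in ~` D) B0%:E)%E).
    apply: ge0_le_integral => //.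
    - by move=> xi _; rewrite lee_fin normc_ge0.
    - by move=> xi _; rewrite lee_fin fB0.
  rewrite integral_cst // EFinM lee_wpmul2l ?lee_fin //.
  apply: (@le_trans _ _ (mu [set x | (enorm x <= 1)%R])).
    apply: le_measure; rewrite ?inE //.
      rewrite (_ : [set x | _] = (@enorm R d) @^-1` `]-oo, 1]); last first.
        by apply/seteqP; split => x /=; rewrite in_itv.
      by rewrite -[X in measurable X]setTI; exact: measurable_enorm.
    by move=> xi /= /negP; rewrite -ltNge => /ltW.
  by have := @lebesgue_enorm_le R d 1 ltr01; rewrite powR1 mulr1.
apply: (@le_trans _ _ (\int[mu]_(xi in D) (B1%:E * (enorm xi `^ (- d.+1%:R))%:E))%E).
  apply: ge0_le_integral => //.
  - by move=> xi _; rewrite lee_fin normc_ge0.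
  - apply: measurable_funTS; apply: measurable_funeM; apply/measurable_EFinP.
    exact: (measurableT_comp (measurable_powR _) measurable_enorm).
rewrite ge0_integralZl //; last 2 first.
- apply: measurable_funTS; apply/measurable_EFinP.
  exact: (measurableT_comp (measurable_powR _) measurable_enorm).
- by move=> xi _; rewrite lee_fin powR_ge0.
rewrite EFinM lee_wpmul2l ?lee_fin //.
have A0 : 0 <= 2 ^+ d :> R by [].
have := HK _ _ mu (@enorm R d) (2 ^+ d) 1 measurable_enorm A0 ltr01 (@lebesgue_enorm_le R d).
by rewrite powR1 mulr1.
Qed.

Lemma cintegrable_normc f : cmeasurable_fun setT f ->
  (\int[mu]_xi (normc (f xi))%:E < +oo)%E -> cintegrable f.
Proof.
move=> [mr mi] fin.
have part (p : R[i] -> R) : (forall z, `|p z| <= normc z) ->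
    measurable_fun setT (fun xi => p (f xi)) ->
    mu.-integrable setT (EFin \o (fun xi => p (f xi))).
  move=> pn mp; apply/integrableP; split; first exact/measurable_EFinP.
  apply: le_lt_trans fin; apply: ge0_le_integral => //=.
  - by apply/measurable_EFinP; apply: measurableT_comp.
  - by apply/measurable_EFinP; exact: measurable_normc.
  - by move=> xi _; rewrite lee_fin.
by split; apply: part => //; [exact: normRe_le|exact: normIm_le].
Qed.

End kernel_bounds.

Section weighted_kernel.
Context {R : realType} {d : nat}.
Implicit Types (psi : R -> 'rV[R]_d -> R[i]) (xi : 'rV[R]_d).
Local Notation normc := Normc.normc.
Local Notation e_ i := (delta_mx ord0 i).
Local Notation mu := (@lebesgue_rV R d).
Hypothesis d0 : (0 < d)%N.
Let m := d./2.+1.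

Lemma normc_fourier_factor_le1 : normc (((2 * pi) ^- d)%:C : R[i]) <= 1.
Proof.
have p1 : 1 <= 2 * pi :> R by have := @pi_ge2 R; lra.
rewrite normc_real ger0_norm ?invr_ge0 ?exprn_ge0 ?mulr_ge0 ?pi_ge0 //.
by rewrite invf_le1 ?exprn_gt0 ?exprn_ege1 // (lt_le_trans ltr01).
Qed.

Lemma weighted_qker_le gamma nu a b (sigma delta B0 B1 C1 C2 : R) :
  0 < delta < sigma -> d%:R + 2 * sigma < 2 * m%:R ->
  0 <= B0 -> 0 <= B1 -> 0 <= C1 -> 0 <= C2 ->
  exists N : R, forall psi s t (c : R[i]), is_symbol gamma nu psi ->
  let g := ker_symbol gamma psi s t a b in
  normc c <= B0 ->
  (forall xi, xi != 0 -> normc (g xi) <= B0) ->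
  (forall xi, xi != 0 -> normc (g xi) <= B1 * enorm xi `^ (- d.+1%:R)) ->
  (forall xi, xi != 0 -> normc (g xi - c) <= C1 * enorm xi `^ sigma) ->
  (forall i (h : R) xi, 0 < h -> 2 * m%:R * h <= enorm xi ->
    normc (iter m (diffV (h *: e_ i)) g xi) <=
      C2 * h ^+ m * enorm xi `^ (sigma - m%:R)) ->
  (\int[mu]_x (normc ((enorm x `^ (d%:R / 2 + delta))%:C *
     qker psi gamma a b s t x) ^+ 2)%R%:E <= N%:E)%E.
Proof.
move=> sd dm B00 B10 C10 C20.
have [C0 HC0] := @integral_normc_le R d B0 B1 B00 B10.
have [N HN] := weighted_cfourier_le C0 d0 sd dm C10 C20.
exists N => psi s t c Hpsi g c1 gB0 gB1 gC1 gC2.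
have mg : cmeasurable_fun setT g := cmeasurable_ker_symbol s t a b Hpsi.
pose g' := punctured c g.
have mg' : cmeasurable_fun setT g' by exact: cmeasurable_punctured.
have I0 : (\int[mu]_xi (normc (g' xi))%:E <= C0%:E)%E.
  apply: HC0 => // xi; rewrite /g' /punctured; first by case: eqP => // /eqP; exact: gB0.
  case: eqP => [->|/eqP x0 _]; last exact: gB1.
  by rewrite enorm0 ler10.
have ig' : cintegrable g' by apply: cintegrable_normc => //; apply: le_lt_trans I0 (ltry _).
have mf : measurable_fun setT (fun x => normc (cfourier g' x)).
  exact: measurable_normc_cfourier.
have E1 xi : normc (g' xi - c) <= C1 * enorm xi `^ sigma.
  rewrite /g' /punctured; case: eqP => [->|/eqP]; last exact: gC1.
  by rewrite subrr Normc.normc0 mulr_ge0 ?powR_ge0.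
have E2 i (h : R) xi : 0 < h -> 2 * m%:R * h <= enorm xi ->
    normc (iter m (diffV (h *: e_ i)) g' xi) <= C2 * h ^+ m * enorm xi `^ (sigma - m%:R).
  move=> h0 hx; rewrite /g' iter_diff_punctured //; first exact: gC2.
  by rewrite -enorm_eq0 gt_eqF // (lt_le_trans _ hx) // !mulr_gt0.
apply: le_trans (HN g' c ig' I0 E1 E2).
have mw : measurable_fun setT (fun x : 'rV[R]_d => enorm x `^ (d%:R / 2 + delta)).
  exact: (measurableT_comp (measurable_powR _) measurable_enorm).
have qE x : normc ((enorm x `^ (d%:R / 2 + delta))%:C * qker psi gamma a b s t x) =
    enorm x `^ (d%:R / 2 + delta) * (normc ((2 * pi) ^- d)%:C * normc (cfourier g' x)).
  rewrite Normc.normcM normc_real (ger0_norm (powR_ge0 _ _)) (cfourier_punctured d0) //.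
  by rewrite -Normc.normcM.
apply: ge0_le_integral => //.
- by move=> x _; rewrite lee_fin sqr_ge0.
- apply/measurable_EFinP; under eq_fun do rewrite qE.
  by apply: measurable_funX; apply: measurable_funM => //; exact: measurable_funM.
- by apply/measurable_EFinP; apply: measurable_funX; exact: measurable_funM.
move=> x _; rewrite lee_fin qE.
rewrite lerXn2r ?nnegrE ?mulr_ge0 ?powR_ge0 ?normc_ge0 //.
by rewrite ler_wpM2l ?powR_ge0 // ler_piMl ?normc_ge0 // normc_fourier_factor_le1.
Qed.

Lemma ker_symbol_decay gamma nu a (b q : R) : 0 < gamma -> 0 < nu ->
  0 <= gamma * a%:R + b + q ->
  exists2 B : R, 0 <= B & forall psi s t, is_symbol gamma nu psi -> s < t ->
  forall xi, xi != 0 ->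
    normc (ker_symbol gamma psi s t a b xi) <= B * enorm xi `^ (- q).
Proof.
move=> g0 nu0 p0.
have [Ce Ce0 bCe] := powR_exp_bounded 0 g0 nu0 p0 (lexx 0).
have n0 : 0 <= nu^-1 ^+ a by rewrite exprn_ge0 // invr_ge0 ltW.
exists (nu^-1 ^+ a * Ce); first exact: mulr_ge0.
move=> psi s t Hpsi st xi x0.
have w0 : 0 < enorm xi by rewrite lt_def enorm_ge0 enorm_eq0 x0.
apply: le_trans (ker_symbol_le g0 nu0 Hpsi st a b (Ordinal d0) x0) _.
have := bCe _ w0; rewrite expr0 mulr1 => H.
rewrite -!mulrA ler_wpM2l //.
rewrite (_ : gamma * a%:R + b = gamma * a%:R + b + q + - q); last by rewrite addrK.
rewrite gt0_powRD // mulrAC ler_wpM2r ?powR_ge0 //.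
Qed.

Lemma cexp_phase_sub1_le gamma nu (sigma : R) : 0 < gamma -> 0 < nu ->
  0 <= sigma <= gamma ->
  exists2 C : R, 0 <= C & forall psi s t, is_symbol gamma nu psi -> s < t ->
  forall xi, xi != 0 ->
    normc (cexp (phase gamma psi s t xi) - 1) <= C * enorm xi `^ sigma.
Proof.
move=> g0 nu0 /andP[s0 sg].
have v0 : 0 <= 3 * (2 * nu^-1) by rewrite !mulr_ge0 // invr_ge0 ltW.
exists (3 * (2 * nu^-1) + 2); first by rewrite addr_ge0.
move=> psi s t Hpsi st xi x0.
have w0 : 0 < enorm xi by rewrite lt_def enorm_ge0 enorm_eq0 x0.
have Re0 := Re_phase_le g0 Hpsi st (Ordinal d0) x0.
have {}Re0 : complex.Re (phase gamma psi s t xi) <= 0.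
  by apply: le_trans Re0 _; rewrite mulNr oppr_le0 mulr_ge0 ?powR_ge0 // ltW.
have S0 := powR_ge0 (enorm xi) sigma.
have [x1|x1] := leP (enorm xi) 1.
  apply: le_trans (normc_cexpB1_le Re0) _.
  have := phase_partial_le g0 Hpsi st (Ordinal d0) (leq0n _) x0.
  rewrite -phaseE expr0 divr1 => H.
  have H2 : enorm xi `^ gamma <= enorm xi `^ sigma.
    rewrite -(subrK sigma gamma) gt0_powRD // ler_piMl //.
    have := @ge0_ler_powR R (gamma - sigma) _ (enorm xi) 1.
    by rewrite powR1; apply; rewrite ?nnegrE ?subr_ge0 ?enorm_ge0.
  apply: (@le_trans _ _ (3 * (2 * nu^-1) * enorm xi `^ sigma)).
    apply: le_trans (ler_wpM2l (ler0n _ 3) H) _.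
    by rewrite !mulrA ler_wpM2l // -!mulrA.
  by rewrite ler_wpM2r // lerDl.
apply: le_trans (normcB _ _) _.
rewrite normc_cexp Normc.normc1.
have e1 : expR (complex.Re (phase gamma psi s t xi)) <= 1 by rewrite -expR0 ler_expR.
have S1 : 1 <= enorm xi `^ sigma.
  have := @ge0_ler_powR R sigma s0 1 (enorm xi).
  by rewrite powR1; apply; rewrite ?nnegrE ?(ltW x1) ?enorm_ge0.
apply: (@le_trans _ _ (2 * enorm xi `^ sigma)).
  by move: e1 S1; set u := expR _; set v := _ `^ _; move=> *; lra.
by rewrite ler_wpM2r // lerDr.
Qed.

End weighted_kernel.

Unset Implicit Arguments.
Set Strict Implicit.
Set Printing Implicit Defensive.

Theorem lemma3p5 (R : realType) (d : nat) (gamma nu : R) (a : nat) (b delta : R)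
  (hd : (0 < d)%N) (hgamma : 0 < gamma) (hnu : 0 < nu) (hb : 0 <= b)
  (hab : (a = 0%N /\ b = 0) \/ 0 < gamma * a%:R + b)
  (hdelta0 : 0 < delta)
  (hdelta1 : 0 < gamma * a%:R + b ->
     delta < Num.min (1 / 2) (gamma * a%:R + b))
  (hdelta2 : a = 0%N /\ b = 0 -> delta < Num.min (1 / 2) gamma) :
  exists N : R, forall psi : R -> 'rV[R]_d -> R[i], is_symbol gamma nu psi ->
    (ereal_sup [set \int[lebesgue_rV d]_x
        (Normc.normc ((enorm x `^ (d%:R / 2 + delta))%:C *
            qker psi gamma a b st.1 st.2 x) ^+ 2)%R%:E
      | st in [set st : R * R | (st.1 < st.2)%R]] <= N%:E)%E.
Proof.
have dm (sigma : R) : sigma < 1 / 2 -> d%:R + 2 * sigma < 2 * d./2.+1%:R.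
  have : (d%:R : R) <= 1 + 2 * d./2%:R.
    rewrite -[in leLHS](odd_double_half d) natrD -mul2n natrM lerD2r.
    by rewrite lern1 leq_b1.
  by rewrite -[d./2.+1%:R]natr1; lra.
have ab0 : 0 <= gamma * a%:R + b by rewrite addr_ge0 // mulr_ge0 // ltW.
have ab0' : 0 <= gamma * a%:R + b + 0 by rewrite addr0.
have abd : 0 <= gamma * a%:R + b + d.+1%:R by rewrite addr_ge0.
have [B0 B00 HB0] := ker_symbol_decay hd hgamma hnu ab0'.
have [B1 B10 HB1] := ker_symbol_decay hd hgamma hnu abd.
have sm (sigma : R) : sigma < 1 / 2 -> sigma <= d./2.+1%:R.
  by move=> s2; have : 0 <= d./2%:R :> R by []; rewrite -[d./2.+1%:R]natr1; lra.
have mid (y : R) : delta < Num.min (1 / 2) y ->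
    exists sigma, [/\ delta < sigma, sigma < 1 / 2 & sigma < y].
  move=> dy; have [d1 d2] := midf_lt dy; exists ((delta + Num.min (1 / 2) y) / 2).
  by move: d2; rewrite lt_min => /andP[].
pose g psi s t := ker_symbol gamma psi s t a b : 'rV[R]_d -> R[i].
have [sigma [C1 [C2 [c [ds s2 [C10 C20] c1 gC]]]]] :
    exists sigma C1 C2 (c : R[i]), [/\ delta < sigma, sigma < 1 / 2, 0 <= C1 /\ 0 <= C2,
      Normc.normc c <= 1 & forall psi s t, is_symbol gamma nu psi -> s < t ->
      (forall xi, xi != 0 -> Normc.normc (g psi s t xi - c) <= C1 * enorm xi `^ sigma) /\
      (forall i (h : R) xi, 0 < h -> 2 * d./2.+1%:R * h <= enorm xi ->
        Normc.normc (iter d./2.+1 (diffV (h *: delta_mx ord0 i)) (g psi s t) xi) <=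
          C2 * h ^+ d./2.+1 * enorm xi `^ (sigma - d./2.+1%:R))].
  case: hab => [ab00|abp].
    have [sigma [ds s2 sg]] := mid _ (hdelta2 ab00).
    have s0 : 0 <= sigma <= gamma by rewrite !ltW // (lt_trans hdelta0).
    have [C1 C10 HC1] := cexp_phase_sub1_le hd hgamma hnu s0.
    have [C2 C20 HC2] := @cexp_phase_diff_le R d gamma nu hgamma hnu sigma (ltW sg) (sm _ s2).
    exists sigma, C1, C2, 1; split => //; first by rewrite Normc.normc1.
    move=> psi s t Hpsi st.
    have -> : g psi s t = fun xi => cexp (phase gamma psi s t xi).
      by apply/funext => xi; rewrite /g /ker_symbol ab00.1 ab00.2 powRr0 expr0 !mul1r.
    by split; [exact: HC1|exact: HC2].
  have [sigma [ds s2 sg]] := mid _ (hdelta1 abp).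
  have abs : 0 <= gamma * a%:R + b + - sigma by rewrite subr_ge0 ltW.
  have [C1 C10 HC1] := ker_symbol_decay hd hgamma hnu abs.
  have [C2 C20 HC2] := @ker_symbol_diff_le R d gamma nu hgamma hnu a b sigma (ltW sg) (sm _ s2).
  exists sigma, C1, C2, 0; split => //; first by rewrite Normc.normc0.
  move=> psi s t Hpsi st; split; last exact: HC2.
  by move=> xi x0; rewrite subr0 -[sigma in leRHS]opprK; exact: HC1.
have B01 : 0 <= B0 + 1 by rewrite addr_ge0.
have ds' : 0 < delta < sigma by rewrite hdelta0.
have [N HN] := @weighted_qker_le R d hd gamma nu a b sigma delta (B0 + 1) B1 C1 C2
  ds' (dm _ s2) B01 B10 C10 C20.
exists N => psi Hpsi; apply: ge_ereal_sup => _ [[s t] /= st <-].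
have [g1 g2] := gC psi s t Hpsi st.
apply: (HN psi s t c Hpsi _ _ _ g1 g2) => [|xi x0|xi x0]; first by rewrite (le_trans c1) // lerDr.
  have := HB0 _ _ _ Hpsi st xi x0; rewrite oppr0 powRr0 mulr1 => /le_trans; apply.
  by rewrite lerDl.
exact: HB1.
Qed.
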